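(* Fix $\gamma\in(0,\infty)\setminus\mathbb{N}$ and set $k=\lfloor\gamma\rfloor+1$, $m=1-2[\gamma]$. Let $L_{2k}=\Delta_m^k$ and let $\mathcal{B}^{2\gamma}=\{B_{2j}^{2\gamma}:0\le j\le\lfloor\gamma\rfloor\}\cup\{B_{2[\gamma]+2j}^{2\gamma}:0\le j\le\lfloor\gamma\rfloor\}$ be the associated boundary operators. Let $\widehat{L}_{2k}$ and $\widehat{\mathcal{B}}^{2\gamma}=\{\widehat{B}_{2\alpha}^{2\gamma}\}$ denote the same operators defined in terms of the inverted metric $\widehat{g}:=r^{-4}(dx^2+dy^2)$ and $\widehat{y}:=r^{-2}y$. Then, as operators (with powers of $r$ and $\overline{r}$ acting by multiplication), \begin{align*} \widehat{L}_{2k}&=r^{n-2[\gamma]+4+2\lfloor\gamma\rfloor}\,L_{2k}\,r^{2\gamma-n},\\ \widehat{B}_{2\alpha}^{2\gamma}&=\overline{r}^{\,n-2\gamma+4\alpha}\,B_{2\alpha}^{2\gamma}\,r^{2\gamma-n} \end{align*} for all $\widehat{B}_{2\alpha}^{2\gamma}\in\widehat{\mathcal{B}}^{2\gamma}$.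
   Context: $\mathbb{R}_+^{n+1}=\mathbb{R}^n\times(0,\infty)$, $n\ge1$, with coordinates $(x,y)$ and boundary $\mathbb{R}^n=\mathbb{R}^n\times\{0\}$; $\Delta=\sum_i\partial_{x_i}^2+\partial_y^2$, $\overline{\Delta}=\sum_i\partial_{x_i}^2$. $r=(|x|^2+y^2)^{1/2}$ and $\overline{r}=|x|$ on $\mathbb{R}^n$. For $\gamma\in(0,\infty)\setminus\mathbb{N}$: $\lfloor\gamma\rfloor$ is the integer part, $[\gamma]=\gamma-\lfloor\gamma\rfloor$, $m=1-2[\gamma]$, $\Delta_m=\Delta+my^{-1}\partial_y$, $T=\partial_y^2+my^{-1}\partial_y$, and $\iota^\ast$ is restriction to $y=0$. The operators act on functions on $\overline{\mathbb{R}_+^{n+1}}\setminus\{0\}$ of the form $F+y^{2[\gamma]}G$ with $F,G$ smooth on $\overline{\mathbb{R}_+^{n+1}}\setminus\{0\}$ and having Taylor expansions in $y$ at $y=0$ with only even powers (boundary operators take values in $C^\infty(\mathbb{R}^n\setminus\{0\})$). Boundary operators, for integers $0\le j\le\lfloor\gamma\rfloor$, defined recursively (empty sums are zero): $$B_{2j}^{2\gamma}=(-1)^j\iota^\ast\circ T^j-\sum_{\ell=1}^j\binom{j}{\ell}\frac{\Gamma(1+j-[\gamma])\Gamma(1+2j-2\ell-\gamma)}{\Gamma(1+j-\ell-[\gamma])\Gamma(1+2j-\ell-\gamma)}\overline{\Delta}^\ell B_{2j-2\ell}^{2\gamma},$$ $$B_{2[\gamma]+2j}^{2\gamma}=(-1)^{j+1}\iota^\ast\circ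 y^m\partial_yT^j-\sum_{\ell=1}^j\binom{j}{\ell}\frac{\Gamma(1+j+[\gamma])\Gamma(1+2j-2\ell-\lfloor\gamma\rfloor+[\gamma])}{\Gamma(1+j-\ell+[\gamma])\Gamma(1+2j-\ell-\lfloor\gamma\rfloor+[\gamma])}\overline{\Delta}^\ell B_{2[\gamma]+2j-2\ell}^{2\gamma}.$$ Hatted operators: the inversion $\Phi(x,y)=(x,y)/r^2$ is an involution of $\overline{\mathbb{R}_+^{n+1}}\setminus\{0\}$ with $\Phi^\ast(dx^2+dy^2)=\widehat{g}$ and $\Phi^\ast y=\widehat{y}$. Hence an operator $A$ (one of $L_{2k}$, $B_{2\alpha}^{2\gamma}$) built from the Euclidean metric and $y$ becomes, when built instead from $\widehat{g}$ and $\widehat{y}$, the operator $\widehat{A}U=\bigl(A(U\circ\Phi)\bigr)\circ\Phi$ (with $\Phi$ restricted to $\mathbb{R}^n\setminus\{0\}$, i.e. $x\mapsto x/|x|^2$, in the outer composition for boundary operators). *)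

(* Defs.v *)
From HB Require Import structures.
From mathcomp Require Import all_boot all_order all_algebra.
From mathcomp Require Import all_classical all_reals all_analysis.
Set Implicit Arguments.
Unset Strict Implicit.
Unset Printing Implicit Defensive.
Import Order.TTheory GRing.Theory Num.Theory.
Import numFieldNormedType.Exports.

Local Open Scope classical_set_scope.
Local Open Scope ring_scope.

(* Points (x, y) of R^(n+1), with x in R^n and y in R. *)
Notation hpoint R n := ('rV[R]_n * R)%type (only parsing).

Section GammaFunction.
Context {R : realType}.
Implicit Type t : R.

Definition Gamma_pos t : R :=
  (\int[lebesgue_measure]_(u in `]0, +oo[) (u `^ (t - 1) * expR (- u)))%R.

(* [Num.truncn (1 - t)] is the least N : nat with 0 < t + N, so that the
   shifted Euler integral converges; this is the usual extension of Gamma by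
   Gamma (t + 1) = t * Gamma t to all t outside {0, -1, -2, ...}. *)
Definition Gamma t : R :=
  let N := Num.truncn (1 - t) in
  Gamma_pos (t + N%:R) / \prod_(i < N) (t + i%:R).

End GammaFunction.

Section HalfSpace.
Context {R : realType} {n : nat}.

Implicit Types (x : 'rV[R]_n) (p : hpoint R n).
Implicit Types (f : 'rV[R]_n -> R) (U : hpoint R n -> R).

(* The Euclidean norms; the library norm on row vectors is the sup norm. *)
Definition r_bdry x : R := Num.sqrt (\sum_(i < n) x 0 i ^+ 2).
Definition r_half p : R := Num.sqrt (\sum_(i < n) p.1 0 i ^+ 2 + p.2 ^+ 2).

Definition e_x (i : 'I_n) : hpoint R n := (delta_mx 0 i, 0).
Definition e_y : hpoint R n := (0, 1).

(* The closed half-space minus the origin. *)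
Definition chalf0 : set (hpoint R n) := [set p | 0 <= p.2 /\ p <> 0].

(* All iterated directional derivatives are differentiable on W; as the space
   is finite-dimensional this is infinite differentiability. *)
Definition smooth_on (W : set (hpoint R n)) U : Prop :=
  forall (vs : seq (hpoint R n)) p, W p ->
    differentiable (foldr (fun v (V : hpoint R n -> R) => 'D_v V) U vs) p.

(* Smooth up to the boundary (i.e. with a smooth extension to an open set
   containing [chalf0]), with only even powers of y in the Taylor expansions
   at y = 0. *)
Definition smooth_even U : Prop :=
  exists (W : set (hpoint R n)) (V : hpoint R n -> R),
    [/\ open W, chalf0 `<=` W, smooth_on W V,
        (forall p, chalf0 p -> U p = V p) &
        forall (k : nat) x, x <> 0 ->
          iter (2 * k + 1) (fun Z : hpoint R n -> R => 'D_e_y Z) V (x, 0) = 0].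

Definition lapl U : hpoint R n -> R := fun p =>
  \sum_(i < n) 'D_(e_x i) ('D_(e_x i) U) p + 'D_e_y ('D_e_y U) p.

Definition laplbar f : 'rV[R]_n -> R := fun x =>
  \sum_(i < n) 'D_(delta_mx 0 i : 'rV[R]_n) ('D_(delta_mx 0 i : 'rV[R]_n) f) x.

Definition laplm (m : R) U : hpoint R n -> R := fun p =>
  lapl U p + m * (p.2)^-1 * 'D_e_y U p.

Definition Top (m : R) U : hpoint R n -> R := fun p =>
  'D_e_y ('D_e_y U) p + m * (p.2)^-1 * 'D_e_y U p.

(* Restriction to y = 0, as the boundary value taken from y > 0: the functions
   it is applied to, such as y^m d_y T^j U, are given by their formulas for
   y > 0 and extend continuously to y = 0. *)
Definition restr0 U : 'rV[R]_n -> R := fun x => lim (U (x, y) @[y --> 0^'+]).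

Definition inv_bdry x : 'rV[R]_n := (r_bdry x ^- 2) *: x.
Definition inv_half p : hpoint R n := (r_half p ^- 2) *: p.

(* The operator A built from the metric r^-4 (dx^2 + dy^2) and r^-2 y in place
   of the Euclidean metric and y: these are the pullbacks under the inversion,
   so A gets conjugated by the inversion. *)
Definition hat_int (A : (hpoint R n -> R) -> hpoint R n -> R) U :
    hpoint R n -> R :=
  A (U \o inv_half) \o inv_half.
Definition hat_bdry (A : (hpoint R n -> R) -> 'rV[R]_n -> R) U :
    'rV[R]_n -> R :=
  A (U \o inv_half) \o inv_bdry.

End HalfSpace.

Section Operators.
Context {R : realType} {n : nat}.
Variable gamma : R.

Definition intpart : nat := Num.truncn gamma.
Definition fracpart : R := gamma - intpart%:R.
Definition mwt : R := 1 - 2 * fracpart.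

Definition adapted (U : hpoint R n -> R) : Prop :=
  exists F G : hpoint R n -> R, [/\ smooth_even F, smooth_even G &
    forall p, chalf0 p -> U p = F p + p.2 `^ (2 * fracpart) * G p].

Definition Lop (U : hpoint R n -> R) : hpoint R n -> R :=
  iter intpart.+1 (laplm mwt) U.

Definition cB_even (j l : nat) : R :=
  'C(j, l)%:R *
  ((Gamma (1 + j%:R - fracpart) * Gamma (1 + 2 * j%:R - 2 * l%:R - gamma)) /
   (Gamma (1 + j%:R - l%:R - fracpart) * Gamma (1 + 2 * j%:R - l%:R - gamma))).

Definition cB_odd (j l : nat) : R :=
  'C(j, l)%:R *
  ((Gamma (1 + j%:R + fracpart) *
      Gamma (1 + 2 * j%:R - 2 * l%:R - intpart%:R + fracpart)) /
   (Gamma (1 + j%:R - l%:R + fracpart) *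
      Gamma (1 + 2 * j%:R - l%:R - intpart%:R + fracpart))).

(* [B_even j] and [B_odd j] are the operators of orders 2j and 2[gamma] + 2j.
   For the guard condition the sums below run over i = l - 1; the recursions
   in their original form are [B_evenE] and [B_oddE]. *)
Fixpoint B_even (j : nat) (U : hpoint R n -> R) (x : 'rV[R]_n) {struct j} : R :=
  (-1) ^+ j * restr0 (iter j (Top mwt) U) x -
  match j with
  | 0 => 0
  | j'.+1 => \sum_(i < j'.+1)
      cB_even j i.+1 * iter i.+1 laplbar (B_even (j' - i) U) x
  end.

Fixpoint B_odd (j : nat) (U : hpoint R n -> R) (x : 'rV[R]_n) {struct j} : R :=
  (-1) ^+ j.+1 *
    restr0 (fun p => p.2 `^ mwt * 'D_e_y (iter j (Top mwt) U) p) x -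
  match j with
  | 0 => 0
  | j'.+1 => \sum_(i < j'.+1)
      cB_odd j i.+1 * iter i.+1 laplbar (B_odd (j' - i) U) x
  end.

Lemma B_evenE (j : nat) (U : hpoint R n -> R) (x : 'rV[R]_n) :
  B_even j U x = (-1) ^+ j * restr0 (iter j (Top mwt) U) x -
    \sum_(1 <= l < j.+1) cB_even j l * iter l laplbar (B_even (j - l) U) x.
Proof.
case: j => [|j]; first by rewrite big_geq.
by rewrite big_add1 /= big_mkord.
Qed.

Lemma B_oddE (j : nat) (U : hpoint R n -> R) (x : 'rV[R]_n) :
  B_odd j U x =
    (-1) ^+ j.+1 *
      restr0 (fun p => p.2 `^ mwt * 'D_e_y (iter j (Top mwt) U) p) x -
    \sum_(1 <= l < j.+1) cB_odd j l * iter l laplbar (B_odd (j - l) U) x.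
Proof.
case: j => [|j]; first by rewrite big_geq.
by rewrite big_add1 /= big_mkord.
Qed.

(* [bdry_op alpha B]: B is the member of order 2 alpha of the family of
   boundary operators. *)
Inductive bdry_op : R -> ((hpoint R n -> R) -> 'rV[R]_n -> R) -> Prop :=
| bdry_even (j : nat) : (j <= intpart)%N -> bdry_op j%:R (B_even j)
| bdry_odd (j : nat) : (j <= intpart)%N -> bdry_op (fracpart + j%:R) (B_odd j).

End Operators.

(* Main.v *)
Require Import Defs.
From HB Require Import structures.
From mathcomp Require Import all_boot all_order all_algebra.
From mathcomp Require Import all_classical all_reals all_analysis.
From mathcomp Require Import measurable_realfun ring lra.
Set Implicit Arguments.
Unset Strict Implicit.
Unset Printing Implicit Defensive.
Import Order.TTheory GRing.Theory Num.Theory.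
Import numFieldNormedType.Exports.
Local Open Scope classical_set_scope.
Local Open Scope ring_scope.

(** Write K_a V = r^a (V o Phi), E for the Euler field and N = n + 1 + m. Everything
    rests on the formula
      D_v (K_a V) = K_(a-2) (D_v V) + <v, p> K_(a-2) (a V - 2 E V),
    which gives Delta_m (K_a V) = K_(a-2) (r^2 Delta_m V - 2 (a + N - 2) E V
    + a (a + N - 2) V).

    Interior: with A = Delta_m and a = 2k + 2 - N, the function
    V = r^2 A U - 4 k E U + 2 k (2k + 2 - N) U satisfies A^k V = r^2 A^(k+1) U by the
    sl_2 relations between A, r^2 and E. Induction on k gives
    A^k K_(2k-N) = K_(-2k-N) A^k.

    Boundary: by the recurrence of Gamma, the recursion defining phi_i = B_(2i) U is
    equivalent to the expansion U ~ sum_i y^(2i) P_i at y = 0, where P_i is the power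
    series solution, with boundary value proportional to phi_i, of Delta_m P_i = 0 for
    the weight m = 1 + 2 (2i - gamma). The Kelvin transform K_(2 gamma - n) maps
    y^(2i) P_i to y^(2i) K_(2 gamma - n - 4i) P_i, and K_(2 gamma - n - 4i) preserves
    the equation Delta_m = 0 for exactly this m. By uniqueness of the power series
    solutions, the boundary operators of K_(2 gamma - n) U are the transforms of the
    phi_i. For the odd operators, factor out y^(2[gamma]) and replace [gamma] by
    -[gamma]. *)

(** * Calculus on the half-space *)

(** Off the origin, V = U o Phi turns r^(2 gamma - n) U into K_(2 gamma - n) V because Phi is an
    involution. Both identities thus become intertwining relations for Kelvin transforms, and the
    interior weight fits because 2k - N = 2 gamma - n. At the boundary the terms of the recursion
    are not separately covariant. Rewriting it as an expansion isolates the functions phi_i, each of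
    which transforms on its own. The weight of P_i is read off the Gamma quotients: with d = l - i,
    consecutive coefficients have ratio -1 / (4 (d + 1) (d + 1 + 2i - gamma)), which is the ratio
    for Delta_m at m = 1 + 2 (2i - gamma). These denominators are nonzero because gamma is not an
    integer, and this gives uniqueness. The series need not converge, so the P_i are truncated and
    only finitely many normal derivatives at y = 0 are compared. The truncation error stays
    invisible after the Kelvin transform because normal derivatives of one parity mix only among
    themselves. *)

Lemma near_eq_differentiable {R : realType} {T M : normedModType R} (U V : T -> M) (p : T) :
  (\near p, U p = V p) -> differentiable U p -> differentiable V p.
Proof.
move=> UV dU; have UVp : U p = V p by exact: nbhs_singleton UV.
have [c e] := (diff_locallyP _ _).1 dU.
have e' : V \o shift p = cst (V p) + 'd U p +o_ 0 id.
  move: e => /eqaddoP e; apply/eqaddoP => eps eps0.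
  have e1 := e eps eps0.
  have UV0 : \forall h \near 0, U (h + p) = V (h + p).
    by move: UV; rewrite {1}[\near p, _](near_shift 0) subr0.
  near=> h.
  have UVh : (U \o shift p \- (cst (U p) + 'd U p)) h =
             (V \o shift p \- (cst (V p) + 'd U p)) h.
    by rewrite !fctE /= UVp (near UV0 h).
  suff : `|(U \o shift p \- (cst (U p) + 'd U p)) h| <= eps * `|h|.
    by rewrite UVh.
  by near: h.
by apply/diff_locallyP; rewrite (diff_unique c e').
Unshelve. all: by end_near. Qed.

Section Calculus.
Context {R : realType} {n : nat}.
Local Notation pt := ('rV[R]_n * R)%type.
Implicit Types (p q v w : pt) (U V Z : pt -> R) (W : set pt) (o : option 'I_n).

(** [None] stands for the normal variable y and [Some i] for x_i, so that sums over all n + 1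
    directions range over one finite type. *)
Definition coord o p : R := if o is Some i then p.1 0 i else p.2.
Definition basis o : pt := if o is Some i then e_x i else e_y.

Lemma sum_option (M : nmodType) (F : option 'I_n -> M) :
  \sum_o F o = F None + \sum_(i < n) F (Some i).
Proof.
rewrite (bigD1 None) //=; congr (_ + _).
rewrite (reindex_omap Some id) //=; last by case.
by apply: eq_bigl => i; rewrite eqxx.
Qed.

Lemma fst_sum (I : finType) (F : I -> pt) :
  (\sum_i F i).1 = \sum_i (F i).1.
Proof. by rewrite (big_morph fst (id1 := 0) (op1 := +%R)). Qed.

Lemma snd_sum (I : finType) (F : I -> pt) :
  (\sum_i F i).2 = \sum_i (F i).2.
Proof. by rewrite (big_morph snd (id1 := 0) (op1 := +%R)). Qed.

Lemma point_sum p : p = \sum_o coord o p *: basis o.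
Proof.
rewrite sum_option /=; case: p => x y /=; congr (_, _).
  rewrite fst_sum /= scaler0 add0r; apply/rowP => j.
  rewrite summxE (bigD1 j) //= !mxE !eqxx mulr1 big1 ?addr0// => i ij.
  by rewrite !mxE eqxx /= eq_sym (negbTE ij) mulr0.
rewrite snd_sum big1 => [|i _]; last exact: mulr0.
by rewrite addr0; apply/esym/mulr1.
Qed.

Lemma coord_basis o o' : coord o (basis o') = (o == o')%:R.
Proof.
by case: o o' => [i|] [j|] //=; rewrite ?mxE //= eqxx.
Qed.

Lemma coordD o p q : coord o (p + q) = coord o p + coord o q.
Proof. by case: o => [i|] //=; rewrite mxE. Qed.

Lemma coordZ o k p : coord o (k *: p) = k * coord o p.
Proof. by case: o => [i|] //=; rewrite mxE. Qed.

Lemma differentiable_coordp o p : differentiable (coord o) p.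
Proof.
case: o => [i|].
  apply: (@differentiable_comp _ _ _ _ (@fst _ _) (fun x : 'rV[R]_n => x 0 i)).
    apply: (@linear_differentiable R pt _ (@fst _ _ : {linear pt -> 'rV[R]_n})).
    by move=> q; exact: cvg_fst.
  exact: differentiable_coord.
apply: (@linear_differentiable R pt R (@snd _ _ : {linear pt -> R^o})).
by move=> q; exact: cvg_snd.
Qed.

Lemma derive_coord o v p : 'D_v (coord o) p = coord o v.
Proof.
apply: cvg_lim => //; apply: cvg_near_cst.
exists 1 => //= h _ h0; rewrite coordD coordZ addrK.
by rewrite /GRing.scale /= mulrA mulVf ?mul1r.
Qed.

Lemma derive_dir V v p : differentiable V p ->
  'D_v V p = \sum_o coord o v * 'D_(basis o) V p.
Proof.
move=> dV; rewrite deriveE// [in LHS](point_sum v) linear_sum.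
by apply: eq_bigr => o _; rewrite linearZ /= deriveE.
Qed.

(** [smooth_on] quantifies over words of derivatives, which gives no direct induction for products:
    the Leibniz rule needs each factor both differentiated and undifferentiated. Stratifying by the
    order k provides one. *)
Fixpoint Ck k W U : Prop :=
  (forall p, W p -> differentiable U p) /\
  (if k is k'.+1 then forall v, Ck k' W ('D_v U) else True).

Lemma Ck_diff k W U p : Ck k W U -> W p -> differentiable U p.
Proof. by case: k => [|k] [+ _]; exact. Qed.

Lemma CkS k W U : Ck k.+1 W U -> Ck k W U.
Proof.
elim: k U => [|k IH] U [dU DU]; split => // v.
by apply: IH; exact: DU.
Qed.

Lemma smooth_onP W U : smooth_on W U <-> forall k, Ck k W U.
Proof.
split=> [sU k|cU vs p Wp].
  elim: k U sU => [|k IH] U sU.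
    by split=> // p; exact: (sU [::]).
  split=> [p|v]; first exact: (sU [::]).
  by apply: IH => vs p Wp; have := sU (rcons vs v) p Wp; rewrite foldr_rcons.
have {cU} := cU (size vs).
(* The last letter of the word is the derivative applied first to [U]. *)
elim/last_ind: vs U => [|vs v IH] U /=; first by move=> [+ _]; exact.
by rewrite size_rcons foldr_rcons => -[_ /(_ v)]; exact: IH.
Qed.

Lemma eqon_derive W U V v p : open W -> (forall q, W q -> U q = V q) ->
  W p -> 'D_v U p = 'D_v V p.
Proof.
move=> oW UV Wp; apply: near_eq_derive.
by apply: filterS UV _; exact: open_nbhs_nbhs.
Qed.

Lemma eqon_Ck k W U V : open W -> (forall q, W q -> U q = V q) ->
  Ck k W U -> Ck k W V.
Proof.
move=> oW; have diffV U' V' : (forall q, W q -> U' q = V' q) ->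
    (forall p, W p -> differentiable U' p) -> forall p, W p -> differentiable V' p.
  move=> UV dU p Wp; apply: near_eq_differentiable (dU p Wp).
  by apply: filterS UV _; exact: open_nbhs_nbhs.
elim: k U V => [|k IH] U V UV [dU DU]; first by split=> //; exact: diffV UV dU.
split=> [|v]; first exact: diffV UV dU.
by apply: IH (DU v) => q Wq; exact: (eqon_derive _ oW).
Qed.

Lemma Ck_cst k W (c : R) : Ck k W (fun=> c).
Proof.
elim: k c => [|k IH] c; split=> // v.
by rewrite (_ : 'D_v _ = fun=> 0) ?funeqE// => p; exact: derive_cst.
Qed.

Lemma Ck_coord k W o : Ck k W (coord o).
Proof.
case: k => [|k]; first by split=> // p _; exact: differentiable_coordp.
split=> [p _|v]; first exact: differentiable_coordp.
rewrite (_ : 'D_v _ = fun=> coord o v); first exact: Ck_cst.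
by apply/funext => p; exact: derive_coord.
Qed.

Lemma deriveDp U V v p : differentiable U p -> differentiable V p ->
  'D_v (fun q => U q + V q) p = 'D_v U p + 'D_v V p.
Proof. by move=> dU dV; apply: deriveD; exact: diff_derivable. Qed.

Lemma deriveMp U V v p : differentiable U p -> differentiable V p ->
  'D_v (fun q => U q * V q) p = 'D_v U p * V p + U p * 'D_v V p.
Proof.
move=> dU dV; rewrite [LHS](@deriveM _ _ U V p v); try exact: diff_derivable.
by rewrite addrC /GRing.scale /= [V p * _]mulrC.
Qed.

Lemma deriveZp (c : R) V v p : differentiable V p ->
  'D_v (fun q => c * V q) p = c * 'D_v V p.
Proof.
by move=> dV; apply: deriveZ; exact: diff_derivable.
Qed.

Lemma differentiable_sump (I : Type) (r : seq I) (F : I -> pt -> R) p :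
  (forall i, differentiable (F i) p) ->
  differentiable (fun q => \sum_(i <- r) F i q) p.
Proof.
move=> dF; elim: r => [|i r IH].
  rewrite (_ : (fun q => _) = cst 0); first exact: differentiable_cst.
  by apply/funext => q; rewrite big_nil.
rewrite (_ : (fun q => _) = fun q => F i q + \sum_(j <- r) F j q).
  exact: differentiableD.
by apply/funext => q; rewrite big_cons.
Qed.

Lemma derive_sump (I : Type) (r : seq I) (F : I -> pt -> R) v p :
  (forall i, differentiable (F i) p) ->
  'D_v (fun q => \sum_(i <- r) F i q) p = \sum_(i <- r) 'D_v (F i) p.
Proof.
move=> dF; elim: r => [|i r IH].
  rewrite (_ : (fun q => _) = cst 0) ?derive_cst ?big_nil//.
  by apply/funext => q; rewrite big_nil.
rewrite (_ : (fun q => _) = fun q => F i q + \sum_(j <- r) F j q).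
  rewrite deriveDp; [|exact: dF|exact: differentiable_sump].
  by rewrite big_cons IH.
by apply/funext => q; rewrite big_cons.
Qed.

Lemma Ck_add k W U V : open W -> Ck k W U -> Ck k W V ->
  Ck k W (fun q => U q + V q).
Proof.
move=> oW; elim: k U V => [|k IH] U V [dU DU] [dV DV].
  by split=> // p Wp; apply: differentiableD; [exact: dU|exact: dV].
split=> [p Wp|v]; first by apply: differentiableD; [exact: dU|exact: dV].
apply: eqon_Ck (IH _ _ (DU v) (DV v)) => // q Wq.
by rewrite deriveDp//; [exact: dU|exact: dV].
Qed.

Lemma Ck_mul k W U V : open W -> Ck k W U -> Ck k W V ->
  Ck k W (fun q => U q * V q).
Proof.
move=> oW; elim: k U V => [|k IH] U V cU cV.
  by split=> // p Wp; apply: differentiableM; [exact: cU.1|exact: cV.1].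
split=> [p Wp|v]; first by apply: differentiableM; [exact: cU.1|exact: cV.1].
have [[dU DU] [dV DV]] := (cU, cV).
apply: (eqon_Ck oW); last first.
  apply: (Ck_add oW (IH _ _ (DU v) (CkS cV)) (IH _ _ (CkS cU) (DV v))).
by move=> q Wq; rewrite deriveMp//; [exact: dU|exact: dV].
Qed.

Lemma Ck_sum (I : Type) (r : seq I) k W (F : I -> pt -> R) : open W ->
  (forall i, Ck k W (F i)) -> Ck k W (fun q => \sum_(i <- r) F i q).
Proof.
move=> oW cF; elim: r => [|i r IH].
  by under eq_fun do rewrite big_nil; exact: Ck_cst.
by under eq_fun do rewrite big_cons; exact: Ck_add.
Qed.

End Calculus.

(** * Symmetry of second derivatives *)

Section MixedDerivatives.
Context {R : realType} {T : normedModType R}.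
Implicit Types (U : T -> R) (p q u v : T) (W : set T).

Lemma derive_line U q u (s : R) :
  'D_1 (fun t : R => U (t *: u + q)) s = 'D_u U (s *: u + q).
Proof.
rewrite /derive; set f := (X in lim (X @ _)); set g := (X in _ = lim (X @ _)).
suff -> : f = g by [].
by apply/funext => h /=; rewrite /f /g [h *: 1]mulr1 /= scalerDl addrA.
Qed.

Lemma is_derive_line U q u (s : R) : differentiable U (s *: u + q) ->
  is_derive s 1 (fun t : R => U (t *: u + q)) ('D_u U (s *: u + q)).
Proof.
move=> dU; have := @diff_derivable _ _ _ U _ u dU; rewrite /derivable.
set f := (X in cvg (X @ _)) => cf.
split; last exact: derive_line.
rewrite /derivable.
set g := (X in cvg (X @ _)); suff -> : g = f by [].
by apply/funext => h /=; rewrite /g /f /= [h *: 1]mulr1 scalerDl addrA.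
Qed.

(** The mean value theorem for s |-> U (su + hv + p) - U (su + p) reduces the second difference to h
    times a difference of values of ['D_u U]; the first-order expansion of ['D_u U] at [p] evaluates
    the latter up to o(h). *)
Lemma second_difference U u v p :
  (\near p, differentiable U p) -> differentiable ('D_u U) p ->
  forall e : R, 0 < e -> \forall h \near 0^'+,
    `|U (h *: u + (h *: v + p)) - U (h *: u + p) - (U (h *: v + p) - U p)
      - h ^+ 2 * 'D_v ('D_u U) p| <= e * h ^+ 2.
Proof.
move=> dU dDU e e0; set F := 'D_u U.
(* [C] bounds |su + tv| / h for s, t in [0, h]. Accuracy e / (2C) then costs e/2 times h at each of
   the two points where the expansion is used. *)
pose C := `|u| + `|v| + 1.
have C0 : 0 < C by rewrite ltr_wpDl// addr_ge0.
have [_ /eqaddoP/(_ (e / (2 * C)))] := (diff_locallyP _ _).1 dDU.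
have -> : (0 < e / (2 * C)) by rewrite divr_gt0// mulr_gt0.
move=> /(_ isT) /nbhs_ballP[d1 /= d10 Hd1].
have /nbhs_ballP[d2 /= d20 Hd2] := dU.
near=> h.
have h0 : 0 < h by [].
have hd1 : h * C < d1.
  by rewrite -ltr_pdivlMr//; near: h; apply: nbhs_right_lt; rewrite divr_gt0.
have hd2 : h * C < d2.
  by rewrite -ltr_pdivlMr//; near: h; apply: nbhs_right_lt; rewrite divr_gt0.
have norm_le s t : 0 <= s <= h -> 0 <= t <= h -> `|s *: u + t *: v| <= h * C.
  move=> /andP[s0 sh] /andP[t0 th].
  rewrite (le_trans (ler_normD _ _))// !normrZ !ger0_norm// /C !mulrDr mulr1.
  by rewrite ler_wpDr ?(ltW h0)// lerD// ler_wpM2r.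
have near_p s t : 0 <= s <= h -> 0 <= t <= h ->
    differentiable U (s *: u + (t *: v + p)).
  move=> sh th; apply: Hd2; rewrite -ball_normE /= addrA opprD addrCA subrr addr0.
  by rewrite normrN (le_lt_trans (norm_le _ _ sh th)).
have expansion s t : 0 <= s <= h -> 0 <= t <= h ->
    `|F (s *: u + (t *: v + p)) - F p - (s * 'D_u F p + t * 'D_v F p)|
      <= e / 2 * h.
  move=> sh th; have := Hd1 (s *: u + t *: v).
  rewrite -ball_normE /= sub0r normrN (le_lt_trans (norm_le _ _ sh th))//.
  have -> : s * 'D_u F p + t * 'D_v F p = 'd F p (s *: u + t *: v).
    by rewrite linearD !linearZ /= !deriveE.
  move=> /(_ isT); rewrite !fctE /= => H.
  rewrite addrA -[_ - _ - _]addrA -opprD; apply: (le_trans H).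
  apply: (le_trans (ler_wpM2l _ (norm_le _ _ sh th))).
    by rewrite divr_ge0 ?mulr_ge0 ?ltW.
  suff -> : e / (2 * C) * (h * C) = e / 2 * h by [].
  by field; rewrite gt_eqF.
pose phi s := U (s *: u + (h *: v + p)) - U (s *: u + p).
have hh : 0 <= h <= h by apply/andP; split=> //; exact: ltW.
have zh : 0 <= (0 : R) <= h by apply/andP; split=> //; exact: ltW.
have dphi s : 0 <= s <= h -> is_derive s 1 phi
    (F (s *: u + (h *: v + p)) - F (s *: u + p)).
  move=> sh; apply: is_deriveB.
    by apply: is_derive_line; exact: near_p.
  by apply: is_derive_line; have := near_p s 0 sh zh; rewrite scale0r add0r.
have [s sh Es] : exists2 s, s \in `]0, h[%R &
    phi h - phi 0 = (F (s *: u + (h *: v + p)) - F (s *: u + p)) * (h - 0).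
  apply: (@MVT _ phi (fun s => F (s *: u + (h *: v + p)) - F (s *: u + p))) => //.
    by move=> s; rewrite in_itv /= => /andP[s0 sh]; apply: dphi; rewrite !ltW.
  apply: derivable_within_continuous => s; rewrite in_itv/= => sh.
  exact: (@ex_derive _ _ _ _ _ _ _ (dphi s sh)).
have {}sh : 0 <= s <= h by move: sh; rewrite in_itv/= => /andP[? ?]; rewrite !ltW.
have E : phi h - phi 0 = U (h *: u + (h *: v + p)) - U (h *: u + p) -
   (U (h *: v + p) - U p) by rewrite /phi !scale0r !add0r.
rewrite -E Es subr0.
have e1 := expansion s h sh hh; have := expansion s 0 sh zh.
rewrite scale0r add0r mul0r addr0 => e2.
have regroup (a b c du dv : R) : (a - b) * h - h ^+ 2 * dv =
    h * ((a - c - (s * du + h * dv)) - (b - c - s * du)) by ring.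
rewrite (regroup _ _ (F p) ('D_u F p)).
rewrite normrM gtr0_norm//.
have -> : e * h ^+ 2 = h * (e / 2 * h + e / 2 * h) by field.
by rewrite ler_pM2l// (le_trans (ler_normB _ _))// lerD.
Unshelve. all: by end_near. Qed.

(** The second difference is symmetric in [u] and [v], so both mixed derivatives approximate the
    same quantity up to o(h^2). This is Young's form of the theorem: differentiability of the first
    derivatives at [p] replaces continuity of the second ones. *)
Lemma derive_comm_point U u v p :
  (\near p, differentiable U p) -> differentiable ('D_u U) p ->
  differentiable ('D_v U) p -> 'D_v ('D_u U) p = 'D_u ('D_v U) p.
Proof.
move=> dU du dv; apply/eqP; rewrite -subr_eq0 -normr_le0.
apply/ler_addgt0Pr => e e0; rewrite add0r.
have e20 : 0 < e / 2 by rewrite divr_gt0.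
have H1 := @second_difference U u v p dU du _ e20.
have H2 := @second_difference U v u p dU dv _ e20.
have [h [h0 [{}H1 {}H2]]] := filter_ex (filterI (nbhs_right_gt 0) (filterI H1 H2)).
move: H1 H2; set b := 'D_v _ _; set a := 'D_u ('D_v _) _.
(* Makes the two second differences share the value at the far corner. *)
rewrite (addrCA (h *: u)).
set x := U _; set y := U _; set z := U _; set t := U _ => H1 H2.
rewrite /= in h0.
have h20 : 0 < h ^+ 2 by rewrite exprn_gt0.
rewrite -(ler_pM2l h20) -{1}(gtr0_norm h20) -normrM.
have -> : h ^+ 2 * (b - a) = (x - z - (y - t) - h ^+ 2 * a) -
  (x - y - (z - t) - h ^+ 2 * b) by ring.
apply: (le_trans (ler_normB _ _)).
have -> : h ^+ 2 * e = e / 2 * h ^+ 2 + e / 2 * h ^+ 2 by field.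
by apply: lerD; [exact: H2|exact: H1].
Qed.

End MixedDerivatives.

(** * The Kelvin transform *)

Section Kelvin.
Context {R : realType} {n : nat}.
Local Notation pt := ('rV[R]_n * R)%type.
Implicit Types (p q v w : pt) (U V Z : pt -> R) (W : set pt) (o : option 'I_n).

Definition dotp v p : R := \sum_o coord o v * coord o p.

Definition euler V p : R := \sum_o coord o p * 'D_(basis o) V p.

Definition kelvin (a : R) V p : R := r_half p `^ a * V (inv_half p).

Lemma r_halfE p : r_half p = Num.sqrt (dotp p p).
Proof. by rewrite /r_half /dotp sum_option addrC. Qed.

Lemma dotpp_ge0 p : 0 <= dotp p p.
Proof. by apply: sumr_ge0 => o _; rewrite -expr2 sqr_ge0. Qed.

Lemma dotpp_gt0 p : p <> 0 -> 0 < dotp p p.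
Proof.
move=> p0; rewrite lt0r dotpp_ge0 andbT; apply/negP => /eqP H; apply: p0.
rewrite (point_sum p) big1 // => o _.
have /eqP := @psumr_eq0P _ _ _ _ (fun o _ => sqr_ge0 (coord o p)) H o isT.
by rewrite mulf_eq0 orbb => /eqP ->; rewrite scale0r.
Qed.

Lemma r_half_gt0 p : p <> 0 -> 0 < r_half p.
Proof. by move=> p0; rewrite r_halfE sqrtr_gt0 dotpp_gt0. Qed.

Lemma r_half_ge0 p : 0 <= r_half p.
Proof. by rewrite sqrtr_ge0. Qed.

Lemma r_half_sqr p : r_half p ^+ 2 = dotp p p.
Proof. by rewrite r_halfE sqr_sqrtr ?dotpp_ge0. Qed.

Lemma r_half_powR p (a : R) : r_half p `^ a = dotp p p `^ (a / 2).
Proof. by rewrite r_halfE -powR12_sqrt ?dotpp_ge0// -powRrM mulrC. Qed.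

Lemma r_half_powRD p (a b : R) : p <> 0 ->
  r_half p `^ (a + b) = r_half p `^ a * r_half p `^ b.
Proof.
move=> p0; rewrite powRD//; apply/implyP => _.
by rewrite gt_eqF ?r_half_gt0.
Qed.

Lemma r_half_powR2 p : r_half p `^ 2 = dotp p p.
Proof. by rewrite powR_mulrn ?r_half_ge0// r_half_sqr. Qed.

Lemma r_half_powRN2 p : r_half p `^ (- 2) = (r_half p) ^- 2.
Proof. by rewrite powRN powR_mulrn ?r_half_ge0. Qed.

Lemma inv_halfE p : inv_half p = r_half p `^ (- 2) *: p.
Proof. by rewrite r_half_powRN2. Qed.

Lemma coord_inv o p : coord o (inv_half p) = r_half p `^ (- 2) * coord o p.
Proof. by rewrite inv_halfE coordZ. Qed.

Lemma differentiable_dotpp p : differentiable (fun q => dotp q q) p.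
Proof.
apply: (@Ck_diff _ _ 0 setT) => //; apply: Ck_sum; first exact: openT.
by move=> o; apply: Ck_mul; [exact: openT|exact: Ck_coord..].
Qed.

Lemma derive_dotpp v p : 'D_v (fun q => dotp q q) p = 2 * dotp v p.
Proof.
have dc o q := differentiable_coordp o q.
rewrite derive_sump => [|o]; last exact: differentiableM.
rewrite /dotp mulr_sumr; apply: eq_bigr => o _.
by rewrite deriveMp// derive_coord; ring.
Qed.

Lemma open_point_neq0 : open [set p : pt | p <> 0].
Proof.
have -> : [set p : pt | p <> 0] = (fun q => dotp q q) @^-1` [set x : R | 0 < x].
  apply/seteqP; split => p /=; first exact: dotpp_gt0.
  move=> + p0; rewrite p0 /dotp big1 ?ltxx// => o _.
  by rewrite -(scale0r (0 : pt)) coordZ mul0r mul0r.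
apply: open_comp; last exact: open_gt.
by move=> q _; exact/differentiable_continuous/differentiable_dotpp.
Qed.

Lemma differentiable_r_half_powR (a : R) p : p <> 0 ->
  differentiable (fun q => r_half q `^ a) p.
Proof.
move=> p0; rewrite (_ : (fun q => _) = (fun x : R => x `^ (a / 2)) \o (fun q => dotp q q)).
  apply: differentiable_comp; first exact: differentiable_dotpp.
  apply/derivable1_diffP; apply: (@ex_derive _ _ _ _ _ _ _ _).
  by apply: is_derive1_powR; exact: dotpp_gt0.
by apply/funext => q; exact: r_half_powR.
Qed.

Lemma derive_r_half_powR (a : R) v p : p <> 0 ->
  'D_v (fun q => r_half q `^ a) p = a * dotp v p * r_half p `^ (a - 2).
Proof.
move=> p0; have dp := dotpp_gt0 p0.
rewrite (_ : (fun q => _) = (fun x : R => x `^ (a / 2)) \o (fun q => dotp q q)); last first.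
  by apply/funext => q; exact: r_half_powR.
have dr := is_derive1_powR (a / 2) dp.
have der := @ex_derive _ _ _ _ _ _ _ dr.
rewrite deriveE; last first.
  apply: differentiable_comp; first exact: differentiable_dotpp.
  exact/derivable1_diffP.
rewrite diff_comp /=; last 2 first.
- exact: differentiable_dotpp.
- exact/derivable1_diffP.
rewrite -[in X in 'd _ _ X]deriveE; last exact: differentiable_dotpp.
rewrite derive_dotpp diff1E; last exact/derivable1_diffP.
rewrite derive1E (@derive_val _ _ _ _ _ _ _ dr) r_half_powR.
have -> : (a - 2) / 2 = a / 2 - 1 :> R by field.
by rewrite /GRing.scale /=; field.
Qed.

Lemma inv_half_neq0 p : p <> 0 -> inv_half p <> 0.
Proof.
move=> p0; rewrite inv_halfE => /eqP; rewrite scaler_eq0 => /orP[|/eqP//].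
by rewrite gt_eqF// powR_gt0 ?r_half_gt0.
Qed.

Lemma dotp_inv p : p <> 0 -> dotp (inv_half p) (inv_half p) = r_half p `^ (- 2).
Proof.
move=> p0; rewrite /dotp (eq_bigr (fun o => r_half p `^ (- 2) * r_half p `^ (- 2) *
  (coord o p * coord o p))); last by move=> o _; rewrite coord_inv; ring.
rewrite -mulr_sumr -/(dotp p p) -r_half_powR2 -!r_half_powRD//.
by congr (_ `^ _); ring.
Qed.

Lemma r_half_inv (a : R) p : p <> 0 -> r_half (inv_half p) `^ a = r_half p `^ (- a).
Proof.
by move=> p0; rewrite r_half_powR dotp_inv// -powRrM; congr (_ `^ _); field.
Qed.

Lemma inv_halfK p : p <> 0 -> inv_half (inv_half p) = p.
Proof.
move=> p0; rewrite inv_halfE r_half_inv// opprK inv_halfE scalerA.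
by rewrite -r_half_powRD// subrr powRr0 scale1r.
Qed.

Let dinv_coef o p : R := r_half p `^ (- 2) * coord o p.

Let differentiable_dinv_coef o p : p <> 0 -> differentiable (dinv_coef o) p.
Proof.
move=> p0; apply: differentiableM; last exact: differentiable_coordp.
exact: differentiable_r_half_powR.
Qed.

Let derive_dinv_coef o v p : p <> 0 -> 'D_v (dinv_coef o) p =
  r_half p `^ (- 2) * coord o v - 2 * dotp v p * r_half p `^ (- 2) * dinv_coef o p.
Proof.
move=> p0; rewrite deriveMp; [|exact: differentiable_r_half_powR
  |exact: differentiable_coordp].
rewrite derive_coord derive_r_half_powR// /dinv_coef.
have -> : (- 2 - 2 : R) = - 2 + - 2 by [].
by rewrite r_half_powRD//; ring.
Qed.

Let inv_half_sum : @inv_half R n = fun p =>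
  dinv_coef None p *: basis None + (\sum_(i < n) (fun q => dinv_coef (Some i) q *: basis (Some i))) p.
Proof.
apply/funext => p; rewrite {1}(point_sum (inv_half p)) sum_option.
by rewrite fct_sumE coord_inv; congr (_ + _); apply: eq_bigr => i _; rewrite coord_inv.
Qed.

Lemma differentiable_inv_half p : p <> 0 -> differentiable (@inv_half R n) p.
Proof.
move=> p0; rewrite inv_half_sum; apply: differentiableD.
  by apply: differentiableZl; exact: differentiable_dinv_coef.
apply: differentiable_sum => i.
by apply: differentiableZl; exact: differentiable_dinv_coef.
Qed.

(** Since [inv_half p] is p / r^2, this is r^-2 times the reflection of v in the hyperplane
    orthogonal to p: the inversion is conformal. *)
Lemma derive_inv_half v p : p <> 0 -> 'D_v (@inv_half R n) p =
  r_half p `^ (- 2) *: v - (2 * dotp v p * r_half p `^ (- 2)) *: inv_half p.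
Proof.
move=> p0; have D o := differentiable_dinv_coef o p0.
have DZ o : 'D_v (fun q => dinv_coef o q *: basis o) p =
            'D_v (dinv_coef o) p *: basis o.
  by rewrite !deriveE ?diffZl//; exact: differentiableZl.
rewrite {1}inv_half_sum deriveD; last 2 first.
- by apply: diff_derivable; exact: differentiableZl.
- by apply: diff_derivable; apply: differentiable_sum => i; exact: differentiableZl.
rewrite derive_sum; last by move=> i; apply: diff_derivable; exact: differentiableZl.
rewrite DZ (eq_bigr (fun i => 'D_v (dinv_coef (Some i)) p *: basis (Some i))) //.
rewrite -(sum_option (fun o => 'D_v (dinv_coef o) p *: basis o)).
rewrite [X in _ *: X - _](point_sum v) [X in _ - _ *: X]point_sum !scaler_sumr -sumrB.
apply: eq_bigr => o _.
by rewrite !scalerA -scalerBl derive_dinv_coef// coord_inv.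
Qed.

Lemma differentiable_kelvin (a : R) V p : p <> 0 -> differentiable V (inv_half p) ->
  differentiable (kelvin a V) p.
Proof.
move=> p0 dV; apply: differentiableM; first exact: differentiable_r_half_powR.
by apply: differentiable_comp => //; exact: differentiable_inv_half.
Qed.

(** The term in <v, p> collects the derivative of r^a and the reflected part of the differential of
    the inversion. Only Kelvin transforms and linear factors occur on the right, so the formula can
    be iterated. *)
Lemma derive_kelvin (a : R) V v p : p <> 0 -> differentiable V (inv_half p) ->
  'D_v (kelvin a V) p = kelvin (a - 2) ('D_v V) p +
    dotp v p * kelvin (a - 2) (fun q => a * V q - 2 * euler V q) p.
Proof.
move=> p0 dV; have dI := differentiable_inv_half p0.
rewrite deriveMp; [|exact: differentiable_r_half_powR|exact: differentiable_comp].
rewrite derive_r_half_powR//.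
have -> : 'D_v (V \o inv_half) p = r_half p `^ (- 2) * 'D_v V (inv_half p) -
    2 * dotp v p * r_half p `^ (- 2) * euler V (inv_half p).
  have dC : differentiable (V \o inv_half) p by exact: differentiable_comp.
  rewrite (deriveE v dC) (diff_comp dI dV).
  rewrite -[LHS]/('d V (inv_half p) ('d (@inv_half R n) p v)).
  rewrite -(deriveE v dI) derive_inv_half// linearB linearZ linearZ /=.
  by rewrite -!deriveE// [X in _ - _ * X]derive_dir.
by rewrite /kelvin r_half_powRD//; ring.
Qed.

End Kelvin.

(** * Smoothness and the Laplacian of a Kelvin transform *)

Section SmoothClosure.
Context {R : realType} {n : nat}.
Local Notation pt := ('rV[R]_n * R)%type.
Implicit Types (p q v w : pt) (U V Z : pt -> R) (W : set pt) (o : option 'I_n).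

Lemma smooth_diff W V p : smooth_on W V -> W p -> differentiable V p.
Proof. by move=> sV Wp; exact: (sV [::]). Qed.

Lemma smooth_derive W V v : smooth_on W V -> smooth_on W ('D_v V).
Proof. by move=> /smooth_onP sV; apply/smooth_onP => k; exact: (sV k.+1).2. Qed.

Lemma smooth_iter_derive W V v k : smooth_on W V -> smooth_on W (iter k (fun Z => 'D_v Z) V).
Proof. by move=> sV; elim: k => //= k; exact: smooth_derive. Qed.

Lemma smooth_sub W W' V : W' `<=` W -> smooth_on W V -> smooth_on W' V.
Proof. by move=> WW sV vs p /WW; exact: sV. Qed.

Lemma smooth_eqon W U V : open W -> (forall q, W q -> U q = V q) ->
  smooth_on W U -> smooth_on W V.
Proof.
move=> oW UV /smooth_onP sU; apply/smooth_onP => k.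
exact: eqon_Ck oW UV (sU k).
Qed.

Lemma smooth_cst W (c : R) : smooth_on W (fun=> c).
Proof. by apply/smooth_onP => k; exact: Ck_cst. Qed.

Lemma smooth_coord W o : smooth_on W (coord o).
Proof. by apply/smooth_onP => k; exact: Ck_coord. Qed.

Lemma smooth_add W U V : open W -> smooth_on W U -> smooth_on W V ->
  smooth_on W (fun q => U q + V q).
Proof.
by move=> oW /smooth_onP sU /smooth_onP sV; apply/smooth_onP => k; exact: Ck_add.
Qed.

Lemma smooth_mul W U V : open W -> smooth_on W U -> smooth_on W V ->
  smooth_on W (fun q => U q * V q).
Proof.
by move=> oW /smooth_onP sU /smooth_onP sV; apply/smooth_onP => k; exact: Ck_mul.
Qed.

Lemma smooth_scale W (c : R) V : open W -> smooth_on W V ->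
  smooth_on W (fun q => c * V q).
Proof. by move=> oW; apply: smooth_mul => //; exact: smooth_cst. Qed.

Lemma smooth_sumr (I : Type) (r : seq I) W (F : I -> pt -> R) : open W ->
  (forall i, smooth_on W (F i)) -> smooth_on W (fun q => \sum_(i <- r) F i q).
Proof.
move=> oW sF; apply/smooth_onP => k; apply: Ck_sum => // i.
by have /smooth_onP := sF i.
Qed.

Lemma smooth_euler W V : open W -> smooth_on W V -> smooth_on W (euler V).
Proof.
move=> oW sV; apply: smooth_sumr => // o; apply: smooth_mul => //.
  exact: smooth_coord.
exact: smooth_derive.
Qed.

Lemma smooth_lapl W V : open W -> smooth_on W V -> smooth_on W (lapl V).
Proof.
move=> oW sV; apply: smooth_add => //; last by do 2! apply: smooth_derive.
by apply: smooth_sumr => // i; do 2! apply: smooth_derive.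
Qed.

(** The origin is removed by hand, as [inv_half] sends it to itself. *)
Definition kelvin_dom W : set pt := [set p | p <> 0 /\ W (inv_half p)].

Lemma open_kelvin_dom W : open W -> open (kelvin_dom W).
Proof.
move=> oW; rewrite openE => p [p0 Wp]; rewrite /interior; apply: filterI.
  by apply: open_nbhs_nbhs; split => //; exact: open_point_neq0.
have /differentiable_continuous := differentiable_inv_half p0; apply.
exact: open_nbhs_nbhs.
Qed.

Lemma kelvinZ (a c : R) V p : kelvin a (fun q => c * V q) p = c * kelvin a V p.
Proof. by rewrite /kelvin mulrCA. Qed.

(** By [derive_kelvin] a derivative is again built from Kelvin transforms, with weight [a - 2] and
    other functions; hence the induction on the order generalises over [a] and [V]. *)
Lemma smooth_kelvin W (a : R) V : open W -> smooth_on W V ->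
  smooth_on (kelvin_dom W) (kelvin a V).
Proof.
move=> oW sV; have oW' := open_kelvin_dom oW.
apply/smooth_onP => k; elim: k => [|k IH] in a V sV *.
  by split=> // p [p0 Wp]; apply: differentiable_kelvin => //; exact: smooth_diff Wp.
split=> [p [p0 Wp]|v]; first by apply: differentiable_kelvin => //; exact: smooth_diff Wp.
apply: (@eqon_Ck _ _ _ _ (fun p => kelvin (a - 2) ('D_v V) p +
    dotp v p * kelvin (a - 2) (fun q => a * V q + - 2 * euler V q) p)) => //.
  move=> p [p0 Wp]; rewrite derive_kelvin//; last exact: smooth_diff Wp.
  by congr (_ + _ * _); rewrite /kelvin mulNr.
apply: Ck_add => //; first by apply: IH; exact: smooth_derive.
apply: Ck_mul => //; last first.
  apply: IH; apply: smooth_add => //; apply: smooth_scale => //.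
  exact: smooth_euler.
apply: Ck_sum => // o; apply: Ck_mul => //; [exact: Ck_cst|exact: Ck_coord].
Qed.

Lemma derive_comm W V u v p : open W -> smooth_on W V -> W p ->
  'D_u ('D_v V) p = 'D_v ('D_u V) p.
Proof.
move=> oW sV Wp; apply: derive_comm_point.
- have : nbhs p W by exact: open_nbhs_nbhs.
  by apply: filterS => q; exact: smooth_diff.
- by apply: smooth_diff Wp; exact: smooth_derive.
- by apply: smooth_diff Wp; exact: smooth_derive.
Qed.

(** The extra term comes from differentiating the coefficients of E; the rest is the symmetry of
    second derivatives. *)
Lemma derive_euler W V o p : open W -> smooth_on W V -> W p ->
  'D_(basis o) (euler V) p = euler ('D_(basis o) V) p + 'D_(basis o) V p.
Proof.
move=> oW sV Wp; have dD u : differentiable ('D_u V) p.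
  by apply: smooth_diff Wp; exact: smooth_derive.
rewrite derive_sump => [|o']; last first.
  by apply: differentiableM => //; exact: differentiable_coordp.
under eq_bigr => o' _.
  rewrite deriveMp//; last exact: differentiable_coordp.
  rewrite derive_coord coord_basis (derive_comm _ _ oW sV Wp).
  over.
rewrite big_split /= addrC; congr (_ + _).
rewrite (bigD1 o) //= eqxx mul1r big1 ?addr0// => o' /negbTE ->.
by rewrite mul0r.
Qed.

Lemma laplE V p : lapl V p = \sum_o 'D_(basis o) ('D_(basis o) V) p.
Proof. by rewrite sum_option addrC. Qed.

Lemma dotp_basis o p : dotp (basis o) p = coord o p.
Proof.
rewrite /dotp (bigD1 o) //= coord_basis eqxx mul1r big1 ?addr0// => o' H.
by rewrite coord_basis (negbTE H) mul0r.
Qed.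

Lemma euler_lin W (a b : R) U V p : smooth_on W U -> smooth_on W V -> W p ->
  euler (fun q => a * U q + b * V q) p = a * euler U p + b * euler V p.
Proof.
move=> sU sV Wp; have dU := smooth_diff sU Wp; have dV := smooth_diff sV Wp.
rewrite /euler !mulr_sumr -big_split; apply: eq_bigr => o _ /=.
have dc (c : R) Z : differentiable Z p -> differentiable (fun q => c * Z q) p.
  by move=> dZ; apply: differentiableM => //; exact: differentiable_cst.
by rewrite deriveDp ?deriveZp//; [ring|exact: dc|exact: dc].
Qed.

Lemma derive2_kelvin W (a : R) V o p : open W -> smooth_on W V -> kelvin_dom W p ->
  let Y := fun q => a * V q + - 2 * euler V q in
  'D_(basis o) ('D_(basis o) (kelvin a V)) p =
    kelvin (a - 4) ('D_(basis o) ('D_(basis o) V)) p +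
    coord o p * kelvin (a - 4) (fun q =>
      (a - 2) * 'D_(basis o) V q + - 2 * euler ('D_(basis o) V) q) p +
    kelvin (a - 2) Y p +
    coord o p * (kelvin (a - 4) ('D_(basis o) Y) p +
      coord o p * kelvin (a - 4) (fun q => (a - 2) * Y q + - 2 * euler Y q) p).
Proof.
move=> oW sV W'p Y; have oW' := open_kelvin_dom oW.
have sY : smooth_on W Y.
  by apply: smooth_add => //; apply: smooth_scale => //; exact: smooth_euler.
have sD : smooth_on W ('D_(basis o) V) by exact: smooth_derive.
have D1 b Z q : smooth_on W Z -> kelvin_dom W q ->
    'D_(basis o) (kelvin b Z) q = kelvin (b - 2) ('D_(basis o) Z) q +
     coord o q * kelvin (b - 2) (fun q => b * Z q + - 2 * euler Z q) q.
  move=> sZ [q0 Wq]; rewrite derive_kelvin//; last exact: smooth_diff Wq.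
  by rewrite dotp_basis; congr (_ + _ * _); rewrite /kelvin mulNr.
rewrite (eqon_derive (basis o) oW' (fun q => @D1 a V q sV) W'p).
have dk b Z : smooth_on W Z -> differentiable (kelvin b Z) p.
  by move=> sZ; apply: smooth_diff W'p; exact: smooth_kelvin.
rewrite deriveDp; [|exact: dk|apply: differentiableM; [exact: differentiable_coordp|exact: dk]].
rewrite deriveMp; [|exact: differentiable_coordp|exact: dk].
rewrite derive_coord coord_basis eqxx mul1r !D1// (_ : a - 2 - 2 = a - 4); last by ring.
by rewrite !addrA.
Qed.

(** When [derive2_kelvin] is summed over the directions, p = r^2 [inv_half p] turns the coordinate
    factors times derivatives into r^2 E. The terms in E (E V) cancel, and the n + 1 copies of Y
    bring the dimension into the coefficients. *)
Lemma lapl_kelvin W (a : R) V p : open W -> smooth_on W V -> kelvin_dom W p ->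
  lapl (kelvin a V) p = kelvin (a - 4) (lapl V) p +
    kelvin (a - 2) (fun q => a * (a + n%:R - 1) * V q
                             - 2 * (a + n%:R - 1) * euler V q) p.
Proof.
move=> oW sV W'p; have [p0 Wp] := W'p; rewrite laplE.
under eq_bigr do rewrite (derive2_kelvin _ _ oW sV W'p).
set Y := fun q => _; set q := inv_half p.
have sE : smooth_on W (euler V) by exact: smooth_euler.
have sY : smooth_on W Y.
  by apply: smooth_add => //; apply: smooth_scale => //; exact: smooth_euler.
have EY : euler Y q = a * euler V q - 2 * euler (euler V) q.
  by rewrite (euler_lin _ _ sV sE Wp) mulNr.
pose k := r_half p `^ (a - 4); pose rr := r_half p `^ 2.
have k2 : r_half p `^ (a - 2) = k * rr.
  by rewrite -r_half_powRD//; congr (_ `^ _); ring.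
have cq o : coord o p = rr * coord o q.
  by rewrite coord_inv mulrA -r_half_powRD// subrr powRr0 mul1r.
have sumq Z : \sum_o coord o p * kelvin (a - 4) ('D_(basis o) Z) p =
    k * rr * euler Z q.
  by rewrite /euler mulr_sumr; apply: eq_bigr => o _; rewrite cq /kelvin -/q -/k; ring.
have sumc : \sum_o coord o p * coord o p = rr by rewrite -/(dotp p p) -r_half_powR2.
have sumE : \sum_o coord o p * kelvin (a - 4) (euler ('D_(basis o) V)) p =
    k * rr * (euler (euler V) q - euler V q).
  rewrite mulrBr -2!sumq -sumrB; apply: eq_bigr => o _.
  by rewrite -mulrBr /kelvin -mulrBr (derive_euler _ oW sV Wp) addrK.
rewrite (eq_bigr (fun o => k * 'D_(basis o) ('D_(basis o) V) q
  + (a - 2) * (coord o p * kelvin (a - 4) ('D_(basis o) V) p)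
  - 2 * (coord o p * kelvin (a - 4) (euler ('D_(basis o) V)) p)
  + k * rr * Y q + coord o p * kelvin (a - 4) ('D_(basis o) Y) p
  + coord o p * coord o p * (k * ((a - 2) * Y q - 2 * euler Y q)))); last first.
  by move=> o _; rewrite /kelvin -/q k2 -/k -/(Y q); ring.
rewrite !big_split /= sumrN -!mulr_sumr -mulr_suml sumc !sumq sumE.
rewrite sumr_const card_option card_ord -[_ *+ n.+1]mulr_natr EY /kelvin -/q k2 -/k laplE /Y.
by ring.
Qed.

(** This is y Delta_m. Unlike Delta_m it is regular at y = 0, so it can be applied to functions
    smooth across the boundary and differentiated there. *)
Definition Sop (m : R) V p : R := p.2 * lapl V p + m * 'D_e_y V p.

(** The first-order term m D_y shifts n - 1 to n - 1 + m in the formula for the Laplacian. At a = 1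
    - n - m the correction vanishes, so this weight preserves solutions of [Sop m V = 0]. *)
Lemma Sop_kelvin W (m a : R) V p : open W -> smooth_on W V -> kelvin_dom W p ->
  Sop m (kelvin a V) p = kelvin (a - 2) (Sop m V) p +
    p.2 * kelvin (a - 2) (fun q => a * (a + n%:R - 1 + m) * V q
                             - 2 * (a + n%:R - 1 + m) * euler V q) p.
Proof.
move=> oW sV W'p; have [p0 Wp] := W'p.
rewrite /Sop (lapl_kelvin _ oW sV W'p) (derive_kelvin _ _ p0 (smooth_diff sV Wp)).
rewrite -/(basis None) dotp_basis /= /kelvin.
have -> : (inv_half p).2 = r_half p `^ (- 2) * p.2 by exact: (coord_inv None).
have -> : r_half p `^ (a - 4) = r_half p `^ (a - 2) * r_half p `^ (- 2).
  by rewrite -r_half_powRD//; congr (_ `^ _); ring.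
by ring.
Qed.

End SmoothClosure.

(** * Interior operators *)

Section Interior.
Context {R : realType} {n : nat}.
Local Notation pt := ('rV[R]_n * R)%type.
Implicit Types (p q v w : pt) (U V Z : pt -> R) (W : set pt) (o : option 'I_n).

Definition upper : set pt := [set p | 0 < p.2].

Lemma open_upper : open upper.
Proof.
apply: (@open_comp _ _ (@snd _ R) [set y | 0 < y]); last exact: open_gt.
by move=> p _; exact: cvg_snd.
Qed.
Hint Resolve open_upper : core.

Lemma upper_neq0 p : upper p -> p <> 0.
Proof. by move=> /[swap] ->; rewrite /upper /= ltxx. Qed.

Lemma upper_inv p : upper p -> upper (inv_half p).
Proof.
move=> p2; have p0 := upper_neq0 p2.
have -> : upper (inv_half p) = (0 < coord None (inv_half p)) :> Prop by [].
by rewrite coord_inv mulr_gt0// powR_gt0 ?r_half_gt0.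
Qed.

Lemma upper_kelvin_dom : upper `<=` kelvin_dom upper.
Proof. by move=> p p2; split; [exact: upper_neq0|exact: upper_inv]. Qed.

Lemma derive_height_powR (b : R) v p : upper p ->
  differentiable (fun q : pt => q.2 `^ b) p /\
  'D_v (fun q : pt => q.2 `^ b) p = b * v.2 * p.2 `^ (b - 1).
Proof.
move=> p2; have dr := is_derive1_powR b p2.
have der := (derivable1_diffP _ _).1 (@ex_derive _ _ _ _ _ _ _ dr).
have dc : differentiable (@coord R n None) p by exact: differentiable_coordp.
have dC : differentiable ((fun x : R => x `^ b) \o @coord R n None) p.
  exact: differentiable_comp.
split; first exact: dC.
rewrite -[LHS]/('D_v ((fun x : R => x `^ b) \o @coord R n None) p).
rewrite (deriveE v dC) (diff_comp dc der).
rewrite -[LHS]/('d (fun x : R => x `^ b) (coord None p) ('d (@coord R n None) p v)).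
rewrite -(deriveE v dc) derive_coord (diff1E der).
rewrite derive1E (@derive_val _ _ _ _ _ _ _ dr) /GRing.scale /=; ring.
Qed.

Lemma smooth_height_powR (b : R) : smooth_on upper (fun p => p.2 `^ b).
Proof.
apply/smooth_onP => k; elim: k b => [|k IH] b.
  by split=> // p p2; have [] := derive_height_powR b 0 p2.
split=> [p p2|v]; first by have [] := derive_height_powR b 0 p2.
apply: (@eqon_Ck _ _ _ _ (fun p => b * v.2 * p.2 `^ (b - 1))) => //.
  by move=> p p2; have [_ ->] := derive_height_powR b v p2.
by apply: Ck_mul => //; exact: Ck_cst.
Qed.

Lemma smooth_height_inv : smooth_on upper (fun p : pt => (p.2)^-1).
Proof.
apply: (@smooth_eqon _ _ _ (fun p => p.2 `^ (- 1))) => //.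
  by move=> q q2; rewrite powR_inv1 ?ltW.
exact: smooth_height_powR.
Qed.

Variable m : R.
Local Notation A := (laplm m).
Local Notation N := (n%:R + 1 + m).

Lemma laplmE V p : upper p -> A V p = (p.2)^-1 * Sop m V p.
Proof.
move=> p2; rewrite /laplm /Sop mulrDr mulrA mulVf ?gt_eqF//; ring.
Qed.

Lemma smooth_laplm V : smooth_on upper V -> smooth_on upper (A V).
Proof.
move=> sV; apply: smooth_add => //; first exact: smooth_lapl.
apply: smooth_mul => //; last exact: smooth_derive.
by apply: smooth_scale => //; exact: smooth_height_inv.
Qed.

Lemma smooth_iter_laplm V k : smooth_on upper V -> smooth_on upper (iter k A V).
Proof. by move=> sV; elim: k => //= k; exact: smooth_laplm. Qed.

Lemma laplm_lin (a b : R) U V p : smooth_on upper U -> smooth_on upper V -> upper p ->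
  A (fun q => a * U q + b * V q) p = a * A U p + b * A V p.
Proof.
move=> sU sV p2.
have dlin X Y v q : smooth_on upper X -> smooth_on upper Y -> upper q ->
    'D_v (fun q => a * X q + b * Y q) q = a * 'D_v X q + b * 'D_v Y q.
  move=> sX sY q2; have dX := smooth_diff sX q2; have dY := smooth_diff sY q2.
  by rewrite deriveDp ?deriveZp//; apply: differentiableM => //;
    exact: differentiable_cst.
have d2 o : 'D_(basis o) ('D_(basis o) (fun q => a * U q + b * V q)) p =
   a * 'D_(basis o) ('D_(basis o) U) p + b * 'D_(basis o) ('D_(basis o) V) p.
  rewrite (eqon_derive _ open_upper (fun q => @dlin U V _ q sU sV))//.
  by rewrite dlin//; exact: smooth_derive.
have S : lapl (fun q => a * U q + b * V q) p = a * lapl U p + b * lapl V p.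
  by rewrite !laplE !mulr_sumr -big_split; apply: eq_bigr => o _; exact: d2.
rewrite /laplm S (dlin _ _ _ _ sU sV p2).
by move: (lapl U p) (lapl V p) ('D_e_y U p) ('D_e_y V p) => *; ring.
Qed.

Lemma eqon_laplm U V p : (forall q, upper q -> U q = V q) -> upper p ->
  A U p = A V p.
Proof.
move=> UV p2.
have d1 v q : upper q -> 'D_v U q = 'D_v V q by exact: eqon_derive.
have S : lapl U p = lapl V p.
  rewrite !laplE; apply: eq_bigr => o _.
  by apply: (eqon_derive _ open_upper) => // q; exact: d1.
by rewrite /laplm S (d1 e_y p p2).
Qed.

Lemma eqon_iter_laplm k U V p : (forall q, upper q -> U q = V q) -> upper p ->
  iter k A U p = iter k A V p.
Proof.
move=> UV; elim: k p => [|k IH] p p2 /=; first exact: UV.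
by apply: eqon_laplm.
Qed.

Lemma iter_laplm_lin k (a b : R) U V p :
  smooth_on upper U -> smooth_on upper V -> upper p ->
  iter k A (fun q => a * U q + b * V q) p = a * iter k A U p + b * iter k A V p.
Proof.
move=> sU sV; elim: k p => // k IH p p2 /=.
by rewrite (eqon_laplm IH)// laplm_lin//; exact: smooth_iter_laplm.
Qed.

Lemma smooth_dotpp W : open W -> smooth_on W (fun q => dotp q q).
Proof.
by move=> oW; apply: smooth_sumr => // o; apply: smooth_mul => //; exact: smooth_coord.
Qed.

(** The sl_2 relation [A, r^2] = 4 E + 2 N; the summand m of N comes from m y^-1 D_y r^2 = 2 m. *)
Lemma laplm_dotpp V p : smooth_on upper V -> upper p ->
  A (fun q => dotp q q * V q) p =
    dotp p p * A V p + 4 * euler V p + 2 * N * V p.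
Proof.
move=> sV p2.
have d1 o q : upper q -> 'D_(basis o) (fun q => dotp q q * V q) q =
    2 * (coord o q * V q) + dotp q q * 'D_(basis o) V q.
  move=> q2; rewrite deriveMp ?derive_dotpp ?dotp_basis//; first by ring.
    exact: differentiable_dotpp.
  exact: smooth_diff q2.
have d2 o : 'D_(basis o) ('D_(basis o) (fun q => dotp q q * V q)) p =
    2 * V p + 4 * (coord o p * 'D_(basis o) V p) +
    dotp p p * 'D_(basis o) ('D_(basis o) V) p.
  rewrite (eqon_derive _ open_upper (d1 o))//.
  have dV := smooth_diff sV p2.
  have dDV := smooth_diff (smooth_derive (basis o) sV) p2.
  have dc := @differentiable_coordp _ _ o p.
  have dq := @differentiable_dotpp _ _ p.
  rewrite deriveDp; [|apply: differentiableM; [exact: differentiable_cst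
    |exact: differentiableM]|exact: differentiableM].
  rewrite deriveZp; last exact: differentiableM.
  rewrite !deriveMp// derive_coord coord_basis eqxx mul1r derive_dotpp dotp_basis; ring.
have S : lapl (fun q => dotp q q * V q) p =
    2 * n.+1%:R * V p + 4 * euler V p + dotp p p * lapl V p.
  rewrite laplE (eq_bigr _ (fun o _ => d2 o)) !big_split /= -!mulr_sumr -laplE.
  rewrite sumr_const card_option card_ord -[V p *+ n.+1]mulr_natr -/(euler V p).
  by move: (lapl V p) (euler V p) => *; ring.
rewrite /laplm S -/(basis None) d1//= -(natr1 n); field.
by rewrite gt_eqF.
Qed.

(** Both parts of A lower homogeneity by two, whence [A, E] = 2 A. For m y^-1 D_y the coefficient
    contributes one unit and the derivative the other. *)
Lemma laplm_euler V p : smooth_on upper V -> upper p ->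
  A (euler V) p = euler (A V) p + 2 * A V p.
Proof.
move=> sV p2; have sE := smooth_euler open_upper sV.
have sD v : smooth_on upper ('D_v V) by exact: smooth_derive.
have sDD o : smooth_on upper ('D_(basis o) ('D_(basis o) V)) by exact: smooth_derive.
have d2 o : 'D_(basis o) ('D_(basis o) (euler V)) p =
    euler ('D_(basis o) ('D_(basis o) V)) p + 2 * 'D_(basis o) ('D_(basis o) V) p.
  rewrite (eqon_derive _ open_upper (fun q => derive_euler o open_upper sV))//.
  rewrite deriveDp; [|exact: smooth_diff (smooth_euler open_upper (sD _)) p2
    |exact: smooth_diff (sD _) p2].
  rewrite (derive_euler o open_upper (sD _) p2); ring.
have sy : smooth_on upper (fun q : pt => m * (q.2)^-1).
  by apply: smooth_scale => //; exact: smooth_height_inv.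
have Dy o : 'D_(basis o) (fun q : pt => m * (q.2)^-1) p =
    - m * (coord None (basis o)) * (p.2)^-1 ^+ 2.
  rewrite (eqon_derive (V := fun q : pt => m * q.2 `^ (- 1)) _ open_upper)//; last first.
    by move=> q q2; rewrite powR_inv1 ?ltW.
  have [dd DD] := derive_height_powR (- 1) (basis o) p2.
  rewrite deriveZp// DD (_ : - 1 - 1 = - 2%:R); last by rewrite -[2%:R]/(1 + 1); ring.
  by rewrite powRN powR_mulrn ?ltW// exprVn /=; ring.
have Eprod : euler (fun q : pt => m * (q.2)^-1 * 'D_e_y V q) p =
    m * (p.2)^-1 * euler ('D_e_y V) p - m * (p.2)^-1 * 'D_e_y V p.
  rewrite {1}/euler.
  under eq_bigr => o _.
    rewrite deriveMp; [|exact: smooth_diff sy p2|exact: smooth_diff (sD _) p2].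
    rewrite Dy mulrDr.
    over.
  rewrite big_split /= addrC; congr (_ + _).
    by rewrite /euler mulr_sumr; apply: eq_bigr => o _; ring.
  rewrite (bigD1 None) //= big1; last first.
    by move=> [i|]//= _; rewrite !(mulr0, mul0r).
  by rewrite addr0; field; rewrite gt_eqF.
have Esum : euler (lapl V) p = \sum_o euler ('D_(basis o) ('D_(basis o) V)) p.
  have -> : lapl V = fun q => \sum_o 'D_(basis o) ('D_(basis o) V) q.
    by apply/funext => q; exact: laplE.
  rewrite [RHS]exchange_big; apply: eq_bigr => o' _; rewrite -mulr_sumr.
  congr (_ * _); apply: derive_sump => o; exact: smooth_diff (sDD o) p2.
have Eadd : euler (A V) p = euler (lapl V) p +
    euler (fun q : pt => m * (q.2)^-1 * 'D_e_y V q) p.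
  rewrite /euler -big_split; apply: eq_bigr => o _ /=; rewrite -mulrDr -deriveDp//.
    by apply: smooth_diff p2; exact: smooth_lapl.
  by apply: smooth_diff p2; exact: smooth_mul.
have S : lapl (euler V) p =
    \sum_o euler ('D_(basis o) ('D_(basis o) V)) p + 2 * lapl V p.
  by rewrite !laplE mulr_sumr -big_split; apply: eq_bigr => o _; exact: d2.
rewrite Eadd Esum Eprod /laplm S -/(basis None).
rewrite (derive_euler None open_upper sV p2); ring.
Qed.

Lemma iter_laplm_euler k V p : smooth_on upper V -> upper p ->
  iter k A (euler V) p = euler (iter k A V) p + 2 * k%:R * iter k A V p.
Proof.
move=> sV; elim: k p => [|k IH] p p2 /=; first by ring.
have sk := smooth_iter_laplm k sV.
rewrite (@eqon_laplm _ (fun q => 1 * euler (iter k A V) q +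
   2 * k%:R * iter k A V q))//; last by move=> q q2; rewrite IH// mul1r.
rewrite laplm_lin//; last exact: smooth_euler.
by rewrite laplm_euler// -!natr1; ring.
Qed.

(** Each of the k + 1 factors A contributes a commutator 4 E + 2 N; moving E to the front past the
    other factors yields an arithmetic progression, whose sum adds 2k to N. *)
Lemma iter_laplm_dotpp k V p : smooth_on upper V -> upper p ->
  iter k.+1 A (fun q => dotp q q * V q) p =
    dotp p p * iter k.+1 A V p + 4 * k.+1%:R * euler (iter k A V) p +
    2 * k.+1%:R * (N + 2 * k%:R) * iter k A V p.
Proof.
move=> sV; elim: k p => [|k IH] p p2; first by rewrite /= laplm_dotpp//; ring.
have sk := smooth_iter_laplm k sV; have sk1 := smooth_iter_laplm k.+1 sV.
rewrite iterS (@eqon_laplm _ (fun q => 1 * (dotp q q * iter k.+1 A V q) +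
  1 * (4 * k.+1%:R * euler (iter k A V) q +
    2 * k.+1%:R * (N + 2 * k%:R) * iter k A V q)))//; last first.
  by move=> q q2; rewrite IH//; ring.
rewrite laplm_lin//; last 2 first.
- by apply: smooth_mul => //; exact: smooth_dotpp.
- by apply: smooth_add => //; apply: smooth_scale => //; exact: smooth_euler.
rewrite laplm_lin//; last exact: smooth_euler.
rewrite laplm_dotpp// laplm_euler// -!iterS.
by rewrite -(natr1 k); ring.
Qed.

(** The factor r^2 is kept inside, so that the whole expression has the single Kelvin weight [a - 2]
    and further powers of A can be treated by induction. *)
Lemma laplm_kelvin (a : R) V p : smooth_on upper V -> upper p ->
  A (kelvin a V) p = kelvin (a - 2) (fun q => dotp q q * A V q +
    (- 2 * (a + N - 2) * euler V q + a * (a + N - 2) * V q)) p.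
Proof.
move=> sV p2; have p0 := upper_neq0 p2.
rewrite laplmE// (Sop_kelvin _ _ open_upper sV (upper_kelvin_dom p2)).
rewrite /kelvin (laplmE _ (upper_inv p2)).
have -> : (inv_half p).2 = r_half p `^ (- 2) * p.2 by exact: (coord_inv None).
rewrite dotp_inv//; field.
by rewrite !gt_eqF// powR_gt0 ?r_half_gt0.
Qed.

Lemma iter_laplm_kelvin k U p : smooth_on upper U -> upper p ->
  iter k A (kelvin (2 * k%:R - N) U) p = kelvin (- 2 * k%:R - N) (iter k A U) p.
Proof.
move=> sU; elim: k U sU p => [|k IH] U sU p p2.
  by rewrite /=; congr (kelvin _ _ _); ring.
(* This is [laplm_kelvin] at a = 2 (k + 1) - N, where a + N - 2 = 2k and the new weight a - 2 = 2k -
   N is that of the induction hypothesis. *)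
pose V q := 1 * (dotp q q * A U q) + 1 * (- 2 * (2 * k%:R) * euler U q +
   (2 * k%:R + 2 - N) * (2 * k%:R) * U q).
have sAU := smooth_laplm sU; have sE := smooth_euler open_upper sU.
have sqA : smooth_on upper (fun q => dotp q q * A U q).
  by apply: smooth_mul => //; exact: smooth_dotpp.
have sEU : smooth_on upper (fun q => - 2 * (2 * k%:R) * euler U q +
   (2 * k%:R + 2 - N) * (2 * k%:R) * U q).
  by apply: smooth_add => //; exact: smooth_scale.
have sV : smooth_on upper V by apply: smooth_add => //; exact: smooth_scale.
rewrite iterSr (@eqon_iter_laplm _ _ (kelvin (2 * k%:R - N) V))//; last first.
  move=> q q2; rewrite laplm_kelvin// -(natr1 k).
  rewrite (_ : 2 * (k%:R + 1) - N - 2 = 2 * k%:R - N); last by ring.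
  by congr (_ * _); rewrite /V; ring.
rewrite IH// /kelvin.
have p0 := upper_neq0 p2; set q := inv_half p.
have q2 : upper q by exact: upper_inv.
have -> : iter k A V q = dotp q q * iter k.+1 A U q.
  rewrite iter_laplm_lin// iter_laplm_lin// iter_laplm_euler//.
  (* For k > 0 the coefficients of E A^k U cancel as 4k - 4k, those of A^k U as 2k (N + 2k - 2) -
     8k^2 + 2k (2k + 2 - N). For k = 0 only r^2 A U is present. *)
  case: k {IH V sEU sV} => [|k]; first by rewrite /=; ring.
  rewrite iter_laplm_dotpp// -!iterSr -(natr1 k); ring.
rewrite dotp_inv// mulrA -r_half_powRD//; congr (_ `^ _ * _).
by rewrite -(natr1 k); ring.
Qed.

End Interior.

(** * Covariance of the interior operator *)

Section InteriorCovariance.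
Context {R : realType} {n : nat}.
Local Notation pt := ('rV[R]_n * R)%type.
Implicit Types (p q : pt) (U : pt -> R).

Lemma chalf0_upper p : upper p -> chalf0 p.
Proof. by move=> p2; split; [exact: ltW|exact: upper_neq0]. Qed.

Lemma smooth_adapted gamma U : adapted gamma U -> smooth_on upper U.
Proof.
move=> [F [G [[WF [VF [_ sWF sVF FE _]]] [WG [VG [_ sWG sVG GE _]]] UE]]].
apply: (@smooth_eqon _ _ _ (fun p => VF p + p.2 `^ (2 * fracpart gamma) * VG p)).
- exact: open_upper.
- move=> q /chalf0_upper q2; rewrite UE// FE// GE//.
- apply: smooth_add; first exact: open_upper.
    by apply: smooth_sub sVF => q /chalf0_upper; exact: sWF.
  apply: smooth_mul; first exact: open_upper.
    exact: smooth_height_powR.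
  by apply: smooth_sub sVG => q /chalf0_upper; exact: sWG.
Qed.

Lemma hat_int_Lop gamma U p : adapted gamma U -> upper p ->
  hat_int (Lop gamma) U p =
    r_half p `^ (n%:R - 2 * fracpart gamma + 4 + 2 * (intpart gamma)%:R) *
    Lop gamma (fun q => r_half q `^ (2 * gamma - n%:R) * U q) p.
Proof.
move=> aU p2; have sU := smooth_adapted aU; have p0 := upper_neq0 p2.
have sU' : smooth_on upper (U \o inv_half).
  apply: (@smooth_eqon _ _ _ (kelvin 0 U)); first exact: open_upper.
    by move=> q _; rewrite /kelvin powRr0 mul1r.
  apply: smooth_sub (@upper_kelvin_dom _ _) _.
  by apply: smooth_kelvin => //; exact: open_upper.
rewrite /hat_int /Lop /=; set k := (intpart gamma).+1; set m := mwt gamma.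
rewrite -!iterS -/k.
rewrite (@eqon_iter_laplm _ _ m k (fun q => _)
  (kelvin (2 * k%:R - (n%:R + 1 + m)) (U \o inv_half)) p _ p2); last first.
  move=> q /upper_neq0 q0; rewrite /kelvin /= inv_halfK//; congr (_ `^ _ * _).
  by rewrite /k /m /mwt /fracpart -(natr1 (intpart gamma)); move: (intpart gamma)%:R => z; ring.
rewrite iter_laplm_kelvin// /kelvin mulrA -r_half_powRD//.
(* The exponent of the prefactor is 2k + N. *)
set e := (X in _ `^ X); have -> : e = 0.
  by rewrite /e /k /m /mwt -(natr1 (intpart gamma)); ring.
by rewrite powRr0 mul1r.
Qed.

End InteriorCovariance.

(** * Normal derivatives at the boundary *)

Section BoundaryJets.
Context {R : realType} {n : nat}.
Local Notation pt := ('rV[R]_n * R)%type.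
Implicit Types (p q v w : pt) (U V Z : pt -> R) (W : set pt) (o : option 'I_n).
Implicit Types (x : 'rV[R]_n) (f : 'rV[R]_n -> R).

Definition dy j V : pt -> R := iter j (fun Z => 'D_e_y Z) V.

Local Arguments dy : simpl never.

Definition van V := forall x, x <> 0 -> V (x, 0) = 0.

(** Such a set reaches below y = 0, so normal derivatives at the boundary are two-sided derivatives
    of the smooth extensions. *)
Definition bdry_nbhd W := open W /\ forall x, x <> 0 -> W (x, 0).

Lemma dySr j V : dy j.+1 V = dy j ('D_e_y V).
Proof. exact: iterSr. Qed.

Lemma smooth_dy W j V : smooth_on W V -> smooth_on W (dy j V).
Proof. exact: smooth_iter_derive. Qed.

Lemma eqon_dy W j U V p : open W -> (forall q, W q -> U q = V q) -> W p ->
  dy j U p = dy j V p.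
Proof.
move=> oW; elim: j U V p => [|j IH] U V p UV Wp; first exact: UV.
by rewrite !dySr; apply: IH => // q Wq; exact: (eqon_derive _ oW).
Qed.

Lemma derive_slice V x (y : R) (v : 'rV[R]_n) :
  'D_((v, 0) : pt) V (x, y) = 'D_v (fun x' => V (x', y)) x.
Proof.
rewrite /derive; set f := (X in lim (X @ _)); set g := (X in _ = lim (X @ _)).
suff -> : f = g by [].
apply/funext => h; rewrite /f /g /=.
suff -> : h *: ((v, 0) : pt) + (x, y) = (h *: v + x, y) by [].
congr (_, _); transitivity (h * 0 + y : R); first by [].
by rewrite mulr0 add0r.
Qed.

Lemma open_neq0 : open [set x : 'rV[R]_n | x <> 0].
Proof.
have -> : [set x' : 'rV[R]_n | x' <> 0] = ~` [set 0] by apply/seteqP; split.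
apply: closed_openC; apply: accessible_closed_set1.
by apply: hausdorff_accessible; exact: norm_hausdorff.
Qed.

Lemma van_derive V i : van V -> van ('D_(basis (Some i)) V).
Proof.
move=> vV x x0; rewrite derive_slice.
rewrite (near_eq_derive (g := cst 0)); first exact: derive_cst.
have : nbhs x [set x' | x' <> 0] by exact: (open_nbhs_nbhs (conj open_neq0 x0)).
by apply: filterS => x' /vV.
Qed.

Lemma derive_dy W j V o p : open W -> smooth_on W V -> W p ->
  dy j ('D_(basis o) V) p = 'D_(basis o) (dy j V) p.
Proof.
move=> oW; elim: j V p => [//|j IH] V p sV Wp.
rewrite !dySr -(IH ('D_e_y V) p (smooth_derive _ sV) Wp).
by apply: (eqon_dy j oW _ Wp) => q Wq; exact: derive_comm oW sV Wq.
Qed.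

Lemma dy_lin W j (a b : R) U V p : open W -> smooth_on W U -> smooth_on W V -> W p ->
  dy j (fun q => a * U q + b * V q) p = a * dy j U p + b * dy j V p.
Proof.
move=> oW; elim: j U V p => [//|j IH] U V p sU sV Wp.
rewrite !dySr.
rewrite -(IH _ _ p (smooth_derive e_y sU) (smooth_derive e_y sV) Wp).
apply: (eqon_dy j oW _ Wp) => q Wq.
have dU := smooth_diff sU Wq; have dV := smooth_diff sV Wq.
by rewrite deriveDp ?deriveZp//; apply: differentiableM => //;
  exact: differentiable_cst.
Qed.

Lemma dy_sum W j (I : Type) (r : seq I) (F : I -> pt -> R) p : open W ->
  (forall i, smooth_on W (F i)) -> W p ->
  dy j (fun q => \sum_(i <- r) F i q) p = \sum_(i <- r) dy j (F i) p.
Proof.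
move=> oW sF Wp; elim: r => [|i r IH].
  rewrite big_nil (eqon_dy (V := fun q => 0 * cst 0 q + 0 * cst 0 q) _ oW)//.
    by rewrite (dy_lin _ _ _ oW)//; [rewrite !mul0r addr0|exact: smooth_cst..].
  by move=> q _; rewrite big_nil !mul0r addr0.
rewrite big_cons -IH (eqon_dy (V := fun q => 1 * F i q +
  1 * \sum_(j <- r) F j q) _ oW)//; last by move=> q _; rewrite big_cons !mul1r.
by rewrite (dy_lin _ _ _ oW) ?mul1r//; exact: smooth_sumr.
Qed.

Lemma dy_height W j V p : open W -> smooth_on W V -> W p ->
  dy j (fun q => q.2 * V q) p = p.2 * dy j V p + j%:R * dy j.-1 V p.
Proof.
move=> oW; elim: j V p => [|j IH] V p sV Wp; first by rewrite mul0r addr0.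
have sD := smooth_derive e_y sV.
have sc := @smooth_coord R n W None.
rewrite dySr (eqon_dy (V := fun q => 1 * V q + 1 * (q.2 * 'D_e_y V q)) _ oW)//.
  rewrite (dy_lin _ _ _ oW)//; last exact: smooth_mul.
  rewrite IH// dySr /= -(natr1 j); move: (dy j ('D_e_y V) p) => z.
  case: j {IH} => [|j] /=; first by move: (dy 0 V p) (dy 0 _ p) => *; ring.
  by rewrite -dySr; move: (dy j.+1 V p) => *; ring.
move=> q Wq; rewrite (@deriveMp _ _ (coord None))//; last exact: smooth_diff Wq.
  rewrite (_ : e_y = basis None)// derive_coord coord_basis eqxx /=.
  by rewrite !mul1r.
exact: differentiable_coordp.
Qed.

Lemma dy_mul_coord W j i V p : open W -> smooth_on W V -> W p ->
  dy j (fun q => coord (Some i) q * V q) p = coord (Some i) p * dy j V p.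
Proof.
move=> oW; elim: j V p => [//|j IH] V p sV Wp.
rewrite !dySr -(IH _ p (smooth_derive e_y sV) Wp).
apply: (eqon_dy j oW _ Wp) => q Wq.
rewrite deriveMp; [|exact: differentiable_coordp|exact: smooth_diff Wq].
by rewrite derive_coord (coord_basis _ None) mul0r add0r.
Qed.

Lemma smooth_heightX W k V : open W -> smooth_on W V ->
  smooth_on W (fun p => p.2 ^+ k * V p).
Proof.
move=> oW sV; apply: smooth_mul => //; elim: k => [|k IH].
  by apply: (smooth_eqon (U := cst 1)) => //; exact: smooth_cst.
apply: (smooth_eqon (U := fun p => coord None p * p.2 ^+ k)) => //.
  by move=> p _; rewrite exprS.
by apply: smooth_mul => //; exact: smooth_coord.
Qed.

(** For j < k the falling factorial is zero, which makes the truncated [j - k] harmless. *)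
Lemma dy_heightX W j k V x : bdry_nbhd W -> smooth_on W V -> x <> 0 ->
  dy j (fun q => q.2 ^+ k * V q) (x, 0) = (j ^_ k)%:R * dy (j - k) V (x, 0).
Proof.
move=> [oW bW] sV x0; have Wx := bW x x0.
elim: k j => [|k IH] j.
  rewrite ffactn0 subn0 mul1r; apply: (eqon_dy _ oW) => // q _.
  by rewrite expr0 mul1r.
rewrite (eqon_dy (V := fun q => q.2 * (q.2 ^+ k * V q)) _ oW)//; last first.
  by move=> q _; rewrite exprS mulrA.
have sk : smooth_on W (fun q => q.2 ^+ k * V q) by exact: smooth_heightX.
rewrite (dy_height _ oW)//= mul0r add0r IH; case: j => [|j] /=.
  by rewrite mul0r ffact0n mul0r.
by rewrite ffactSS natrM mulrA subSS.
Qed.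

(** E is tangent to the boundary: at y = 0 its normal part y D_y multiplies the j-th normal
    derivative by j, and its tangential part differentiates that derivative along the boundary. *)
Lemma van_dy_euler W j V : bdry_nbhd W -> smooth_on W V -> van (dy j V) ->
  van (dy j (euler V)).
Proof.
move=> [oW bW] sV vV x x0; have Wx := bW x x0.
have sm o : smooth_on W (fun q => coord o q * 'D_(basis o) V q).
  by apply: smooth_mul => //; [exact: smooth_coord|exact: smooth_derive].
rewrite (dy_sum _ _ oW sm)// sum_option big1 => [|i _]; last first.
  rewrite (dy_mul_coord _ _ oW)//; last exact: smooth_derive.
  by rewrite (derive_dy _ _ oW)// van_derive// mulr0.
rewrite addr0 (@dy_height W j ('D_e_y V))//; last exact: smooth_derive.
rewrite mul0r add0r; case: j vV => [|j] vV; first by rewrite mul0r.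
by rewrite -dySr vV ?mulr0.
Qed.

Lemma r_half_bdry x : r_half (x, 0) = r_bdry x :> R.
Proof. by rewrite /r_half /r_bdry /= expr0n addr0. Qed.

Lemma inv_half_bdry x : inv_half (x, 0) = (inv_bdry x, 0) :> pt.
Proof. by rewrite /inv_half r_half_bdry; congr (_, _); exact: mulr0. Qed.

Lemma bdry_neq0 x : x <> 0 -> (x, 0) <> 0 :> pt.
Proof. by move=> x0 []. Qed.

Lemma inv_bdry_neq0 x : x <> 0 -> inv_bdry x <> 0.
Proof.
move=> x0 i0; apply: (inv_half_neq0 (bdry_neq0 x0)).
by rewrite inv_half_bdry i0.
Qed.

Lemma kelvin_bdry (a : R) V x :
  kelvin a V (x, 0) = r_bdry x `^ a * V (inv_bdry x, 0).
Proof. by rewrite /kelvin r_half_bdry inv_half_bdry. Qed.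

Lemma bdry_nbhd_kelvin W : bdry_nbhd W -> bdry_nbhd (kelvin_dom W).
Proof.
move=> [oW bW]; split; first exact: open_kelvin_dom.
move=> x x0; split; first exact: bdry_neq0.
by rewrite inv_half_bdry; apply: bW; exact: inv_bdry_neq0.
Qed.

(* Normal derivatives of the Kelvin transform only involve normal derivatives
   of the same parity: the inversion commutes with [y |-> - y]. *)
Lemma van_dy_kelvin W j (a : R) V : bdry_nbhd W -> smooth_on W V ->
  (forall i, (i <= j)%N -> odd i = odd j -> van (dy i V)) ->
  van (dy j (kelvin a V)).
Proof.
move=> bW; have [oW _] := bW; have [oW' bW'] := bdry_nbhd_kelvin bW.
elim/ltn_ind: j a V => -[|j] IH a V sV vV x x0.
  have V0 : V (inv_bdry x, 0) = 0 by exact: (vV 0%N isT erefl _ (inv_bdry_neq0 x0)).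
  by rewrite -[LHS]/(kelvin a V (x, 0)) kelvin_bdry V0 mulr0.
have sD := smooth_derive e_y sV.
have sE := smooth_euler oW sV.
pose Y q := a * V q + - 2 * euler V q.
have sY : smooth_on W Y by apply: smooth_add => //; exact: smooth_scale.
have Wx := bW' x x0.
(* At y = 0 one of the j remaining derivatives is spent on the factor y, leaving order j - 1 on the
   second term: again the parity of j + 1. *)
rewrite dySr (eqon_dy (V := fun q => 1 * kelvin (a - 2) ('D_e_y V) q +
   1 * (q.2 * kelvin (a - 2) Y q)) _ oW')//; last first.
  move=> q [q0 Wq]; rewrite derive_kelvin//; last exact: smooth_diff Wq.
  by rewrite (dotp_basis None) /kelvin /Y mulNr !mul1r.
have sc := @smooth_coord R n (kelvin_dom W) None.
have sK b Z : smooth_on W Z -> smooth_on (kelvin_dom W) (kelvin b Z).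
  exact: smooth_kelvin.
rewrite (dy_lin _ _ _ oW'); [|exact: sK|apply: smooth_mul => //; exact: sK|exact: Wx].
rewrite (dy_height _ oW' (sK _ _ sY) Wx) !mul1r mul0r add0r.
rewrite IH// => [|i ij oi]; last by rewrite -dySr; apply: vV => //=; rewrite oi.
case: j IH vV => [|j] IH vV; first by rewrite mul0r addr0.
rewrite [X in _ * X](IH j _ _ Y)// ?mulr0 ?addr0// => i ij oi z z0.
have vi : van (dy i V).
  by apply: vV; rewrite ?(leq_trans ij)//=; [exact: leqW|rewrite oi negbK].
rewrite (dy_lin _ _ _ oW)//; last by apply: bW.2.
by rewrite vi// (van_dy_euler bW)// !mulr0 addr0.
Qed.

Lemma laplbar_slice Z x :
  \sum_(i < n) 'D_(basis (Some i)) ('D_(basis (Some i)) Z) (x, 0) =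
  laplbar (fun x' => Z (x', 0)) x.
Proof.
apply: eq_bigr => i _; pose d : 'rV[R]_n := delta_mx 0 i.
have E : (fun x' => 'D_(basis (Some i)) Z (x', 0)) = 'D_d (fun x' => Z (x', 0)).
  by apply/funext => x'; exact: (derive_slice Z x' 0 d).
transitivity ('D_d (fun x' => 'D_(basis (Some i)) Z (x', 0)) x).
  exact: (derive_slice ('D_(basis (Some i)) Z) x 0 d).
by rewrite E.
Qed.

(** Odd derivatives of y Delta_m V link consecutive even derivatives of V: one derivative is spent
    on y, and m D_y shifts the factor 2j + 1 by m. *)
Lemma dy_Sop W j (m : R) V x : bdry_nbhd W -> smooth_on W V -> x <> 0 ->
  dy (2 * j).+1 (Sop m V) (x, 0) =
    (2 * j).+1%:R * laplbar (fun x' => dy (2 * j) V (x', 0)) x +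
    ((2 * j).+1%:R + m) * dy (2 * j.+1) V (x, 0).
Proof.
move=> [oW bW] sV x0; have Wx := bW x x0; have sL := smooth_lapl oW sV.
have sD := smooth_derive e_y sV.
have sDD o := smooth_derive (basis o) (smooth_derive (basis o) sV).
have sc := @smooth_coord R n W None.
rewrite (eqon_dy (V := fun q => 1 * (q.2 * lapl V q) + m * 'D_e_y V q) _ oW)//.
  2: by move=> q _; rewrite mul1r.
rewrite (dy_lin _ _ _ oW)//; last exact: smooth_mul.
rewrite (dy_height _ oW sL Wx) !mul1r mul0r add0r -dySr mulnS add2n /=.
have -> : dy (2 * j) (lapl V) (x, 0) =
    laplbar (fun x' => dy (2 * j) V (x', 0)) x + dy (2 * j).+2 V (x, 0).
  rewrite (eqon_dy (V := fun q => \sum_o 'D_(basis o) ('D_(basis o) V) q) _ oW)//.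
    2: by move=> q _; exact: laplE.
  rewrite (dy_sum _ _ oW sDD Wx) sum_option addrC !dySr.
  congr (_ + _); rewrite -laplbar_slice; apply: eq_bigr => i _.
  rewrite (derive_dy (2 * j) (Some i) oW (smooth_derive _ sV) Wx).
  by apply: (eqon_derive _ oW _ Wx) => q Wq; exact: (derive_dy _ _ oW).
by move: (dy _.+2 V _) (laplbar _ _) => *; ring.
Qed.

End BoundaryJets.

(** * Boundary functions and even Taylor coefficients *)

Section BoundaryFunctions.
Context {R : realType} {n : nat}.
Local Notation pt := ('rV[R]_n * R)%type.
Implicit Types (p q v w : pt) (U V Z : pt -> R) (W : set pt) (o : option 'I_n).
Implicit Types (x : 'rV[R]_n) (f g : 'rV[R]_n -> R).

Definition punctured : set pt := [set p | p.1 <> 0].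

(** Constant extension in y, which lets the calculus for functions of (x, y) serve boundary
    functions as well. *)
Definition lift f p : R := f p.1.

Definition smooth_bdry f := smooth_on punctured (lift f).

Lemma open_punctured : open punctured.
Proof.
apply: (@open_comp _ _ (@fst 'rV[R]_n R) [set x | x <> 0]); last exact: open_neq0.
by move=> p _; exact: cvg_fst.
Qed.

Lemma bdry_nbhd_punctured : bdry_nbhd punctured.
Proof. by split; first exact: open_punctured. Qed.

Lemma smooth_bdry_eq f g : (forall x, x <> 0 -> f x = g x) ->
  smooth_bdry f -> smooth_bdry g.
Proof.
by move=> fg; apply: smooth_eqon => [|p p0]; [exact: open_punctured|exact: fg].
Qed.

Lemma smooth_bdryZ (c : R) f : smooth_bdry f -> smooth_bdry (fun x => c * f x).
Proof. by apply: smooth_scale; exact: open_punctured. Qed.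

Lemma smooth_bdryD f g : smooth_bdry f -> smooth_bdry g ->
  smooth_bdry (fun x => f x + g x).
Proof. by apply: smooth_add; exact: open_punctured. Qed.

Lemma smooth_bdry_sum (I : Type) (r : seq I) (F : I -> 'rV[R]_n -> R) :
  (forall i, smooth_bdry (F i)) -> smooth_bdry (fun x => \sum_(i <- r) F i x).
Proof. by apply: smooth_sumr; exact: open_punctured. Qed.

Let proj p : pt := (p.1, 0).

Let differentiable_proj p : differentiable proj p.
Proof.
have -> : proj = (fun q => q - coord None q *: basis None).
  apply/funext => q; rewrite /proj; case: q => x y; congr (_, _) => /=.
    by transitivity (x - y *: (0 : 'rV[R]_n)); [rewrite scaler0 subr0|].
  by transitivity (y - y * 1); [rewrite mulr1 subrr|].
apply: differentiableB; first exact: (@ex_diff _ _ _ _ _ _ _ (is_diff_id p)).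
by apply: differentiableZl; exact: differentiable_coordp.
Qed.

Lemma smooth_trace W Z : bdry_nbhd W -> smooth_on W Z ->
  smooth_bdry (fun x => Z (x, 0)).
Proof.
move=> [oW bW] /smooth_onP sZ; apply/smooth_onP => k.
have dZ Y p : Ck 0 W Y -> punctured p ->
    differentiable (lift (fun x => Y (x, 0))) p.
  move=> [dY _] p0; apply: (@differentiable_comp _ _ _ _ proj Y).
    exact: differentiable_proj.
  by apply: dY; exact: bW.
have {sZ} := sZ k; elim: k Z => [|k IH] Z sZ.
  by split=> // p; exact: dZ.
have s0 : Ck 0 W Z by split=> // p; exact: (Ck_diff sZ).
split=> [p|v]; first exact: dZ.
have E : 'D_v (lift (fun x => Z (x, 0))) = lift (fun x => 'D_((v.1, 0) : pt) Z (x, 0)).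
  apply/funext => p; rewrite /derive /lift.
  set f := (X in lim (X @ _)); set g := (X in _ = lim (X @ _)).
  suff -> : f = g by [].
  apply/funext => h; rewrite /f /g /=; congr (_ *: (Z _ - _)); congr (_, _).
  by transitivity (h * 0 + 0 : R); [rewrite mulr0 addr0|].
by rewrite E; exact: (IH ('D_((v.1, 0) : pt) Z) (sZ.2 _)).
Qed.

Lemma lift_laplbar f p : lift (laplbar f) p =
  \sum_(i < n) 'D_(basis (Some i)) ('D_(basis (Some i)) (lift f)) p.
Proof.
case: p => x y; apply: eq_bigr => i _; pose d : 'rV[R]_n := delta_mx 0 i.
have E : (fun x' => 'D_(basis (Some i)) (lift f) (x', y)) = 'D_d f.
  by apply/funext => x'; exact: (derive_slice (lift f) x' y d).
transitivity ('D_d (fun x' => 'D_(basis (Some i)) (lift f) (x', y)) x).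
  by rewrite E.
by apply/esym; exact: (derive_slice ('D_(basis (Some i)) (lift f)) x y d).
Qed.

Lemma smooth_laplbar f : smooth_bdry f -> smooth_bdry (laplbar f).
Proof.
move=> sf; rewrite /smooth_bdry (_ : lift (laplbar f) = fun p =>
  \sum_(i < n) 'D_(basis (Some i)) ('D_(basis (Some i)) (lift f)) p).
  apply: smooth_sumr; first exact: open_punctured.
  by move=> i; do 2! apply: smooth_derive.
by apply/funext => p; exact: lift_laplbar.
Qed.

Lemma smooth_iter_laplbar k f : smooth_bdry f -> smooth_bdry (iter k laplbar f).
Proof. by move=> sf; elim: k => //= k; exact: smooth_laplbar. Qed.

Lemma eqon_laplbar f g x : (forall x, x <> 0 -> f x = g x) -> x <> 0 ->
  laplbar f x = laplbar g x.
Proof.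
move=> fg x0; have d1 h k (v : 'rV[R]_n) z : (forall z, z <> 0 -> h z = k z) -> z <> 0 ->
    'D_v h z = 'D_v k z.
  move=> hk z0; apply: near_eq_derive.
  have : nbhs z [set z | z <> 0] by exact: (open_nbhs_nbhs (conj open_neq0 z0)).
  by apply: filterS => ? /hk.
apply: eq_bigr => i _; apply: (d1); last exact: x0.
by move=> z z0; apply: d1; [exact: fg|exact: z0].
Qed.

Lemma eqon_iter_laplbar k f g x : (forall x, x <> 0 -> f x = g x) -> x <> 0 ->
  iter k laplbar f x = iter k laplbar g x.
Proof.
move=> fg; elim: k x => [|k IH] x x0 /=; first exact: fg.
exact: eqon_laplbar.
Qed.

Lemma laplbarZ (c : R) f x : smooth_bdry f -> x <> 0 ->
  laplbar (fun x => c * f x) x = c * laplbar f x.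
Proof.
move=> sf x0; pose p : pt := (x, 0).
have D1 v q : punctured q -> 'D_v (lift (fun x => c * f x)) q = c * 'D_v (lift f) q.
  by move=> q0; apply: deriveZp; exact: smooth_diff q0.
transitivity (lift (laplbar (fun x => c * f x)) p); first by [].
transitivity (c * \sum_(i < n) 'D_(basis (Some i)) ('D_(basis (Some i)) (lift f)) p).
  rewrite lift_laplbar mulr_sumr; apply: eq_bigr => i _.
  rewrite (eqon_derive _ open_punctured (fun q => D1 _ q) (p := p))//.
  by apply: deriveZp; apply: smooth_diff (x0 : punctured p); exact: smooth_derive.
by rewrite -lift_laplbar.
Qed.

(** The coefficient of y^(2l) in the Taylor expansion at y = 0. *)
Definition jet l V x : R := dy (2 * l) V (x, 0) / ((2 * l)`!)%:R.

Lemma smooth_jet W l V : bdry_nbhd W -> smooth_on W V -> smooth_bdry (jet l V).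
Proof.
move=> bW sV; apply: (@smooth_bdry_eq (fun x => ((2 * l)`!)%:R^-1 * dy (2 * l) V (x, 0))).
  by move=> x _; rewrite mulrC.
by apply: smooth_bdryZ; apply: smooth_trace bW _; exact: smooth_dy.
Qed.

Lemma factR_neq0 k : (k`!)%:R != 0 :> R.
Proof. by rewrite pnatr_eq0 -lt0n fact_gt0. Qed.

Lemma dy_jet l V x : dy (2 * l) V (x, 0) = ((2 * l)`!)%:R * jet l V x.
Proof. by rewrite mulrC divfK ?factR_neq0. Qed.

(** For Taylor coefficients c_j the factorials separate, and vanishing of the left-hand side becomes
    the power series recursion 2 (j + 1) (2j + 1 + m) c_(j+1) = - [laplbar] c_j. *)
Lemma dy_Sop_jet W j (m : R) V x : bdry_nbhd W -> smooth_on W V -> x <> 0 ->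
  dy (2 * j).+1 (Sop m V) (x, 0) = (((2 * j).+1)`!)%:R *
   (laplbar (jet j V) x + 2 * j.+1%:R * ((2 * j).+1%:R + m) * jet j.+1 V x).
Proof.
move=> bW sV x0; rewrite (dy_Sop _ _ bW sV x0).
rewrite (@eqon_laplbar _ (fun x => ((2 * j)`!)%:R * jet j V x))//; last first.
  by move=> z _; rewrite dy_jet.
rewrite laplbarZ//; last exact: smooth_jet bW sV.
rewrite dy_jet (_ : 2 * j.+1 = (2 * j).+2)%N; last by rewrite mulnS add2n.
rewrite !factS !natrM -[in X in _ = _ * (_ + X * _ * _)]natrM.
rewrite (_ : 2 * j.+1 = (2 * j).+2)%N; last by rewrite mulnS add2n.
by move: (laplbar _ _) (jet _ _ _) => *; ring.
Qed.

End BoundaryFunctions.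

(** * Kelvin transforms of power series solutions *)

Section KelvinCoefficients.
Context {R : realType} {n : nat}.
Local Notation pt := ('rV[R]_n * R)%type.
Implicit Types (p : pt) (U V Z : pt -> R) (W : set pt).
Implicit Types (x : 'rV[R]_n) (f : 'rV[R]_n -> R).

Lemma dy_lift j f p : dy j.+1 (lift f) p = 0.
Proof.
rewrite dySr; have -> : 'D_e_y (lift f) = fun=> 0.
  apply/funext => q; rewrite /derive /lift; apply: cvg_lim => //.
  apply: cvg_near_cst; near=> h; rewrite /=.
  have -> : (h *: (0 : 'rV[R]_n) + q.1) = q.1 by rewrite scaler0 add0r.
  by rewrite subrr scaler0.
elim: j => [//|j IH]; rewrite dySr (_ : 'D_e_y _ = fun=> 0)//.
by apply/funext => q; exact: derive_cst.
Unshelve. all: by end_near. Qed.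

Lemma jet_lift l k f x : smooth_bdry f -> x <> 0 ->
  jet l (fun p => p.2 ^+ (2 * k) * lift f p) x = (l == k)%:R * f x.
Proof.
move=> sf x0; rewrite /jet (dy_heightX _ _ (@bdry_nbhd_punctured _ _) sf x0).
have [->|lk] := eqVneq l k.
  by rewrite ffactnn subnn -[dy 0 _ _]/(f x) mulrAC divff ?factR_neq0.
rewrite mul0r; have [/ffact_small ->|kl] := ltnP (2 * l) (2 * k).
  by rewrite !mul0r.
have : (0 < 2 * l - 2 * k)%N.
  by rewrite subn_gt0 ltn_neqAle kl andbT eqn_mul2l /= eq_sym.
by case: (_ - _)%N => // j _; rewrite dy_lift mulr0 mul0r.
Qed.

Lemma jet_sum W l (I : Type) (r : seq I) (c : I -> R) (F : I -> pt -> R) x :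
  bdry_nbhd W -> (forall i, smooth_on W (F i)) -> x <> 0 ->
  jet l (fun p => \sum_(i <- r) c i * F i p) x = \sum_(i <- r) c i * jet l (F i) x.
Proof.
move=> [oW bW] sF x0; have Wx := bW x x0.
have scF i : smooth_on W (fun p => c i * F i p) by exact: smooth_scale.
rewrite /jet (dy_sum _ _ oW scF Wx) mulr_suml; apply: eq_bigr => i _.
rewrite (eqon_dy (V := fun p => c i * F i p + 0 * F i p) _ oW _ Wx).
  by rewrite (dy_lin _ _ _ oW (sF i) (sF i) Wx) mul0r addr0 mulrA.
by move=> p _; rewrite mul0r addr0.
Qed.

Lemma jet_lin W l (a b : R) U V x : bdry_nbhd W -> smooth_on W U -> smooth_on W V ->
  x <> 0 -> jet l (fun p => a * U p + b * V p) x = a * jet l U x + b * jet l V x.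
Proof.
move=> [oW bW] sU sV x0; rewrite /jet (dy_lin _ _ _ oW sU sV (bW x x0)).
by rewrite mulrDl !mulrA.
Qed.

Lemma eqon_jet W l U V x : bdry_nbhd W -> (forall p, W p -> U p = V p) ->
  x <> 0 -> jet l U x = jet l V x.
Proof. by move=> [oW bW] UV x0; rewrite /jet (eqon_dy _ oW UV (bW x x0)). Qed.

Lemma jet_heightX W l i V x : bdry_nbhd W -> smooth_on W V -> x <> 0 ->
  jet l (fun p => p.2 ^+ (2 * i) * V p) x =
    if (i <= l)%N then jet (l - i) V x else 0.
Proof.
move=> bW sV x0; rewrite /jet (dy_heightX _ _ bW sV x0); case: leqP => il.
  rewrite -mulnBr -[in LHS](@ffact_fact (2 * l) (2 * i)) ?leq_mul2l//.
  rewrite -mulnBr natrM invfM mulrACA divff ?mul1r//.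
  by rewrite pnatr_eq0 -lt0n ffact_gt0 leq_mul2l.
by rewrite ffact_small ?mul0r// ltn_pmul2l.
Qed.

Definition kelvin_trace (a : R) f x : R := r_bdry x `^ a * f (inv_bdry x).

Variables (g : R) (q : nat -> nat -> R) (phi : nat -> 'rV[R]_n -> R).
Hypothesis sphi : forall i, smooth_bdry (phi i).
Hypothesis gN : forall k : nat, k%:R - g != 0.
(** With d = l - i this is the recursion for the coefficients of y^(2d) in a solution of weight m =
    1 + 2 (2i - g), because 2 (d + 1) (2d + 1 + m) = 4 (d + 1) (d + 1 + 2i - g). *)
Hypothesis qrec : forall i l : nat, (i <= l)%N ->
  4 * (l.+1%:R - i%:R) * (l.+1%:R + i%:R - g) * q l.+1 i = - q l i.

(** The coefficient of y^(2l) in the sum of the y^(2i) P_i, where P_i has the coefficients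
    [q (i + d) i] times [iter d laplbar (f i)]. *)
Definition expansion (f : nat -> 'rV[R]_n -> R) l x : R :=
  \sum_(i < l.+1) q l i * iter (l - i) laplbar (f i) x.

Local Notation psi :=
  (fun i : nat => kelvin_trace (2 * g - n%:R - 4 * i%:R) (phi i)).

Section Truncation.
Variable N : nat.

(* A truncation of the power series solution, with boundary value [q i i * phi i],
   of the equation [Sop (mi i) = 0]. The weight in [H i] is the one for which the
   Kelvin transform preserves the solutions of this equation. *)
Let P i p : R := \sum_(l < (N - i).+1)
  q (i + l)%N i * (p.2 ^+ (2 * l) * lift (iter l laplbar (phi i)) p).

Let H i : pt -> R := kelvin (2 * g - n%:R - 4 * i%:R) (P i).

Let mi i : R := 1 + 2 * (2 * i%:R - g).

Let smooth_P i : smooth_on punctured (P i).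
Proof.
apply: smooth_sumr => [|l]; first exact: open_punctured.
apply: smooth_scale; first exact: open_punctured.
apply: smooth_heightX; first exact: open_punctured.
exact: smooth_iter_laplbar.
Qed.

Let jet_P i l x : x <> 0 -> (l <= N - i)%N ->
  jet l (P i) x = q (i + l)%N i * iter l laplbar (phi i) x.
Proof.
move=> x0 lN.
rewrite (@jet_sum punctured l _ _ (fun l : 'I_(N - i).+1 => q (i + l)%N i)
  (fun l : 'I_(N - i).+1 => fun p => p.2 ^+ (2 * l) * lift (iter l laplbar (phi i)) p)) //.
- rewrite (bigD1 (Ordinal (lN : (l < (N - i).+1)%N)))//= jet_lift//; last exact: smooth_iter_laplbar.
  rewrite eqxx mul1r big1 ?addr0// => k kl; rewrite jet_lift//; last exact: smooth_iter_laplbar.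
  by rewrite -val_eqE /= eq_sym in kl; rewrite (negbTE kl) mul0r mulr0.
- exact: bdry_nbhd_punctured.
- move=> k; apply: smooth_heightX; first exact: open_punctured.
  exact: smooth_iter_laplbar.
Qed.

Let qrec' i l : 2 * l.+1%:R * ((2 * l).+1%:R + mi i) * q (i + l).+1 i = - q (i + l)%N i.
Proof.
rewrite -qrec ?leq_addr//; congr (_ * _); rewrite /mi -!(natr1, natrD) natrM.
by ring.
Qed.

Let van_Sop_P i l : (l < N - i)%N -> van (dy (2 * l).+1 (Sop (mi i) (P i))).
Proof.
move=> lN x x0.
rewrite (dy_Sop_jet _ _ (@bdry_nbhd_punctured _ _) (smooth_P i) x0).
rewrite (jet_P x0 lN) addnS.
rewrite (@eqon_laplbar _ _ _ (fun x => q (i + l)%N i * iter l laplbar (phi i) x))//.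
  rewrite laplbarZ//; last exact: smooth_iter_laplbar.
  rewrite [2 * _ * _ * _]mulrA qrec' -iterS; ring.
by move=> z z0; rewrite jet_P// ltnW.
Qed.

(** The weight e of [H i] satisfies e + n - 1 + [mi i] = 0, so the correction in [Sop_kelvin] drops
    out and [Sop] commutes with the Kelvin transform; vanishing of odd derivatives then passes to
    [H i] by parity. *)
Let van_Sop_H i l : (l < N - i)%N -> van (dy (2 * l).+1 (Sop (mi i) (H i))).
Proof.
move=> lN x x0; have bP := @bdry_nbhd_punctured R n; have [oP _] := bP.
have [oK bK] := bdry_nbhd_kelvin bP.
have sP := smooth_P i.
have E p : kelvin_dom punctured p ->
    Sop (mi i) (H i) p = kelvin (2 * g - n%:R - 4 * i%:R - 2) (Sop (mi i) (P i)) p.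
  move=> pK; rewrite (Sop_kelvin _ _ oP sP pK).
  set e := 2 * g - _ - _; have -> : e + n%:R - 1 + mi i = 0 by rewrite /e /mi; ring.
  by rewrite /kelvin !(mulr0, mul0r) subr0 !(mulr0, addr0).
rewrite (eqon_dy _ oK E (bK x x0)).
have sS : smooth_on punctured (Sop (mi i) (P i)).
  apply: smooth_add => //; last by apply: smooth_scale => //; exact: smooth_derive.
  by apply: smooth_mul => //; [exact: (@smooth_coord _ _ _ None)|exact: smooth_lapl].
apply: (@van_dy_kelvin R n punctured (2 * l).+1 _ _ bP sS _ x x0) => j jl oj.
have [k kj] : exists k, j = (2 * k).+1.
  exists j./2; have := odd_double_half j.
  by rewrite oj mul2n /= odd_double add1n mul2n.
rewrite kj; apply: van_Sop_P; apply: leq_ltn_trans lN.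
by move: jl; rewrite kj ltnS leq_pmul2l.
Qed.

Let smooth_H i : smooth_on (kelvin_dom punctured) (H i).
Proof. by apply: smooth_kelvin => //; exact: open_punctured. Qed.

Let smooth_psi i : smooth_bdry (psi i).
Proof.
have bP := @bdry_nbhd_punctured R n.
apply: (@smooth_bdry_eq _ _ (fun x => kelvin (2 * g - n%:R - 4 * i%:R) (lift (phi i)) (x, 0))).
  by move=> x _; rewrite kelvin_bdry.
apply: smooth_trace (bdry_nbhd_kelvin bP) _.
exact: (smooth_kelvin _ bP.1 (sphi i)).
Qed.

(** Uniqueness of power series solutions: the jets of [H i] obey the same recursion as those of
    [P i], and its boundary value is [q i i] times the trace [psi i]. *)
Let jet_H i l x : x <> 0 -> (l <= N - i)%N ->
  jet l (H i) x = q (i + l)%N i * iter l laplbar (psi i) x.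
Proof.
have bK := bdry_nbhd_kelvin (@bdry_nbhd_punctured R n).
elim: l x => [|l IH] x x0 lN.
  have P0 := @jet_P i 0 (inv_bdry x) (inv_bdry_neq0 x0) isT.
  rewrite /jet fact0 divr1 -[LHS]/(H i (x, 0)) /H kelvin_bdry.
  move: P0; rewrite /jet fact0 divr1 -[dy _ _ _]/(P i (inv_bdry x, 0)) => ->.
  by rewrite /= mulrCA.
have := van_Sop_H lN x0; rewrite (dy_Sop_jet _ _ bK (smooth_H i) x0).
move/eqP; rewrite mulf_eq0 (negbTE (factR_neq0 _)) /= => /eqP.
rewrite (@eqon_laplbar _ _ _ (fun x => q (i + l)%N i * iter l laplbar (psi i) x))//.
  rewrite laplbarZ//; last exact: smooth_iter_laplbar.
  rewrite -iterS addnS -[q (i + l)%N i]opprK -qrec'.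
  set c := 2 * _ * _ => Hx.
  (* The recursion can be solved for the next coefficient because g is not a natural number. *)
  have c0 : c != 0.
    rewrite /c mulf_neq0//.
    have -> : (2 * l).+1%:R + mi i = 2 * ((l.+1 + 2 * i)%:R - g).
      by rewrite /mi -(natr1 (2 * l)) natrD -(natr1 l) !natrM; ring.
    by rewrite mulf_neq0 ?gN// pnatr_eq0.
  apply: (mulfI c0); apply/eqP; rewrite -subr_eq0; apply/eqP.
  by rewrite -[RHS]Hx; move: (iter _ _ _ _) (jet _ _ _) => *; ring.
by move=> z z0; rewrite IH// ltnW.
Qed.

(** [V] and the sum of the truncated y^(2i) P_i have the same even normal derivatives up to order 2N
    at y = 0. By parity so do their Kelvin transforms, and the transform of the sum is known from
    [jet_H]. *)
Lemma jet_kelvin_trunc W V : bdry_nbhd W -> smooth_on W V ->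
  (forall l x, (l <= N)%N -> x <> 0 -> jet l V x = expansion phi l x) ->
  forall x, x <> 0 -> jet N (kelvin (2 * g - n%:R) V) x = expansion psi N x.
Proof.
move=> bW sV EV x x0; have [oW bW1] := bW.
have bP := @bdry_nbhd_punctured R n; have [oP _] := bP.
pose W' := W `&` punctured.
have bW' : bdry_nbhd W'.
  by split; [exact: openI|move=> z z0; split; [exact: bW1|]].
have [oW' _] := bW'.
have sV' : smooth_on W' V by apply: smooth_sub sV => z [].
have sP' i : smooth_on W' (P i) by apply: smooth_sub (smooth_P i) => z [].
have syP i : smooth_on W' (fun p => p.2 ^+ (2 * i) * P i p) by exact: smooth_heightX.
pose S p := \sum_(i < N.+1) 1 * (p.2 ^+ (2 * i) * P i p).
have sS : smooth_on W' S.
  by apply: smooth_sumr => // i; apply: smooth_scale.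
pose D p := 1 * V p + - 1 * S p.
have sD : smooth_on W' D by apply: smooth_add => //; exact: smooth_scale.
have D0 l : (l <= N)%N -> van (dy (2 * l) D).
  move=> lN z z0; rewrite dy_jet (jet_lin _ _ _ bW' sV' sS z0).
  rewrite (jet_sum _ _ (fun=> 1) bW' (fun i : 'I_N.+1 => syP i) z0).
  rewrite (EV l z lN z0) /expansion.
  have -> : \sum_(i < N.+1) 1 * jet l (fun p => p.2 ^+ (2 * i) * P i p) z =
      \sum_(i < N.+1 | (i < l.+1)%N) q l i * iter (l - i) laplbar (phi i) z.
    rewrite [RHS]big_mkcond; apply: eq_bigr => i _; rewrite mul1r ltnS.
    rewrite (jet_heightX _ _ bW' (sP' i) z0); case: leqP => // il.
    by rewrite jet_P ?subnKC// leq_sub2r.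
  rewrite (big_ord_widen N.+1 (fun i => q l i * iter (l - i) laplbar (phi i) z))//.
  by rewrite mul1r mulN1r subrr mulr0.
have bK := bdry_nbhd_kelvin bW'; have [oK _] := bK.
have sKD : smooth_on (kelvin_dom W') (kelvin (2 * g - n%:R) D) by exact: smooth_kelvin.
have sH' i : smooth_on (kelvin_dom W') (H i).
  by apply: smooth_sub (smooth_H i) => z [z0 [_ ?]].
have syH i : smooth_on (kelvin_dom W') (fun p => p.2 ^+ (2 * i) * H i p).
  exact: smooth_heightX.
pose SH p := \sum_(i < N.+1) 1 * (p.2 ^+ (2 * i) * H i p).
have sSH : smooth_on (kelvin_dom W') SH.
  by apply: smooth_sumr => // i; apply: smooth_scale.
have E p : kelvin_dom W' p -> kelvin (2 * g - n%:R) V p =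
    1 * kelvin (2 * g - n%:R) D p + 1 * SH p.
  move=> [p0 _]; rewrite !mul1r.
  (* As y o Phi = r^-2 y, the factor y^(2i) accounts for the weight 4i that distinguishes [H i]. *)
  have -> : SH p = kelvin (2 * g - n%:R) S p.
    rewrite /kelvin /S mulr_sumr; apply: eq_bigr => i _; rewrite !mul1r.
    rewrite /H /kelvin.
    have -> : (inv_half p).2 = r_half p `^ (- 2) * p.2 by exact: (coord_inv None).
    have -> : r_half p `^ (2 * g - n%:R - 4 * i%:R) =
        r_half p `^ (2 * g - n%:R) * (r_half p `^ (- 2)) ^+ (2 * i).
      rewrite -powR_mulrn ?powR_ge0// -powRrM -r_half_powRD//; congr (_ `^ _).
      by rewrite natrM; ring.
    by rewrite exprMn; move: (P _ _) => *; ring.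
  by rewrite /kelvin /D; move: (S _) (V _) => *; ring.
rewrite (eqon_jet _ bK E x0) (jet_lin _ _ _ bK sKD sSH x0).
have -> : jet N (kelvin (2 * g - n%:R) D) x = 0.
  rewrite /jet; suff -> : dy (2 * N) (kelvin (2 * g - n%:R) D) (x, 0) = 0.
    by rewrite mul0r.
  apply: (@van_dy_kelvin R n W' (2 * N) _ _ bW' sD _ x x0) => j jN oj.
  have [k kj] : exists k, j = (2 * k)%N.
    exists j./2; have := odd_double_half j.
    by rewrite oj mul2n odd_double add0n mul2n.
  by rewrite kj; apply: D0; move: jN; rewrite kj leq_pmul2l.
rewrite mulr0 add0r mul1r (jet_sum _ _ (fun=> 1) bK (fun i : 'I_N.+1 => syH i) x0).
rewrite /expansion; apply: eq_bigr => -[i /= iN] _; rewrite mul1r.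
rewrite (jet_heightX _ _ bK (sH' i) x0) -ltnS iN.
by rewrite jet_H// subnKC.
Qed.

End Truncation.

Lemma jet_kelvin W V : bdry_nbhd W -> smooth_on W V ->
  (forall l x, x <> 0 -> jet l V x = expansion phi l x) ->
  forall l x, x <> 0 -> jet l (kelvin (2 * g - n%:R) V) x = expansion psi l x.
Proof.
by move=> bW sV EV l x x0; apply: (jet_kelvin_trunc bW sV) => // k z _; exact: EV.
Qed.

End KelvinCoefficients.

(** * Boundary limits *)

Section NormalExpansion.
Context {R : realType} {n : nat}.
Local Notation pt := ('rV[R]_n * R)%type.
Implicit Types (U V Z : pt -> R) (a b c M : R).

Lemma cvg_normal (x : 'rV[R]_n) : (x, y) @[y --> (0 : R)] --> ((x, 0) : pt).
Proof.
exact: (@cvg_pair _ _ _ (nbhs (0 : R)) (nbhs x) (nbhs (0 : R)) _ _ _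
  (fun=> x) id (cvg_cst _) cvg_id).
Qed.

Variables (W : set pt) (x : 'rV[R]_n).
Hypotheses (bW : bdry_nbhd W) (x0 : x <> 0).

Let oW : open W := bW.1.

Definition above : set pt := W `&` upper.

Lemma open_above : open above.
Proof. by apply: openI => //; exact: open_upper. Qed.

Lemma near_above : \forall y \near 0^'+, above (x, y).
Proof.
have W0 : nbhs ((x, 0) : pt) W by apply: (open_nbhs_nbhs (conj oW (bW.2 x x0))).
have /cvg_at_right_filter cy' := @cvg_normal x.
near=> y; split; first by near: y; exact: (cy' _ W0).
by rewrite /upper /=; near: y; exact: nbhs_right_gt.
Unshelve. all: by end_near. Qed.

Let near_below1 : \forall y \near (0 : R)^'+, 0 < y <= 1.
Proof.
near=> y; apply/andP; split; first by near: y; exact: nbhs_right_gt.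
by near: y; exact: nbhs_right_le.
Unshelve. all: by end_near. Qed.

Let powR_le_small y a b : 0 < y <= 1 -> a <= b -> y `^ b <= y `^ a :> R.
Proof.
move=> /andP[y0 y1] ab; rewrite -(subrK a b) powRD; last first.
  by apply/implyP => _; rewrite gt_eqF.
rewrite -[leRHS]mul1r ler_wpM2r ?powR_ge0//.
have -> : 1 = 1 `^ (b - a) :> R by rewrite powR1.
by apply: ge0_ler_powR; rewrite ?nnegrE ?subr_ge0 ?ler01// ltW.
Qed.

(** Bounding all derivatives makes the class stable under D_y, multiplication by y^b and T, which
    change the order M to M - 1, M + b and M - 2. The order is real because b = 2s occurs. *)
Definition flat M Z := forall k, exists c, \forall y \near (0 : R)^'+,
  `|dy k Z (x, y)| <= c * y `^ (M - k%:R).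

Lemma eqon_flat M Z Z' : (forall p, above p -> Z p = Z' p) -> flat M Z -> flat M Z'.
Proof.
move=> E fZ k; have [c Hc] := fZ k; exists c.
apply: filterS (filterI Hc near_above) => y [H yW].
by rewrite -(eqon_dy k open_above E yW).
Qed.

Lemma flatW M M' Z : M' <= M -> flat M Z -> flat M' Z.
Proof.
move=> MM fZ k; have [c Hc] := fZ k; exists `|c|.
apply: filterS (filterI Hc near_below1) => y [H y1].
apply: (le_trans H); rewrite (le_trans (ler_wpM2r (powR_ge0 _ _) (ler_norm c)))//.
by rewrite ler_wpM2l// powR_le_small// lerB.
Qed.

Lemma flat_derive M Z : flat M Z -> flat (M - 1) ('D_e_y Z).
Proof.
move=> fZ k; have [c Hc] := fZ k.+1; exists c.
apply: filterS Hc => y; rewrite dySr -(natr1 k).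
by rewrite (_ : M - (k%:R + 1) = M - 1 - k%:R)//; ring.
Qed.

Lemma flat_lin M a b U V : smooth_on above U -> smooth_on above V ->
  flat M U -> flat M V -> flat M (fun p => a * U p + b * V p).
Proof.
move=> sU sV fU fV k; have [c Hc] := fU k; have [d Hd] := fV k.
exists (`|a| * c + `|b| * d).
apply: filterS (filterI (filterI Hc Hd) near_above) => y [[Hy Hy'] yW].
rewrite (dy_lin _ _ _ open_above sU sV yW) (le_trans (ler_normD _ _))//.
by rewrite !normrM mulrDl -!mulrA lerD// ler_wpM2l.
Qed.

Lemma smooth_above_powR b : smooth_on above (fun p : pt => p.2 `^ b).
Proof. by apply: smooth_sub (smooth_height_powR b) => p []. Qed.

(** One derivative gives b y^(b - 1) Z + y^b D_y Z, with both terms flat of order M + b - 1; this is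
    why the induction varies M and b. *)
Lemma flat_powR M b Z : smooth_on above Z -> flat M Z ->
  flat (M + b) (fun p => p.2 `^ b * Z p).
Proof.
move=> sZ fZ k; elim: k => [|k IH] in M b Z sZ fZ *.
  have [c Hc] := fZ 0%N; exists c.
  apply: filterS (filterI Hc near_below1) => y [H /andP[y0 _]].
  rewrite !subr0 in H *; rewrite -[dy 0 _ _]/(y `^ b * Z (x, y)).
  rewrite normrM (ger0_norm (powR_ge0 _ _)) powRD; last first.
    by apply/implyP => _; rewrite gt_eqF.
  by rewrite [_ `^ M * _]mulrC mulrCA ler_wpM2l// powR_ge0.
have sD := smooth_derive e_y sZ.
have oA := open_above.
have [c Hc] := IH M (b - 1) Z sZ fZ.
have [d Hd] := IH (M - 1) b ('D_e_y Z) sD (flat_derive fZ).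
exists (`|b| * c + `|1 : R| * d).
apply: filterS (filterI (filterI Hc Hd) near_above) => y [[Hy Hy'] yA].
rewrite dySr (eqon_dy (V := fun p => b * (p.2 `^ (b - 1) * Z p) +
   1 * (p.2 `^ b * 'D_e_y Z p)) k oA _ yA); last first.
  move=> p [Wp p2]; have [dp Dp] := derive_height_powR b e_y p2.
  rewrite deriveMp//; last by apply: smooth_diff (conj Wp p2 : above p).
  by rewrite Dp /=; ring.
rewrite (dy_lin _ _ _ oA _ _ yA); last 2 first.
- by apply: smooth_mul => //; exact: smooth_above_powR.
- by apply: smooth_mul => //; exact: smooth_above_powR.
rewrite (le_trans (ler_normD _ _))// !normrM mulrDl -!mulrA lerD// ler_wpM2l//.
- apply: (le_trans Hy); rewrite -(natr1 k).
  by rewrite (_ : M + (b - 1) - k%:R = M + b - (k%:R + 1))//; ring.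
- apply: (le_trans Hy'); rewrite -(natr1 k).
  by rewrite (_ : M - 1 + b - k%:R = M + b - (k%:R + 1))//; ring.
Qed.

Lemma flat_cvg0 M Z : 0 < M -> flat M Z -> Z (x, y) @[y --> (0 : R)^'+] --> (0 : R).
Proof.
move=> M0 fZ; have [c Hc] := fZ 0%N; rewrite subr0 in Hc.
apply: norm_cvg0; apply: (@squeeze_cvgr _ _ _ _ (cst 0) (fun y => c * y `^ M)).
- by apply: filterS Hc => y H; rewrite normr_ge0.
- exact: cvg_cst.
- rewrite -[X in _ --> X](mulr0 c); apply: cvgM; first exact: cvg_cst.
  exact: powR_cvg0.
Qed.

Variable m : R.
Local Notation T := (Top m).

Lemma TopE Z p : above p -> T Z p =
  1 * 'D_e_y ('D_e_y Z) p + m * (p.2 `^ (- 1) * 'D_e_y Z p).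
Proof.
by move=> [_ p2]; rewrite /Top powR_inv1 ?ltW// mul1r mulrA.
Qed.

Lemma smooth_Top Z : smooth_on above Z -> smooth_on above (T Z).
Proof.
move=> sZ; have oA := open_above; have sD := smooth_derive e_y sZ.
apply: (smooth_eqon oA (fun p pA => esym (TopE Z pA))).
apply: smooth_add => //; apply: smooth_scale => //; first exact: smooth_derive.
by apply: smooth_mul => //; exact: smooth_above_powR.
Qed.

Lemma smooth_iter_Top k Z : smooth_on above Z -> smooth_on above (iter k T Z).
Proof. by move=> sZ; elim: k => //= k; exact: smooth_Top. Qed.

Lemma eqon_Top U V p : (forall q, above q -> U q = V q) -> above p -> T U p = T V p.
Proof.
move=> UV pA; have E q : above q -> 'D_e_y U q = 'D_e_y V q.
  exact: eqon_derive open_above UV.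
by rewrite /Top (E p pA) (eqon_derive e_y open_above E pA).
Qed.

Lemma eqon_iter_Top k U V p : (forall q, above q -> U q = V q) -> above p ->
  iter k T U p = iter k T V p.
Proof.
by move=> UV; elim: k p => [|k IH] p pA /=; [exact: UV|exact: eqon_Top].
Qed.

Lemma Top_lin a b U V p : smooth_on above U -> smooth_on above V -> above p ->
  T (fun q => a * U q + b * V q) p = a * T U p + b * T V p.
Proof.
move=> sU sV pA; have oA := open_above.
have D1 : 'D_e_y (fun q => a * U q + b * V q) p = a * 'D_e_y U p + b * 'D_e_y V p.
  exact: (dy_lin 1 a b oA sU sV pA).
have D2 : 'D_e_y ('D_e_y (fun q => a * U q + b * V q)) p =
    a * 'D_e_y ('D_e_y U) p + b * 'D_e_y ('D_e_y V) p.
  exact: (dy_lin 2 a b oA sU sV pA).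
rewrite /Top D1 D2; move: ('D_e_y ('D_e_y U) p) ('D_e_y ('D_e_y V) p).
by move: ('D_e_y U p) ('D_e_y V p) => *; ring.
Qed.

Lemma iter_Top_lin k a b U V p : smooth_on above U -> smooth_on above V -> above p ->
  iter k T (fun q => a * U q + b * V q) p = a * iter k T U p + b * iter k T V p.
Proof.
move=> sU sV; elim: k p => [//|k IH] p pA.
by rewrite iterS (eqon_Top IH pA) Top_lin//; exact: smooth_iter_Top.
Qed.

Lemma flat_Top M Z : smooth_on above Z -> flat M Z -> flat (M - 2) (T Z).
Proof.
move=> sZ fZ; have sD := smooth_derive e_y sZ; have oA := open_above.
apply: (eqon_flat (fun p pA => esym (TopE Z pA))).
have fD := flat_derive fZ; have fDD := flat_derive fD.
have M2 : M - 1 - 1 = M - 2 by ring.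
rewrite -M2; apply: flat_lin => //.
- exact: smooth_derive.
- by apply: smooth_mul => //; exact: smooth_above_powR.
- exact: flat_powR.
Qed.

Lemma flat_iter_Top k M Z : smooth_on above Z -> flat M Z ->
  flat (M - 2 * k%:R) (iter k T Z).
Proof.
move=> sZ fZ; elim: k => [|k IH]; first by rewrite mulr0 subr0.
rewrite iterS -(natr1 k) (_ : M - 2 * (k%:R + 1) = M - 2 * k%:R - 2); last by ring.
by apply: flat_Top => //; exact: smooth_iter_Top.
Qed.

Lemma derive_above_powR b p : above p ->
  'D_e_y (fun q : pt => q.2 `^ b) p = b * p.2 `^ (b - 1).
Proof.
by move=> [_ p2]; have [_ ->] := derive_height_powR b e_y p2; rewrite mulr1.
Qed.

Lemma Top_powR b p : above p ->
  T (fun q => q.2 `^ b) p = b * (b - 1 + m) * p.2 `^ (b - 2).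
Proof.
move=> pA; have [_ p2] := pA; have oA := open_above.
rewrite TopE// (eqon_derive e_y oA (@derive_above_powR b) pA).
have [dp _] := derive_height_powR (b - 1) e_y p2.
rewrite deriveZp// !derive_above_powR// (_ : b - 1 - 1 = b - 2); last by ring.
have -> : p.2 `^ (- 1) * (b * p.2 `^ (b - 1)) = b * p.2 `^ (b - 2).
  rewrite mulrCA -powRD; last by apply/implyP => _; rewrite gt_eqF.
  by congr (_ * _ `^ _); ring.
ring.
Qed.

Lemma iter_Top_powR k b p : above p -> iter k T (fun q => q.2 `^ b) p =
  \prod_(l < k) ((b - 2 * l%:R) * (b - 2 * l%:R - 1 + m)) * p.2 `^ (b - 2 * k%:R).
Proof.
elim: k p => [|k IH] p pA; first by rewrite big_ord0 mul1r mulr0 subr0.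
have oA := open_above; set c := \prod_(l < k) _ in IH.
rewrite iterS (eqon_Top (V := fun q => c * q.2 `^ (b - 2 * k%:R) +
   0 * q.2 `^ (b - 2 * k%:R)) _ pA); last by move=> q qA; rewrite IH// mul0r addr0.
have sp := smooth_above_powR (b - 2 * k%:R).
rewrite Top_lin// mul0r addr0 Top_powR// big_ord_recr /= -/c mulrA.
by congr (_ * _ `^ _); rewrite -(natr1 k); ring.
Qed.

End NormalExpansion.

(** * Limits of the iterated normal operators *)

Section NormalLimits.
Context {R : realType} {n : nat}.
Local Notation pt := ('rV[R]_n * R)%type.
Implicit Types (U V Z : pt -> R) (a b c M : R).

Variables (W : set pt) (x : 'rV[R]_n).
Hypotheses (bW : bdry_nbhd W) (x0 : x <> 0).

Let oW : open W := bW.1.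
Local Notation above := (@above R n W).
Local Notation flat := (@flat R n x).

Let normal_line (t : R) : t *: (e_y : pt) + (x, 0) = (x, t).
Proof.
congr (_, _).
  by transitivity (t *: (0 : 'rV[R]_n) + x); [|rewrite scaler0 add0r].
by transitivity (t * 1 + 0); [|rewrite mulr1 addr0].
Qed.

(** Taylor's estimate by induction: on the normal segment over x, the mean value theorem turns a
    bound c y^M for D_y Z into |c| y^(M + 1) for Z. *)
Lemma vanishing_bound (M : nat) Z : smooth_on W Z ->
  (forall i, (i < M)%N -> dy i Z (x, 0) = 0) ->
  exists c : R, \forall y \near (0 : R)^'+, `|Z (x, y)| <= c * y ^+ M.
Proof.
elim: M Z => [|M IH] Z sZ Z0.
  exists (`|Z (x, 0)| + 1).
  have cZ : Z (x, y) @[y --> (0 : R)^'+] --> Z (x, 0).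
    apply: cvg_at_right_filter; apply: (@cvg_comp _ _ _ (fun y : R => (x, y)) Z).
      exact: cvg_normal.
    exact: (differentiable_continuous (smooth_diff sZ (bW.2 x x0))).
  move/cvgrPdist_lt: cZ => /(_ 1 ltr01); apply: filterS => y Hy.
  rewrite expr0 mulr1 -[Z (x, y)](subrK (Z (x, 0))) addrC.
  by rewrite (le_trans (ler_normD _ _))// lerD// distrC ltW.
have sD := smooth_derive e_y sZ.
have [c Hc] : exists c : R, \forall y \near (0 : R)^'+, `|'D_e_y Z (x, y)| <= c * y ^+ M.
  by apply: (IH _ sD) => i iM; rewrite -dySr Z0.
exists `|c|.
have W0 : nbhs ((x, 0) : pt) W by apply: (open_nbhs_nbhs (conj oW (bW.2 x x0))).
have /nbhs_ballP[d1 /= d10 Hd1] := @cvg_normal _ _ x _ W0.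
have /nbhs_ballP[d2 /= d20 Hd2] := Hc.
near=> y.
have y0 : 0 < y by [].
have yd1 : y < d1 by near: y; exact: nbhs_right_lt.
have yd2 : y < d2 by near: y; exact: nbhs_right_lt.
pose phi t := Z (t *: e_y + (x, 0)).
have dphi t : 0 <= t <= y -> is_derive t 1 phi ('D_e_y Z (x, t)).
  move=> /andP[t0 ty]; rewrite -(normal_line t); apply: is_derive_line.
  rewrite normal_line; apply: smooth_diff sZ _; apply: Hd1.
  by rewrite -ball_normE /= sub0r normrN ger0_norm// (le_lt_trans ty).
have [t ty E] : exists2 t, t \in `]0, y[%R & phi y - phi 0 = 'D_e_y Z (x, t) * (y - 0).
  apply: (@MVT _ phi (fun t => 'D_e_y Z (x, t))) => //.
    by move=> t; rewrite in_itv /= => /andP[t0 ty]; apply: dphi; rewrite !ltW.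
  apply: derivable_within_continuous => t; rewrite in_itv/= => ty.
  exact: (@ex_derive _ _ _ _ _ _ _ (dphi t ty)).
move: ty; rewrite in_itv /= => /andP[t0 ty].
have -> : Z (x, y) = phi y - phi 0.
  by rewrite /phi !normal_line -[Z (x, 0)]/(dy 0 Z (x, 0)) Z0// subr0.
rewrite E subr0 normrM (gtr0_norm y0) exprSr mulrA ler_pM2r//.
have /= H := Hd2 t; apply: (le_trans (H _ t0)).
  by rewrite -ball_normE /= sub0r normrN gtr0_norm// (lt_trans ty).
apply: (le_trans (ler_wpM2r (exprn_ge0 _ (ltW t0)) (ler_norm c))).
by rewrite ler_wpM2l// lerXn2r// ?nnegrE ltW.
Unshelve. all: by end_near. Qed.

Lemma vanishing_flat (M : nat) Z : smooth_on W Z ->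
  (forall i, (i < M)%N -> dy i Z (x, 0) = 0) -> flat M%:R Z.
Proof.
move=> sZ Z0 k.
have [c Hc] : exists c : R, \forall y \near (0 : R)^'+,
    `|dy k Z (x, y)| <= c * y ^+ (M - k).
  apply: vanishing_bound; first exact: smooth_dy.
  by move=> i; rewrite /dy -iterD ltn_subRL addnC => /Z0.
exists `|c|; near=> y.
have y0 : 0 < y by [].
have y1 : y <= 1 by near: y; exact: nbhs_right_le.
have H : `|dy k Z (x, y)| <= c * y ^+ (M - k) by near: y.
apply: (le_trans H); rewrite (le_trans (ler_wpM2r (exprn_ge0 _ (ltW y0)) (ler_norm c)))//.
rewrite ler_wpM2l// -powR_mulrn ?(ltW y0)//.
(* For k > M the natural exponent is truncated to 0, and a bounded quantity is compared with a power
   that is at least 1 for y <= 1. *)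
have Mk : M%:R - k%:R <= (M - k)%:R :> R.
  have [kM|/ltnW Mk] := leqP k M; first by rewrite natrB.
  by rewrite (eqP Mk) subr_le0 ler_nat.
set b := M%:R - k%:R; rewrite -/b in Mk.
rewrite -(subrK b (M - k)%:R) powRD; last first.
  by apply/implyP => _; rewrite gt_eqF.
rewrite -[leRHS]mul1r ler_wpM2r ?powR_ge0//.
have : y `^ ((M - k)%:R - b) <= 1 `^ ((M - k)%:R - b).
  by apply: ge0_ler_powR; rewrite ?nnegrE ?subr_ge0 ?ler01// ltW.
by rewrite powR1.
Unshelve. all: by end_near. Qed.

Variables (s : R) (U VF VG : pt -> R).
Hypotheses (s01 : 0 < s < 1) (sF : smooth_on W VF) (sG : smooth_on W VG).
Hypothesis oddF : forall i, odd i -> dy i VF (x, 0) = 0.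
Hypothesis oddG : forall i, odd i -> dy i VG (x, 0) = 0.
Hypothesis UE : forall p, above p -> U p = VF p + p.2 `^ (2 * s) * VG p.

Local Notation T := (Top (1 - 2 * s)).

(** For m = 1 - 2s one has T y^b = b (b - 2s) y^(b - 2), so T^j y^(2j) is [normal_const s j] and T^j
    y^(2s + 2j) is [normal_const (- s) j] times y^(2s). *)
Definition normal_const (t : R) j : R := \prod_(l < j) (4 * l.+1%:R * (l.+1%:R - t)).

(** T involves no tangential derivative, so only the normal line over [x] matters and the Taylor
    coefficients can be frozen at [x]. *)
Let remainder j V p : R := 1 * V p +
  - 1 * \sum_(i < j.+1) jet i V x * (p.2 ^+ (2 * i) * lift (fun=> 1) p).

Let smooth_monomial W' i : open W' ->
  smooth_on W' (fun p : pt => p.2 ^+ i * lift (fun=> 1) p).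
Proof. by move=> oW'; apply: smooth_heightX => //; exact: smooth_cst. Qed.

Let smooth_remainder j V : smooth_on W V -> smooth_on W (remainder j V).
Proof.
move=> sV; apply: smooth_add => //; apply: smooth_scale => //.
by apply: smooth_sumr => // i; apply: smooth_scale => //; exact: smooth_monomial.
Qed.

(** Odd derivatives vanish by hypothesis, so removing the even Taylor terms up to degree 2j gains
    the full order 2j + 2. *)
Let flat_remainder j V : smooth_on W V -> (forall i, odd i -> dy i V (x, 0) = 0) ->
  flat (2 * j.+1)%:R (remainder j V).
Proof.
move=> sV oddV; apply: vanishing_flat; first exact: smooth_remainder.
move=> i ij; have Wx := bW.2 x x0.
have smon k : smooth_on W (fun p : pt => p.2 ^+ k * lift (fun=> 1) p).
  exact: smooth_monomial.
have scmon (k : 'I_j.+1) : smooth_on W (fun p : pt => jet k V x *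
    (p.2 ^+ (2 * k) * lift (fun=> 1) p)).
  exact: smooth_scale.
have ssum : smooth_on W (fun p : pt => \sum_(k < j.+1) jet k V x *
    (p.2 ^+ (2 * k) * lift (fun=> 1) p)).
  exact: smooth_sumr.
have [oi|ei] := boolP (odd i).
  rewrite (dy_lin _ _ _ oW sV ssum Wx) oddV// (dy_sum _ _ oW scmon Wx).
  rewrite big1 ?mulr0 ?addr0// => k _.
  rewrite (eqon_dy (V := fun p => jet k V x * (p.2 ^+ (2 * k) * lift (fun=> 1) p) +
    0 * (p.2 ^+ (2 * k) * lift (fun=> 1) p)) i oW _ Wx); last first.
    by move=> p _; rewrite mul0r addr0.
  rewrite (dy_lin _ _ _ oW (smon _) (smon _) Wx) mul0r addr0.
  have sl : smooth_on W (lift (fun=> 1)) by exact: smooth_cst.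
  rewrite (dy_heightX _ _ bW sl x0).
  have [/ffact_small ->|ki] := ltnP i (2 * k); first by rewrite mul0r mulr0.
  have : (0 < i - 2 * k)%N.
    rewrite subn_gt0 ltn_neqAle ki andbT; apply/eqP => ik.
    by move: oi; rewrite -ik mul2n odd_double.
  by case: (_ - _)%N => // l _; rewrite dy_lift !mulr0.
have i2 : i = (2 * i./2)%N.
  by have := odd_double_half i; rewrite (negbTE ei) add0n mul2n.
rewrite i2 dy_jet (jet_lin _ _ _ bW sV ssum x0).
rewrite (jet_sum _ _ (fun k : 'I_j.+1 => jet k V x) bW (fun k : 'I_j.+1 => smon (2 * k)%N) x0).
have ij' : (i./2 < j.+1)%N by move: ij; rewrite {1}i2 ltn_pmul2l.
rewrite (bigD1 (Ordinal ij')) //= big1 ?addr0 => [|k ki]; last first.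
  rewrite jet_lift//; last exact: smooth_cst.
  by rewrite -val_eqE /= eq_sym in ki; rewrite (negbTE ki) mul0r mulr0.
rewrite jet_lift//; last exact: smooth_cst.
by rewrite eqxx !mulr1 mul1r mulN1r subrr mulr0.
Qed.

(** For i < j the factor l = i vanishes: j applications of T kill the lower monomials. The case t =
    s serves the powers y^(2i), the case t = - s the powers y^(2s + 2i). *)
Let prod_zero (t : R) i j : (i <= j)%N ->
  \prod_(l < j) ((2 * i%:R - 2 * l%:R) * (2 * i%:R - 2 * l%:R - 2 * t)) =
  (i == j)%:R * normal_const t j.
Proof.
rewrite leq_eqVlt => /predU1P[->|ij].
  rewrite eqxx mul1r /normal_const (reindex_inj rev_ord_inj).
  apply: eq_bigr => l _ /=; rewrite natrB//; ring.
by rewrite (bigD1 (Ordinal ij))//= subrr !mul0r (ltn_eqF ij) mul0r.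
Qed.

Let rho j p : R := 1 * remainder j VF p + 1 * (p.2 `^ (2 * s) * remainder j VG p).

Let sab V : smooth_on W V -> smooth_on above V.
Proof. by apply: smooth_sub => p []. Qed.

Let smooth_rho j : smooth_on above (rho j).
Proof.
have oA := open_above bW.
apply: smooth_add => //; apply: smooth_scale => //.
  by apply: sab; exact: smooth_remainder.
apply: smooth_mul => //; first exact: smooth_above_powR.
by apply: sab; exact: smooth_remainder.
Qed.

Let flat_rho j : flat (2 * j.+1)%:R (rho j).
Proof.
have oA := open_above bW; have [s0 _] := andP s01.
apply: (flat_lin bW x0).
- by apply: sab; exact: smooth_remainder.
- apply: smooth_mul => //; first exact: smooth_above_powR.
  by apply: sab; exact: smooth_remainder.
- exact: flat_remainder.
- apply: (@flatW _ _ _ ((2 * j.+1)%:R + 2 * s)); first by rewrite lerDl mulr_ge0 ?ltW.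
  apply: (flat_powR bW x0); last exact: flat_remainder.
  by apply: sab; exact: smooth_remainder.
Qed.

Let iter_Top_sum k (N : nat) (c : 'I_N -> R) (b : 'I_N -> R) p : above p ->
  iter k T (fun q : pt => \sum_(i < N) c i * q.2 `^ b i) p =
  \sum_(i < N) c i * iter k T (fun q : pt => q.2 `^ b i) p.
Proof.
move=> pA; have oA := open_above bW; elim: (index_enum _) => [|i r IH].
  rewrite big_nil (eqon_iter_Top bW _ k (V := fun q : pt => 0 * q.2 `^ 0 + 0 * q.2 `^ 0) _ pA).
    by rewrite (iter_Top_lin bW)//; [rewrite !mul0r addr0|exact: smooth_above_powR..].
  by move=> q _; rewrite big_nil !mul0r addr0.
rewrite big_cons -IH (eqon_iter_Top bW _ k (V := fun q : pt => c i * q.2 `^ b i +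
  1 * \sum_(i <- r) c i * q.2 `^ b i) _ pA).
  rewrite (iter_Top_lin bW)// ?mul1r//; first exact: smooth_above_powR.
  by apply: smooth_sumr => // l; apply: smooth_scale => //; exact: smooth_above_powR.
by move=> q _; rewrite big_cons mul1r.
Qed.

Lemma iter_Top_expansion j p : above p -> iter j T U p =
  jet j VF x * normal_const s j + jet j VG x * normal_const (- s) j * p.2 `^ (2 * s)
  + iter j T (rho j) p.
Proof.
move=> pA; have oA := open_above bW.
pose SF (q : pt) := \sum_(i < j.+1) jet i VF x * q.2 `^ (2 * i%:R).
pose SG (q : pt) := \sum_(i < j.+1) jet i VG x * q.2 `^ (2 * s + 2 * i%:R).
have sS (c b : 'I_j.+1 -> R) :
    smooth_on above (fun q : pt => \sum_(i < j.+1) c i * q.2 `^ b i).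
  by apply: smooth_sumr => // i; apply: smooth_scale => //; exact: smooth_above_powR.
have sSFG : smooth_on above (fun q => 1 * SF q + 1 * SG q).
  by apply: smooth_add => //; apply: smooth_scale => //; exact: sS.
rewrite (eqon_iter_Top bW _ j (V := fun q => 1 * (1 * SF q + 1 * SG q) + 1 * rho j q) _ pA).
  2: {
    move=> q qA; have [_ q2] := qA; have q0 : 0 <= q.2 by exact: ltW.
    rewrite UE// /rho /remainder.
    have -> : SF q = \sum_(i < j.+1) jet i VF x * (q.2 ^+ (2 * i) * lift (fun=> 1) q).
      by apply: eq_bigr => i _; rewrite /lift mulr1 -powR_mulrn// natrM.
    have -> : SG q = q.2 `^ (2 * s) *
        \sum_(i < j.+1) jet i VG x * (q.2 ^+ (2 * i) * lift (fun=> 1) q).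
      rewrite mulr_sumr; apply: eq_bigr => i _; rewrite /lift mulr1 -powR_mulrn// natrM.
      by rewrite powRD 1?mulrCA//; apply/implyP => _; rewrite gt_eqF.
    by move: (\sum_(_ < _) _) (\sum_(_ < _) _) (VF _) (VG _) => *; ring.
  }
rewrite (iter_Top_lin bW _ _ _ _ sSFG (smooth_rho j) pA) !mul1r; congr (_ + _).
rewrite (iter_Top_lin bW _ _ _ _ (sS _ _) (sS _ _) pA) !mul1r.
have sum1 (c : 'I_j.+1 -> R) (d e : R) (F : 'I_j.+1 -> R) :
    (forall i : 'I_j.+1, F i = (i == j :> nat)%:R * d * e) ->
    \sum_(i < j.+1) c i * F i = c ord_max * d * e.
  move=> HF; rewrite (bigD1 ord_max) //= big1 ?addr0 => [|i ij].
    by rewrite HF eqxx mul1r mulrA.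
  by rewrite -val_eqE /= in ij; rewrite HF (negbTE ij) !mul0r mulr0.
rewrite /SF /SG !iter_Top_sum//; congr (_ + _).
  rewrite -[RHS]mulr1; apply: (sum1 (fun i : 'I_j.+1 => jet i VF x)) => i.
  have ij : (i <= j)%N by rewrite -ltnS.
  have E : \prod_(l < j) ((2 * i%:R - 2 * l%:R) *
      (2 * i%:R - 2 * l%:R - 1 + (1 - 2 * s))) = (i == j :> nat)%:R * normal_const s j.
    by rewrite -(prod_zero s ij); apply: eq_bigr => l _; congr (_ * _); ring.
  rewrite (iter_Top_powR bW _ j _ pA) E.
  by have [->|_] := eqVneq (i : nat) j; rewrite ?mul0r// subrr powRr0.
apply: (sum1 (fun i : 'I_j.+1 => jet i VG x)) => i.
have ij : (i <= j)%N by rewrite -ltnS.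
have E : \prod_(l < j) ((2 * s + 2 * i%:R - 2 * l%:R) *
    (2 * s + 2 * i%:R - 2 * l%:R - 1 + (1 - 2 * s))) =
    (i == j :> nat)%:R * normal_const (- s) j.
  by rewrite -(prod_zero (- s) ij); apply: eq_bigr => l _; ring.
rewrite (iter_Top_powR bW _ j _ pA) E.
by have [->|_] := eqVneq (i : nat) j; rewrite ?mul0r// addrK.
Qed.

(** In T^j U the remainder is flat of order 2 and y^(2s) tends to 0, so only the constant term is
    left. *)
Lemma restr0_even j : restr0 (iter j T U) x = normal_const s j * jet j VF x.
Proof.
have [s0 s1] := andP s01.
apply: cvg_lim => //.
pose f (y : R) := jet j VF x * normal_const s j +
  jet j VG x * normal_const (- s) j * y `^ (2 * s) + iter j T (rho j) (x, y).
apply: (@cvg_trans _ (f y @[y --> (0 : R)^'+])).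
  apply: near_eq_cvg; apply: filterS (near_above bW x0) => y yA.
  by rewrite iter_Top_expansion.
have -> : normal_const s j * jet j VF x = jet j VF x * normal_const s j +
  jet j VG x * normal_const (- s) j * 0 + 0 by ring.
apply: cvgD; last first.
  apply: (@flat_cvg0 _ _ x ((2 * j.+1)%:R - 2 * j%:R)).
    by rewrite -natrM -natrB ?leq_mul2l ?leqnSn// ltr0n subn_gt0 ltn_pmul2l.
  by apply: (flat_iter_Top bW x0) => //; exact: flat_rho.
apply: cvgD; first exact: cvg_cst.
by apply: cvgM; [exact: cvg_cst|apply: powR_cvg0; rewrite mulr_gt0].
Qed.

(** The operator y^(1 - 2s) D_y kills the constant term, turns y^(2s) into 2s, and gives the
    remainder the order 2 (1 - s), positive because s < 1. *)
Lemma restr0_odd j :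
  restr0 (fun p => p.2 `^ (1 - 2 * s) * 'D_e_y (iter j T U) p) x =
  2 * s * normal_const (- s) j * jet j VG x.
Proof.
have [s0 s1] := andP s01; have oA := open_above bW.
have srho := smooth_iter_Top bW (1 - 2 * s) j (smooth_rho j).
apply: cvg_lim => //.
pose f (y : R) := 2 * s * normal_const (- s) j * jet j VG x +
  y `^ (1 - 2 * s) * 'D_e_y (iter j T (rho j)) (x, y).
apply: (@cvg_trans _ (f y @[y --> (0 : R)^'+])).
  apply: near_eq_cvg; apply: filterS (near_above bW x0) => y yA.
  rewrite (eqon_derive e_y oA (fun q qA => iter_Top_expansion j qA) yA) /f /=.
  have [_ y0] := yA; rewrite /upper /= in y0.
  have [dp _] := derive_height_powR (2 * s) e_y yA.2.
  have dM : differentiable (fun q : pt => jet j VG x * normal_const (- s) j *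
      q.2 `^ (2 * s)) (x, y).
    by apply: differentiableM => //; exact: differentiable_cst.
  have dC : differentiable (fun q : pt => jet j VF x * normal_const s j) (x, y).
    exact: differentiable_cst.
  rewrite deriveDp; [|exact: differentiableD|exact: smooth_diff yA].
  have D0 : 'D_e_y (fun q : pt => jet j VF x * normal_const s j) (x, y) = 0.
    exact: derive_cst.
  rewrite deriveDp// D0 (deriveZp _ _ dp) (derive_above_powR _ yA) /=.
  rewrite add0r mulrDr; congr (_ + _).
  have -> : 2 * s * normal_const (- s) j * jet j VG x =
     jet j VG x * normal_const (- s) j * (2 * s) * (y `^ (1 - 2 * s) * y `^ (2 * s - 1)).
    rewrite -powRD; last by apply/implyP => _; rewrite gt_eqF.
    by rewrite (_ : _ + _ = 0) ?powRr0; ring.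
  by ring.
rewrite -[2 * s * normal_const (- s) j * jet j VG x]addr0.
apply: cvgD; first exact: cvg_cst.
apply: (@flat_cvg0 _ _ x ((2 * j.+1)%:R - 2 * j%:R - 1 + (1 - 2 * s))
  (fun p => p.2 `^ (1 - 2 * s) * 'D_e_y (iter j T (rho j)) p)).
  rewrite natrM -(natr1 j).
  have -> : 2 * (j%:R + 1) - 2 * j%:R - 1 + (1 - 2 * s) = 2 * (1 - s) by ring.
  by rewrite mulr_gt0// subr_gt0.
apply: (flat_powR bW x0); first exact: smooth_derive.
by apply: flat_derive; apply: (flat_iter_Top bW x0) => //; exact: flat_rho.
Qed.

End NormalLimits.

(** * The Gamma function *)

Section GammaRecurrence.
Context {R : realType}.
Implicit Types (t u a b : R).
Local Notation mu := (@lebesgue_measure R).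

Let f t u : R := u `^ (t - 1) * expR (- u).

(** Euler's integral as an extended real. [Gamma_pos] is its finite part, so the recurrence is
    proved for [I] and transferred by finiteness. *)
Let I t : \bar R := (\int[mu]_(u in `]0%R, +oo[) (f t u)%:E)%E.

Let f_ge0 t u : 0 <= f t u.
Proof. by rewrite mulr_ge0 ?powR_ge0 ?expR_ge0. Qed.

Let measurable_expRN (D : set R) : measurable D ->
  measurable_fun D (fun u : R => expR (- u)).
Proof.
move=> mD; apply: (measurable_funS measurableT) => //.
rewrite -[X in measurable_fun _ X]/(@expR R \o -%R).
by apply: measurableT_comp; [exact: measurable_expR|exact: oppr_measurable].
Qed.

Let measurable_f t (D : set R) : measurable D -> measurable_fun D (EFin \o f t).
Proof.
move=> mD; apply/measurable_EFinP; apply: measurable_funM.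
  by apply: (measurable_funS measurableT) => //; exact: measurable_powR.
exact: measurable_expRN.
Qed.

Let continuous_powR_at b u : 0 < u -> {for u, continuous (fun v => v `^ b)}.
Proof.
move=> u0; apply: differentiable_continuous; apply/derivable1_diffP.
exact: (@ex_derive _ _ _ _ _ _ _ (is_derive1_powR b u0)).
Qed.

Let derivable_expRN u : is_derive u 1 (fun v : R => - expR (- v)) (expR (- u)).
Proof.
by apply: trigger_derive; rewrite mulrN1 opprK.
Qed.

Let continuous_within_itv (h : R -> R) a b :
  (forall u, a <= u <= b -> {for u, continuous h}) -> {within `[a, b], continuous h}.
Proof.
move=> ch; apply: continuous_in_subspaceT => u /set_mem /=.
by rewrite in_itv /=; exact: ch.
Qed.

Let derivable_continuous_at (h : R -> R) u (dh : R) : is_derive u 1 h dh ->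
  {for u, continuous h}.
Proof.
move=> d; apply: differentiable_continuous; apply/derivable1_diffP.
exact: (@ex_derive _ _ _ _ _ _ _ d).
Qed.

Let derivable_LR (h dh : R -> R) a b :
  (forall u, a <= u <= b -> is_derive u 1 h (dh u)) -> a < b ->
  derivable_oo_LRcontinuous h a b /\ {in `]a, b[, derive1 h =1 dh}.
Proof.
move=> d ab; split; first split.
- move=> u; rewrite in_itv /= => /andP[au ub].
  by apply: (@ex_derive _ _ _ _ _ _ _ (d u _)); rewrite !ltW.
- apply: cvg_at_right_filter; apply: derivable_continuous_at (d a _).
  by rewrite lexx ltW.
- apply: cvg_at_left_filter; apply: derivable_continuous_at (d b _).
  by rewrite lexx ltW.
- move=> u; rewrite in_itv /= => /andP[au ub]; rewrite derive1E.
  by apply: (@derive_val _ _ _ _ _ _ _ (d u _)); rewrite !ltW.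
Qed.

Let by_parts t a b : 0 < t -> 0 < a -> a < b ->
  (\int[mu]_(u in `[a, b]) (f (t + 1) u)%:E =
   (a `^ t * expR (- a) - b `^ t * expR (- b))%:E +
    t%:E * \int[mu]_(u in `[a, b]) (f t u)%:E)%E.
Proof.
move=> t0 a0 ab.
have pos u : a <= u <= b -> 0 < u by move=> /andP[/(lt_le_trans a0)].
have dF u : a <= u <= b -> is_derive u 1 (fun v : R => v `^ t) (t * u `^ (t - 1)).
  by move=> /pos u0; exact: is_derive1_powR.
have [dF1 dF2] := derivable_LR dF ab.
have [dG1 dG2] := derivable_LR (fun u _ => derivable_expRN u) ab.
have := @integration_by_parts R (fun v => v `^ t) (fun v => - expR (- v))
  (fun v => t * v `^ (t - 1)) (fun v => expR (- v)) a b ab.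
have -> : (\int[mu]_(u in `[a, b]) (f (t + 1) u)%:E =
    \int[mu]_(u in `[a, b]) (u `^ t * expR (- u))%:E)%E.
  by apply: eq_integral => u _; rewrite /f addrK.
move=> ->//; last 2 first.
- apply: continuous_within_itv => u /pos u0; apply: cvgM; first exact: cvg_cst.
  exact: continuous_powR_at.
- apply: continuous_within_itv => u _; apply: continuous_comp.
    exact: opp_continuous.
  exact: continuous_expR.
have -> : (\int[mu]_(u in `[a, b]) (t * u `^ (t - 1) * - expR (- u))%:E =
    - (t%:E * \int[mu]_(u in `[a, b]) (f t u)%:E))%E.
  rewrite -ge0_integralZl_EFin//; last 3 first.
  - by move=> u _; rewrite lee_fin.
  - exact: measurable_f.
  - exact: ltW.
  rewrite -integral_ge0N//; last first.
    by move=> u _; rewrite lee_fin mulr_ge0// ltW.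
  by apply: eq_integral => u _; rewrite -EFinM -EFinN /f mulrN mulrA.
by rewrite oppeK; congr (_%:E + _)%E; ring.
Qed.

Let a_ k : R := k.+1%:R^-1.
Let b_ k : R := k.+2%:R.

Let cvg_I t : (\int[mu]_(u in `[a_ k, b_ k]) (f t u)%:E @[k --> \oo] --> I t)%E.
Proof.
have -> : I t = (\int[mu]_(u in \bigcup_k [set` `[a_ k, b_ k]%R]) (f t u)%:E)%E.
  congr (integral _ _ _); apply/seteqP; split => u /=.
    rewrite in_itv /= andbT => u0.
    pose k := (Num.truncn u + Num.truncn u^-1)%N.
    exists k => //=; rewrite in_itv /=; apply/andP; split.
      rewrite /a_ invf_ple ?posrE//; apply/ltW.
      rewrite (lt_le_trans (truncnS_gt _))// ler_nat ltnS leq_addl //.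
    apply/ltW; rewrite (lt_le_trans (truncnS_gt _))// ler_nat ltnS.
    exact: leq_trans (leq_addr _ _) (leqnSn _).
  move=> [k _] /=; rewrite !in_itv /= andbT => /andP[ak _].
  by rewrite (lt_le_trans _ ak)// invr_gt0.
apply: ge0_nondecreasing_set_cvg_integral => //.
- move=> k l kl; apply/subsetPset => u /=; rewrite !in_itv /= => /andP[ku uk].
  rewrite (le_trans _ ku) ?(le_trans uk)//.
    by rewrite ler_nat !ltnS.
  by rewrite lef_pV2 ?posrE// ler_nat ltnS.
- by move=> k; exact: measurable_f.
- by move=> k u _; rewrite lee_fin.
Qed.

Let cvg_a t : 0 < t -> a_ k `^ t * expR (- a_ k) @[k --> \oo] --> 0.
Proof.
move=> t0; apply: (@squeeze_cvgr _ _ _ _ (cst 0) (fun k => a_ k `^ t)).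
- near=> k; rewrite mulr_ge0 ?powR_ge0 ?expR_ge0//= ler_piMr ?powR_ge0//.
  by rewrite -expR0 ler_expR oppr_le0 invr_ge0.
- exact: cvg_cst.
- apply: ((cvg_at_rightP (fun u => u `^ t) 0 0).1 (powR_cvg0 t0)); split.
    by move=> k; rewrite invr_gt0.
  exact: cvg_harmonic.
Unshelve. all: by end_near. Qed.

Let cvg_b t : 0 < t -> b_ k `^ t * expR (- b_ k) @[k --> \oo] --> 0.
Proof.
(* [M] exceeds t, and e^b >= b^(M + 1) / (M + 1)! leaves a factor 1 / b. *)
move=> t0; pose M := (Num.truncn t).+1; pose C : R := (M.+1)`!%:R.
apply: (@squeeze_cvgr _ _ _ _ (cst 0) (fun k => C * a_ k)).
- near=> k; rewrite mulr_ge0 ?powR_ge0 ?expR_ge0//=.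
  have b0 : 0 < b_ k by rewrite ltr0n.
  have b1 : 1 <= b_ k by rewrite ler1n.
  have C0 : 0 < C by rewrite ltr0n fact_gt0.
  apply: (@le_trans _ _ (C * (b_ k)^-1)); last first.
    by rewrite ler_pM2l// lef_pV2 ?posrE// ler_nat.
  rewrite expRN ler_pdivrMr ?expR_gt0//.
  apply: (@le_trans _ _ (b_ k ^+ M)).
    rewrite -powR_mulrn ?(ltW b0)//; apply: ler_powR => //.
    exact/ltW/truncnS_gt.
  have -> : b_ k ^+ M = C * (b_ k)^-1 * (b_ k ^+ M.+1 / C).
    by rewrite exprS; field; rewrite !gt_eqF.
  rewrite ler_wpM2l ?mulr_ge0 ?invr_ge0 ?(ltW b0) ?(ltW C0)//.
  by apply: le_trans (expR_ge1Dxn M (ltW b0)); rewrite lerDr ler01.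
- exact: cvg_cst.
- rewrite -[X in _ --> X](mulr0 C); apply: cvgM; first exact: cvg_cst.
  exact: cvg_harmonic.
Unshelve. all: by end_near. Qed.

(** Integration by parts on [1 / (k + 1), k + 2], where the boundary terms tend to 0, combined with
    monotone convergence. The identity holds in the extended reals, before finiteness is known. *)
Let I_rec t : 0 < t -> I (t + 1) = (t%:E * I t)%E.
Proof.
move=> t0; rewrite -(cvg_lim (@ereal_hausdorff R) (@cvg_I (t + 1))).
apply: cvg_lim; first exact: ereal_hausdorff.
have E : (fun k => \int[mu]_(u in `[a_ k, b_ k]) (f (t + 1) u)%:E)%E =
   (fun k => (a_ k `^ t * expR (- a_ k) - b_ k `^ t * expR (- b_ k))%:E +
     t%:E * \int[mu]_(u in `[a_ k, b_ k]) (f t u)%:E)%E.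
  apply/funext => k; apply: by_parts => //; first by rewrite invr_gt0.
  by apply: (@le_lt_trans _ _ 1); rewrite ?ltr1n// /a_ invf_le1 ?ler1n ?ltr0n.
rewrite E -[(t%:E * I t)%E]add0e; apply: cvgeD.
- by rewrite fin_num_adde_defr.
- apply: cvg_EFin; first by near=> k.
  rewrite /comp /= -[X in _ --> X](subr0 (0 : R)).
  by apply: cvgB; [exact: cvg_a|exact: cvg_b].
- by apply: cvgeZl => //; exact: cvg_I.
Unshelve. all: by end_near. Qed.

Let I1_lty : (I 1 < +oo)%E.
Proof.
have d u := derivable_expRN u.
apply: (@le_lt_trans _ _ (\int[mu]_(u in `[0%R, +oo[) (expR (- u))%:E)%E).
  have -> : I 1 = (\int[mu]_(u in `]0%R, +oo[) (expR (- u))%:E)%E.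
    by apply: eq_integral => u _; rewrite /f subrr powRr0 mul1r.
  apply: ge0_subset_integral => //.
  - by apply/measurable_EFinP; exact: measurable_expRN.
  - by move=> u /=; rewrite !in_itv /= !andbT => /ltW.
have -> : (\int[mu]_(u in `[0%R, +oo[) (expR (- u))%:E =
    0%:E - (- expR (- 0))%:E)%E.
  apply: (@ge0_continuous_FTC2y _ (fun u => expR (- u)) (fun u => - expR (- u))).
  - by move=> u _; rewrite expR_ge0.
  - apply: continuous_subspaceT => u; apply: continuous_comp.
      exact: opp_continuous.
    exact: continuous_expR.
  - by rewrite -oppr0; apply: cvgN; exact: cvgr_expR.
  - by move=> u _; exact: (@ex_derive _ _ _ _ _ _ _ (d u)).
  - by apply: cvg_at_right_filter; exact: derivable_continuous_at (d 0).
  - by move=> u _; rewrite derive1E; exact: (@derive_val _ _ _ _ _ _ _ (d u)).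
by rewrite -EFinB ltry.
Qed.

Let Inat_lty k : (I k.+1%:R < +oo)%E.
Proof.
elim: k => [|k IH]; first exact: I1_lty.
by rewrite -(natr1 k.+1) I_rec// lte_mul_pinfty// lee_fin.
Qed.

Let I_ge0 t : (0 <= I t)%E.
Proof. by apply: integral_ge0 => u _; rewrite lee_fin. Qed.

(** For arguments at least 1 the integrand is dominated by e^(-u) up to u = 1 and by an integer
    power times e^(-u) beyond. Smaller t follow from the recurrence: an infinite [I t] would make
    [I (t + 1)] infinite. *)
Let I_lty t : 0 < t -> (I t < +oo)%E.
Proof.
have ge1 s : 1 <= s -> (I s < +oo)%E.
  move=> s1; pose k := Num.truncn s.
  apply: (@le_lt_trans _ _ (\int[mu]_(u in `]0%R, +oo[) ((f 1 u)%:E + (f k.+2%:R u)%:E))%E).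
    apply: ge0_le_integral => //.
    - by move=> u _; rewrite lee_fin.
    - exact: measurable_f.
    - by apply: emeasurable_funD; exact: measurable_f.
    - move=> u /=; rewrite in_itv /= andbT => u0; rewrite -EFinD lee_fin.
      rewrite /f subrr powRr0 -(natr1 k.+1) addrK -mulrDl ler_wpM2r ?expR_ge0//.
      have [u1|u1] := leP u 1.
        rewrite ler_wpDr ?powR_ge0//.
        have : u `^ (s - 1) <= 1 `^ (s - 1).
          by apply: ge0_ler_powR; rewrite ?nnegrE ?subr_ge0 ?ler01// ltW.
        by rewrite powR1.
      rewrite ler_wpDl ?ler01//; apply: ler_powR; first exact: ltW.
      by apply/ltW/(lt_trans _ (truncnS_gt s)); rewrite ltrBlDr ltrDl.
  have f0 r u : `]0%R, +oo[%classic u -> (0 <= (f r u)%:E)%E by rewrite lee_fin.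
  rewrite (ge0_integralD mu (measurable_itv _) (f0 1) _ (f0 k.+2%:R)).
  - by apply: lte_add_pinfty; [exact: I1_lty|exact: Inat_lty].
  - exact: measurable_f.
  - exact: measurable_f.
move=> t0; have : (I (t + 1) < +oo)%E by rewrite ge1// lerDr ltW.
rewrite (I_rec t0); have := I_ge0 t; case: (I t) => [r _ _| |] //; first exact: ltry.
by rewrite gt0_muley ?lte_fin// ltxx.
Qed.

Let I_gt0 t : 0 < t -> (0 < I t)%E.
Proof.
(* On [1, 2] one has u^(t - 1) >= u^-1 >= 1/2 and e^(-u) >= e^(-2). *)
move=> t0; pose c : R := 2^-1 * expR (- 2).
have c0 : 0 < c by rewrite mulr_gt0 ?invr_gt0 ?expR_gt0.
apply: (@lt_le_trans _ _ (\int[mu]_(u in `[1%R, 2%R]) (f t u)%:E)%E); last first.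
  apply: ge0_subset_integral => //; first exact: measurable_f.
    by move=> u _; rewrite lee_fin.
  by move=> u /=; rewrite !in_itv /= andbT => /andP[/(lt_le_trans ltr01)].
apply: (@lt_le_trans _ _ (\int[mu]_(u in `[1%R, 2%R]) cst c%:E u)%E).
  rewrite integral_cst//= lebesgue_measure_itv /= lte_fin ltr1n.
  by rewrite -EFinB -EFinM lte_fin mulr_gt0// subr_gt0 ltr1n.
apply: ge0_le_integral => //.
- by move=> u _; rewrite lee_fin ltW.
- exact: measurable_f.
- move=> u /=; rewrite in_itv /= => /andP[u1 u2]; rewrite lee_fin.
  have u0 : 0 < u by exact: lt_le_trans u1.
  apply: ler_pM; rewrite ?invr_ge0 ?expR_ge0//.
    apply: (@le_trans _ _ (u `^ (- 1))).
      by rewrite powR_inv1 ?(ltW u0)// lef_pV2 ?posrE.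
    by apply: ler_powR => //; rewrite lerBrDr addNr ltW.
  by rewrite ler_expR lerN2.
Qed.

Lemma Gamma_pos_gt0 t : 0 < t -> 0 < Gamma_pos t.
Proof.
by move=> t0; apply: fine_gt0; apply/andP; split; [exact: I_gt0|exact: I_lty].
Qed.

Lemma Gamma_posS t : 0 < t -> Gamma_pos (t + 1) = t * Gamma_pos t.
Proof.
move=> t0; rewrite -[LHS]/(fine (I (t + 1))) (I_rec t0) fineM//.
by rewrite (ge0_fin_numE (I_ge0 t)) I_lty.
Qed.

(** For t > 0 both shifts are 0. For t < 0 the shift of t exceeds that of t + 1 by one, so both
    sides evaluate Euler's integral at the same point and the products differ by the factor t. *)
Lemma GammaS t : t != 0 -> Gamma (t + 1) = t * Gamma t.
Proof.
move=> tn0; rewrite /Gamma opprD addrCA subrr addr0.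
have [t0|t0] := ltP 0 t.
  have -> : Num.truncn (- t) = 0%N by apply/truncn0Pn; rewrite -ltNge (lt_trans _ ltr01)// oppr_lt0.
  have -> : Num.truncn (1 - t) = 0%N by apply/truncn0Pn; rewrite -ltNge ltrBlDr ltrDl.
  by rewrite !big_ord0 !divr1 !addr0; exact: Gamma_posS.
have -> : Num.truncn (1 - t) = (Num.truncn (- t)).+1.
  have t0' : 0 <= - t by rewrite oppr_ge0.
  have /andP[h1 h2] := truncn_itv t0'; move: h1 h2; set N := Num.truncn _ => h1 h2.
  apply: truncn_def; move: h2; rewrite -(natr1 N.+1) -(natr1 N) => h2.
  by apply/andP; split; lra.
set N := Num.truncn _; rewrite big_ord_recl /= addr0 -natr1.
rewrite (_ : t + (N%:R + 1) = t + 1 + N%:R); last by ring.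
have -> : \prod_(i < N) (t + (bump 0 i)%:R) = \prod_(i < N) (t + 1 + i%:R).
  by apply: eq_bigr => i _; rewrite /bump leq0n add1n -(natr1 i); ring.
by rewrite invfM [RHS]mulrCA (mulrA t) divff// mul1r.
Qed.

Lemma Gamma_neq0 t : (forall i : nat, t + i%:R != 0) -> Gamma t != 0.
Proof.
move=> tN; rewrite /Gamma; set N := Num.truncn _.
rewrite mulf_neq0// ?invr_eq0; last by apply/prodf_neq0 => i _.
rewrite gt_eqF// Gamma_pos_gt0//.
have : 1 - t < N.+1%:R by exact: truncnS_gt.
by rewrite -natr1 ltrBlDr addrAC -ltrBlDr subrr addrC.
Qed.

End GammaRecurrence.

(** * Boundary operators *)

Section BoundaryCovariance.
Context {R : realType} {n : nat}.
Local Notation pt := ('rV[R]_n * R)%type.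
Implicit Types (U V : pt -> R) (W : set pt) (x : 'rV[R]_n).

(* The common form of [cB_even] (with [t = fracpart gamma] and [g = gamma]) and
   of [cB_odd] (with [t = - fracpart gamma] and [g = gamma - 2 * fracpart gamma]). *)
Definition bdry_coef (t g : R) (j l : nat) : R :=
  'C(j, l)%:R *
  ((Gamma (1 + j%:R - t) * Gamma (1 + 2 * j%:R - 2 * l%:R - g)) /
   (Gamma (1 + j%:R - l%:R - t) * Gamma (1 + 2 * j%:R - l%:R - g))).

Lemma normal_constS (t : R) j :
  normal_const t j.+1 = normal_const t j * (4 * j.+1%:R * (j.+1%:R - t)).
Proof. by rewrite /normal_const big_ord_recr. Qed.

Variables (t g : R).
Hypothesis tN : forall k : nat, k%:R - t != 0.
Hypothesis gN : forall k : nat, k%:R - g != 0.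

Let normal_const_neq0 j : normal_const t j != 0.
Proof.
apply/prodf_neq0 => l _; rewrite mulf_neq0// mulf_neq0// ?pnatr_eq0//.
Qed.

Let Gamma_shift_neq0 (c : R) (k : nat) : (forall k : nat, k%:R - c != 0) ->
  Gamma (k%:R - c) != 0.
Proof. by move=> cN; apply: Gamma_neq0 => i; rewrite addrAC -natrD. Qed.

Lemma bdry_coef0 j : bdry_coef t g j 0 = 1.
Proof.
rewrite /bdry_coef bin0 mul1r mulr0 !subr0 divff//.
have -> : 1 + j%:R - t = j.+1%:R - t by rewrite -(natr1 j); ring.
have -> : 1 + 2 * j%:R - g = (2 * j).+1%:R - g.
  by rewrite -(natr1 (2 * j)) natrM; ring.
by rewrite mulf_neq0// Gamma_shift_neq0.
Qed.

(** Solving the recursion of the boundary operators for the jet of order l gives this coefficient of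
    [iter (l - i) laplbar (phi i)]; the sign is its own inverse. *)
Definition bdry_series (l i : nat) : R :=
  (-1) ^+ l * bdry_coef t g l (l - i) / normal_const t l.

(** At fixed i two of the four Gamma factors depend on i only; the other two and the binomial change
    by rational factors when l grows by 1. The resulting (l + 1) (l + 1 - t) cancels against the new
    factor of [normal_const], so that t disappears from the recursion. *)
Lemma bdry_series_rec i l : (i <= l)%N ->
  4 * (l.+1%:R - i%:R) * (l.+1%:R + i%:R - g) * bdry_series l.+1 i =
  - bdry_series l i.
Proof.
move=> il; have -> : l = (i + (l - i))%N by rewrite subnKC.
set d := (l - i)%N; rewrite /bdry_series -addnS !addKn addnS normal_constS.
have E1 : bdry_coef t g (i + d).+1 d.+1 * (d.+1%:R * (1 + 2 * i%:R + d%:R - g)) =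
    bdry_coef t g (i + d) d * ((i + d).+1%:R * ((i + d).+1%:R - t)).
  have bin : d.+1%:R * 'C((i + d).+1, d.+1)%:R = (i + d).+1%:R * 'C(i + d, d)%:R :> R.
    by rewrite -!natrM -mul_bin_diag.
  rewrite /bdry_coef.
  have G1 : Gamma (1 + (i + d).+1%:R - t) =
      ((i + d).+1%:R - t) * Gamma (1 + (i + d)%:R - t).
    rewrite [RHS](_ : _ = (1 + (i + d)%:R - t) * Gamma (1 + (i + d)%:R - t)).
      rewrite -GammaS; first by congr Gamma; rewrite -(natr1 (i + d)); ring.
      by have := tN (i + d).+1; rewrite -natr1 [_ + 1]addrC.
    by congr (_ * _); rewrite -(natr1 (i + d)); ring.
  have c0 : 1 + 2 * i%:R + d%:R - g != 0.
    have := gN (2 * i + d).+1; rewrite -natr1 natrD natrM.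
    by rewrite (_ : 2 * i%:R + d%:R + 1 - g = 1 + 2 * i%:R + d%:R - g)//; ring.
  have G2 : Gamma (1 + 2 * (i + d).+1%:R - d.+1%:R - g) =
      (1 + 2 * i%:R + d%:R - g) * Gamma (1 + 2 * (i + d)%:R - d%:R - g).
    have -> : 1 + 2 * (i + d)%:R - d%:R - g = 1 + 2 * i%:R + d%:R - g.
      by rewrite natrD; ring.
    rewrite -GammaS//; congr Gamma.
    by rewrite -(natr1 (i + d)) -(natr1 d) natrD; ring.
  have -> : 1 + (i + d).+1%:R - d.+1%:R - t = 1 + (i + d)%:R - d%:R - t.
    by rewrite -(natr1 (i + d)) -(natr1 d); ring.
  have -> : 1 + 2 * (i + d).+1%:R - 2 * d.+1%:R - g =
      1 + 2 * (i + d)%:R - 2 * d%:R - g.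
    by rewrite -(natr1 (i + d)) -(natr1 d); ring.
  rewrite G1 G2.
  set G := Gamma (1 + 2 * (i + d)%:R - 2 * d%:R - g).
  set H := Gamma (1 + (i + d)%:R - t); set K := Gamma (1 + (i + d)%:R - d%:R - t).
  set L := Gamma (1 + 2 * (i + d)%:R - d%:R - g).
  set c := 1 + 2 * i%:R + d%:R - g in c0 *.
  move: bin; set C1 := 'C(_, _)%:R; set C2 := 'C(i + d, d)%:R => bin.
  clearbody G H K L c C1 C2; rewrite !invfM.
  transitivity (d.+1%:R * C1 *
    (((i + d).+1%:R - t) * H * G * (K^-1 * L^-1)) * (c^-1 * c)); first by ring.
  by rewrite mulVf// bin; ring.
have s0 : ((i + d).+1%:R : R) != 0 by rewrite pnatr_eq0.
have t0 := tN (i + d).+1; have nc0 := normal_const_neq0 (i + d).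
rewrite exprS.
have -> : 4 * ((i + d).+1%:R - i%:R) * ((i + d).+1%:R + i%:R - g) =
    4 * (d.+1%:R * (1 + 2 * i%:R + d%:R - g)) :> R.
  by rewrite -(natr1 (i + d)) -(natr1 d) natrD; ring.
set c := d.+1%:R * _ in E1 *; set b := bdry_coef t g (i + d).+1 _ in E1 *.
set b' := bdry_coef t g (i + d) d in E1 *.
set e := (i + d).+1%:R in s0 t0 E1 *; set nc := normal_const t _ in nc0 *.
clearbody c b b' e nc.
transitivity (- ((-1) ^+ (i + d) * (b * c) / (nc * (e * (e - t))))).
  by field; rewrite nc0 s0 t0.
by rewrite E1; field; rewrite nc0 s0 t0.
Qed.

(* The recursion satisfied by the boundary values of a function whose terms
   [(-1) ^ j * restr0 (T ^ j _)], or their odd analogues, are read off [V]. *)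
Definition bdry_recursion V (phi : nat -> 'rV[R]_n -> R) := forall j x, x <> 0 ->
  phi j x = (-1) ^+ j * normal_const t j * jet j V x -
    \sum_(1 <= l < j.+1) bdry_coef t g j l * iter l laplbar (phi (j - l)%N) x.

Lemma expansion_bdry (phi : nat -> 'rV[R]_n -> R) l x :
  (-1) ^+ l * normal_const t l * expansion bdry_series phi l x =
  phi l x + \sum_(1 <= k < l.+1) bdry_coef t g l k * iter k laplbar (phi (l - k)%N) x.
Proof.
rewrite /expansion mulr_sumr (reindex_inj rev_ord_inj) /=.
have -> : phi l x = bdry_coef t g l 0 * iter 0 laplbar (phi (l - 0)%N) x.
  by rewrite bdry_coef0 mul1r subn0.
rewrite -(@big_ltn _ _ _ 0 l.+1 (fun k => bdry_coef t g l k * iter k laplbar (phi (l - k)%N) x))//.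
rewrite big_mkord; apply: eq_bigr => -[k /= kl] _.
rewrite subSS subKn// /bdry_series subKn//.
have s2 : (-1) ^+ l * (-1) ^+ l = 1 :> R by rewrite -exprMn mulrNN mulr1 expr1n.
move: (iter _ _ _ _) (bdry_coef t g l k) (normal_const_neq0 l) => Z c nc0.
transitivity ((-1) ^+ l * (-1) ^+ l * (c * Z)); last by rewrite s2 mul1r.
by field.
Qed.

Lemma bdry_recursion_expansion V phi : bdry_recursion V phi ->
  forall l x, x <> 0 -> jet l V x = expansion bdry_series phi l x.
Proof.
move=> rec l x x0.
have c0 : (-1) ^+ l * normal_const t l != 0.
  by rewrite mulf_neq0// signr_eq0.
apply: (mulfI c0); rewrite expansion_bdry rec// subrK.
by [].
Qed.

(** Since [bdry_coef t g l 0] is 1, the coefficient of order l determines the l-th function from the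
    earlier ones. *)
Lemma expansion_bdry_recursion V phi psi : bdry_recursion V phi ->
  (forall l x, x <> 0 -> jet l V x = expansion bdry_series psi l x) ->
  forall l x, x <> 0 -> phi l x = psi l x.
Proof.
move=> rec EV; elim/ltn_ind => l IH x x0.
rewrite rec// EV// expansion_bdry.
rewrite [X in _ - X](@eq_big_nat _ _ _ _ _ _ (fun k =>
  bdry_coef t g l k * iter k laplbar (psi (l - k)%N) x)) ?addrK// => k /andP[k0 kl].
congr (_ * _); apply: eqon_iter_laplbar => // z z0; apply: IH => //.
by rewrite ltn_subrL k0 (leq_trans k0).
Qed.

Lemma bdry_recursion_smooth W V phi : bdry_nbhd W -> smooth_on W V ->
  bdry_recursion V phi -> forall j, smooth_bdry (phi j).
Proof.
move=> bW sV rec; elim/ltn_ind => j IH.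
apply: (smooth_bdry_eq (f := fun x => (-1) ^+ j * normal_const t j * jet j V x +
  -1 * \sum_(l < j) bdry_coef t g j l.+1 * iter l.+1 laplbar (phi (j - l.+1)%N) x)).
  by move=> x x0; rewrite rec// mulN1r big_add1 /= big_mkord.
apply: smooth_bdryD; first by apply: smooth_bdryZ; exact: smooth_jet bW sV.
apply: smooth_bdryZ; apply: smooth_bdry_sum => l; apply: smooth_bdryZ.
apply: (smooth_iter_laplbar l.+1); apply: IH.
by rewrite ltn_subrL (leq_trans _ (ltn_ord l)).
Qed.

Lemma bdry_recursion_kelvin W V phi phi' : bdry_nbhd W -> smooth_on W V ->
  bdry_recursion V phi -> bdry_recursion (kelvin (2 * g - n%:R) V) phi' ->
  forall j x, x <> 0 ->
    phi' j x = kelvin_trace (2 * g - n%:R - 4 * j%:R) (phi j) x.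
Proof.
move=> bW sV rec rec'; apply: (expansion_bdry_recursion rec').
apply: (jet_kelvin (bdry_recursion_smooth bW sV rec) gN bdry_series_rec bW sV).
exact: bdry_recursion_expansion.
Qed.

End BoundaryCovariance.

(** * Covariance of the boundary operators *)

Section MainTheorem.
Context {R : realType} {n : nat}.
Local Notation pt := ('rV[R]_n * R)%type.
Implicit Types (U V : pt -> R) (W : set pt) (x : 'rV[R]_n).

Variable gamma : R.
Hypotheses (gamma_gt0 : 0 < gamma) (gammaN : gamma \isn't a Num.nat).
Local Notation s := (fracpart gamma).

Lemma fracpart_itv : 0 < s < 1.
Proof.
have /andP[h1 h2] := truncn_itv (ltW gamma_gt0).
rewrite /fracpart /intpart subr_gt0 lt_neqAle h1 andbT -natrEtruncn gammaN /=.
by rewrite ltrBlDr addrC natr1.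
Qed.

Let s01 := fracpart_itv.

(** An integer never equals s; k - gamma and k - (gamma - 2s) take this form up to sign, as gamma is
    [intpart gamma] + s. *)
Let nat_subs (k l : nat) : k%:R - l%:R - s != 0.
Proof.
have /andP[s0 s1] := s01; have [kl|lk] := leqP k l.
  by rewrite lt_eqF// subr_lt0 (le_lt_trans _ s0)// subr_le0 ler_nat.
rewrite gt_eqF// subr_gt0 (lt_le_trans s1)// -natrB 1?ltnW// ler1n.
by rewrite subn_gt0.
Qed.

Lemma natB_fracpart k : k%:R - s != 0.
Proof. by have := nat_subs k 0; rewrite subr0. Qed.

Lemma natD_fracpart k : k%:R - - s != 0.
Proof.
by have /andP[s0 _] := s01; rewrite opprK gt_eqF// ltr_wpDl.
Qed.

Lemma natB_gamma k : k%:R - gamma != 0.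
Proof.
have := nat_subs k (intpart gamma).
by rewrite /fracpart (_ : k%:R - _ - (gamma - _) = k%:R - gamma)//; ring.
Qed.

Lemma natB_gamma_fracpart k : k%:R - (gamma - 2 * s) != 0.
Proof.
have := nat_subs (intpart gamma) k; rewrite -oppr_eq0.
rewrite (_ : - ((intpart gamma)%:R - k%:R - s) = k%:R - (gamma - 2 * s))//.
by rewrite /fracpart; ring.
Qed.

(* The even part and, up to the factor [y ^ (2 * s)], the odd part of [U]. *)
Definition bdry_split U W VF VG := [/\ bdry_nbhd W, smooth_on W VF, smooth_on W VG,
  (forall i, odd i -> van (dy i VF)) /\ (forall i, odd i -> van (dy i VG)) &
  forall p, above W p -> U p = VF p + p.2 `^ (2 * s) * VG p].

Lemma adapted_bdry_split U : adapted gamma U -> exists W VF VG, bdry_split U W VF VG.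
Proof.
move=> [F [G [[WF [VF [oF sWF sVF FE evF]]] [WG [VG [oG sWG sVG GE evG]]] UE]]].
have cb x : x <> 0 -> chalf0 (x, 0) by move=> x0; split => //=; exact: bdry_neq0.
have odd_iter i V : (forall (k : nat) x, x <> 0 ->
    iter (2 * k + 1) (fun Z : pt -> R => 'D_e_y Z) V (x, 0) = 0) -> odd i -> van (dy i V).
  move=> evV oi x x0.
  have -> : i = (2 * i./2 + 1)%N.
    by rewrite addnC mul2n -[LHS]odd_double_half oi.
  exact: evV.
exists (WF `&` WG), VF, VG; split.
- split; first exact: openI.
  by move=> x x0; split; [apply: sWF|apply: sWG]; exact: cb.
- by apply: smooth_sub sVF => p [].
- by apply: smooth_sub sVG => p [].
- by split => i; exact: odd_iter.
- move=> p [_ /chalf0_upper p2]; rewrite UE// FE// GE//.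
Qed.

(** As y o Phi = r^-2 y, the factor y^(2s) becomes r^(-4s) y^(2s), which lowers the weight of the
    second part by 4s; evenness in y is preserved by parity. *)
Lemma bdry_split_kelvin (a : R) U W VF VG : bdry_split U W VF VG ->
  bdry_split (kelvin a U) (kelvin_dom W) (kelvin a VF) (kelvin (a - 4 * s) VG).
Proof.
move=> [bW sF sG [oF oG] UE]; have bK := bdry_nbhd_kelvin bW.
have van_kelvin b V : smooth_on W V -> (forall i, odd i -> van (dy i V)) ->
    forall i, odd i -> van (dy i (kelvin b V)).
  move=> sV oV i oi; apply: (@van_dy_kelvin _ _ W i b V bW sV) => k _ ki.
  by apply: oV; rewrite ki.
split => //.
- by apply: smooth_kelvin => //; exact: bW.1.
- by apply: smooth_kelvin => //; exact: bW.1.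
- by split; exact: van_kelvin.
- move=> p [[p0 Wp] p2]; rewrite /kelvin UE; last first.
    by split => //; exact: upper_inv.
  have -> : (inv_half p).2 = r_half p `^ (- 2) * p.2 by exact: (coord_inv None).
  rewrite powRM ?powR_ge0//; last exact: ltW.
  rewrite -powRrM mulrDr; congr (_ + _).
  have -> : r_half p `^ (a - 4 * s) = r_half p `^ a * r_half p `^ (- 2 * (2 * s)).
    by rewrite -r_half_powRD//; congr (_ `^ _); ring.
  by move: (VG _) => *; ring.
Qed.

Lemma B_even_recursion U W VF VG : bdry_split U W VF VG ->
  bdry_recursion s gamma VF (fun j => B_even gamma j U).
Proof.
move=> [bW sF sG [oF oG] UE] j x x0; rewrite B_evenE; congr (_ - _).
rewrite -mulrA; congr (_ * _).
by apply: (restr0_even bW x0 s01 sF sG _ _ UE) => i oi; [exact: oF|exact: oG].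
Qed.

Lemma cB_oddE j l : cB_odd gamma j l = bdry_coef (- s) (gamma - 2 * s) j l.
Proof.
rewrite /cB_odd /bdry_coef opprK.
have e (a : R) : a - (intpart gamma)%:R + s = a - (gamma - 2 * s).
  by rewrite /fracpart; ring.
by rewrite !e.
Qed.

(** The constant - 2s absorbs the factor 2s from [restr0_odd] and the sign (-1)^(j + 1), where the
    common recursion has (-1)^j. *)
Lemma B_odd_recursion U W VF VG : bdry_split U W VF VG ->
  bdry_recursion (- s) (gamma - 2 * s) (fun p => - (2 * s) * VG p)
    (fun j => B_odd gamma j U).
Proof.
move=> [bW sF sG [oF oG] UE] j x x0; rewrite B_oddE; congr (_ - _).
  have -> : restr0 (fun p => p.2 `^ mwt gamma * 'D_e_y (iter j (Top (mwt gamma)) U) p) x =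
      2 * s * normal_const (- s) j * jet j VG x.
    by apply: (restr0_odd bW x0 s01 sF sG _ _ UE) => i oi; [exact: oF|exact: oG].
  have -> : jet j (fun p => - (2 * s) * VG p) x = - (2 * s) * jet j VG x.
    rewrite -[RHS]addr0 -(mul0r (jet j VG x)) -(jet_lin _ _ _ bW sG sG x0).
    by apply: (eqon_jet j bW _ x0) => p _; rewrite mul0r addr0.
  by rewrite (exprS _ j); move: (jet j VG x) (normal_const (- s) j) => *; ring.
by apply: eq_bigr => l _; rewrite cB_oddE.
Qed.

(** The boundary values of r^(2 gamma - n) U are traces of those of U o Phi with weight 2g - n - 4j.
    For g = gamma, alpha = j and for g = gamma - 2s, alpha = s + j alike, this is 2 gamma - n - 4
    alpha, which the prefactor cancels. *)
Lemma hat_bdry_op (alpha : R) B U : bdry_op gamma alpha B -> adapted gamma U ->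
  forall x, x <> 0 -> hat_bdry B U x = r_bdry x `^ (n%:R - 2 * gamma + 4 * alpha) *
    B (fun q => r_half q `^ (2 * gamma - n%:R) * U q) x.
Proof.
move=> HB aU x x0; have [W [VF [VG HU]]] := adapted_bdry_split aU.
have HV := bdry_split_kelvin 0 HU; have HV' := bdry_split_kelvin (2 * gamma - n%:R) HV.
have E0 : U \o inv_half = kelvin 0 U.
  by apply/funext => p; rewrite /kelvin powRr0 mul1r.
have HB' : bdry_split (fun q => r_half q `^ (2 * gamma - n%:R) * U q)
    (kelvin_dom (kelvin_dom W)) (kelvin (2 * gamma - n%:R) (kelvin 0 VF))
    (kelvin (2 * gamma - n%:R - 4 * s) (kelvin (0 - 4 * s) VG)).
  have [b1 b2 b3 b4 b5] := HV'; split => // p pA; rewrite -b5//.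
  have p0 : p <> 0 by case: pA => -[].
  by rewrite /kelvin powRr0 mul1r inv_halfK.
have [bW sF sG _ _] := HV.
have cancel (a c d : R) : a + c = 0 -> r_bdry x `^ a * (r_bdry x `^ c * d) = d.
  move=> ac; rewrite mulrA -!r_half_bdry -r_half_powRD; last exact: bdry_neq0.
  by rewrite ac powRr0 mul1r.
rewrite /hat_bdry /= E0; case: HB => j _.
  rewrite (bdry_recursion_kelvin natB_fracpart natB_gamma bW sF
    (B_even_recursion HV) (B_even_recursion HB') j x0).
  by rewrite /kelvin_trace cancel//; ring.
have rec := B_odd_recursion HV; have rec' := B_odd_recursion HB'.
have sG' : smooth_on (kelvin_dom W) (fun p => - (2 * s) * kelvin (0 - 4 * s) VG p).
  by apply: smooth_scale => //; exact: bW.1.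
(* The loss of 4s in the weight of the odd part is exactly the passage from gamma to gamma - 2s. *)
have EK : (fun p => - (2 * s) * kelvin (2 * gamma - n%:R - 4 * s) (kelvin (0 - 4 * s) VG) p) =
    kelvin (2 * (gamma - 2 * s) - n%:R) (fun p => - (2 * s) * kelvin (0 - 4 * s) VG p).
  apply/funext => p; rewrite kelvinZ; congr (_ * kelvin _ _ _); ring.
rewrite EK in rec'.
rewrite (bdry_recursion_kelvin natD_fracpart natB_gamma_fracpart bW sG' rec rec' j x0).
by rewrite /kelvin_trace cancel//; ring.
Qed.

End MainTheorem.

Theorem theorem4p4 (R : realType) (n : nat) (hn : (1 <= n)%N) (gamma : R)
    (gamma_gt0 : 0 < gamma) (gammaN : gamma \isn't a Num.nat) :
  (forall U : hpoint R n -> R, adapted gamma U ->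
    forall p : hpoint R n, 0 < p.2 ->
      hat_int (Lop gamma) U p =
        r_half p `^ (n%:R - 2 * fracpart gamma + 4 + 2 * (intpart gamma)%:R) *
        Lop gamma (fun q => r_half q `^ (2 * gamma - n%:R) * U q) p) /\
  (forall (alpha : R) (B : (hpoint R n -> R) -> 'rV[R]_n -> R),
    bdry_op gamma alpha B ->
    forall U : hpoint R n -> R, adapted gamma U ->
    forall x : 'rV[R]_n, x <> 0 ->
      hat_bdry B U x =
        r_bdry x `^ (n%:R - 2 * gamma + 4 * alpha) *
        B (fun q => r_half q `^ (2 * gamma - n%:R) * U q) x).
Proof.
split; first by move=> U aU p p2; exact: hat_int_Lop.
by move=> alpha B HB U aU x x0; exact: hat_bdry_op.
Qed.
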